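(* Fix $\alpha,\beta>0$. The following are equivalent. (a) There is a constant $C_{\alpha,\beta}$ such that \[\sup_{\tau\in\mathbb{R}}\int_{S_\tau}|P(s)|^2\left(\sigma-\tfrac12\right)^{\beta-1}dm_1(s)\leq C_{\alpha,\beta}\|P\|_{\mathcal{D}_\alpha}^2\] for every Dirichlet polynomial $P$, where $S_\tau=[1/2,1]\times[\tau,\tau+1]=\{\sigma+it:1/2\le\sigma\le1,\ \tau\le t\le\tau+1\}$, $s=\sigma+it$, and $m_1$ is Lebesgue area measure. (b) For every $\varphi\in\mathcal{G}$ with characteristic $c_0=0$, the composition operator $\mathcal{C}_\varphi f=f\circ\varphi$ maps $\mathcal{D}_\alpha$ boundedly into $\mathcal{D}_\beta$. (c) With $\mathcal{T}(z)=\frac12+\frac{1-z}{1+z}$ and $\psi(s)=\mathcal{T}(2^{-s})$, the composition operator $\mathcal{C}_\psi$ maps $\mathcal{D}_\alpha$ boundedly into $\mathcal{D}_\beta$.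
   Context: For $\alpha\in\mathbb{R}$, $\mathcal{D}_\alpha$ is the Hilbert space of Dirichlet series $f(s)=\sum_{n\ge1}a_nn^{-s}$ with $\|f\|_{\mathcal{D}_\alpha}^2=\sum_{n\ge1}|a_n|^2/[d(n)]^\alpha<\infty$, where $d(n)$ is the number of divisors of $n$; such series converge absolutely in $\mathbb{C}_{1/2}$, where $\mathbb{C}_\theta=\{s:\operatorname{Re}s>\theta\}$. The Gordon–Hedenmalm class $\mathcal{G}$ consists of functions $\varphi:\mathbb{C}_{1/2}\to\mathbb{C}_{1/2}$ of the form $\varphi(s)=c_0s+\varphi_0(s)$, $\varphi_0(s)=\sum_{n\ge1}c_nn^{-s}$, where $c_0$ (the characteristic) is a non-negative integer, $\varphi_0$ converges uniformly in $\mathbb{C}_\varepsilon$ for every $\varepsilon>0$, and: if $c_0=0$ then $\varphi_0(\mathbb{C}_0)\subset\mathbb{C}_{1/2}$; if $c_0\ge1$ then either $\varphi_0\equiv0$ or $\varphi_0(\mathbb{C}_0)\subset\mathbb{C}_0$. *)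

(* Defs.v *)
From mathcomp Require Import all_boot all_order all_algebra.
From mathcomp Require Import all_classical all_reals all_analysis.
From mathcomp Require Import complex.
Import Order.TTheory GRing.Theory Num.Theory.
Import numFieldNormedType.Exports.

Set Implicit Arguments.
Unset Strict Implicit.
Unset Printing Implicit Defensive.

Local Open Scope ring_scope.
Local Open Scope classical_set_scope.
Local Open Scope complex_scope.

Section Defs.
Variable R : realType.
Local Notation C := R[i].

Definition cabs2 (z : C) : R := complex.Re z ^+ 2 + complex.Im z ^+ 2.

Definition ccvg (u : nat -> C) (z : C) : Prop :=
  ((fun n => complex.Re (u n)) @ \oo --> complex.Re z) /\ ((fun n => complex.Im (u n)) @ \oo --> complex.Im z).

(* n^{-s} = exp(-s log n) = n^{-Re s} (cos(Im s log n) - i sin(Im s log n)) *)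
Definition npow (n : nat) (s : C) : C :=
  let r := (n%:R : R) `^ (- complex.Re s) in
  let th := complex.Im s * ln (n%:R : R) in
  (r * cos th) -i* (r * sin th).

Definition ndiv (n : nat) : R := (size (divisors n))%:R.

Definition dpartial (a : nat -> C) (s : C) (N : nat) : C :=
  \sum_(1 <= n < N.+1) a n * npow n s.

Definition dser_to (a : nat -> C) (s : C) (z : C) : Prop := ccvg (dpartial a s) z.

Definition Dnorm2 (alpha : R) (a : nat -> C) : \bar R :=
  (\sum_(1 <= n <oo) ((cabs2 (a n)) / (ndiv n `^ alpha))%:E)%E.

Definition inD (alpha : R) (a : nat -> C) : Prop := (Dnorm2 alpha a < +oo)%E.

Definition trunc (N : nat) (a : nat -> C) : nat -> C :=
  fun n => if (n <= N)%N then a n else 0.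

Definition Srect (tau : R) : set (R * R) :=
  [set p | 2^-1 <= p.1 <= 1 /\ tau <= p.2 <= tau + 1].

Definition area := (@lebesgue_measure R \x @lebesgue_measure R)%E.

Definition carleson_int (beta : R) (N : nat) (a : nat -> C) (tau : R) : \bar R :=
  (\int[area]_(p in Srect tau)
     (cabs2 (dpartial a (p.1 +i* p.2) N) * (p.1 - 2^-1) `^ (beta - 1))%:E)%E.

Definition comp_bounded (alpha beta : R) (phi : C -> C) : Prop :=
  exists K : R, forall a : nat -> C, inD alpha a ->
    exists b : nat -> C,
      inD beta b /\ (Dnorm2 beta b <= K%:E * Dnorm2 alpha a)%E /\
      forall s : C, 2^-1 < complex.Re s ->
        exists z : C, dser_to a (phi s) z /\ dser_to b s z.

(* phi in the Gordon-Hedenmalm class with characteristic c0 = 0: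
   phi = phi_0 = sum_{n>=1} c_n n^{-s}, converging uniformly on every C_eps,
   and phi_0(C_0) subset C_{1/2} *)
Definition GH_char0 (c : nat -> C) (phi : C -> C) : Prop :=
  (forall eps : R, 0 < eps ->
     forall e : R, 0 < e -> exists N0 : nat, forall N : nat, (N0 <= N)%N ->
       forall s : C, eps < complex.Re s -> Num.sqrt (cabs2 (phi s - dpartial c s N)) < e)
  /\ (forall s : C, 0 < complex.Re s -> 2^-1 < complex.Re (phi s)).

Definition Tmap (z : C) : C := 2^-1 + (1 - z) / (1 + z).
Definition psi (s : C) : C := Tmap (npow 2 s).

End Defs.

(* Main.v *)
Require Import Defs.
From mathcomp Require Import all_boot all_order all_algebra.
From mathcomp Require Import all_classical all_reals all_analysis.
From mathcomp Require Import measurable_realfun complex ring lra zify.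
Import Order.TTheory GRing.Theory Num.Theory.
Import numFieldNormedType.Exports.
Set Implicit Arguments.
Unset Strict Implicit.
Unset Printing Implicit Defensive.
Local Open Scope ring_scope.
Local Open Scope classical_set_scope.
Local Open Scope complex_scope.
Local Notation ReC := (@complex.Re _).
Local Notation ImC := (@complex.Im _).

(**
  Boundedness from the Carleson condition. Write kappa = Re c_1 - 1/2 > 0 and let
  Omega count prime factors with multiplicity. The coefficients c of phi satisfy
  Re sum c_d f_k conj(f_{dk}) >= 1/2 |f|^2, because the mean over vertical lines of
  Re phi |F|^2 is bounded below; a Harnack argument in the variable r of the twist
  n |-> r^Omega(n) improves 1/2 to 1/2 + y for r = (kappa - y) / (kappa + y).
  Hence each exp(- t (phi - 1/2 - y)) acts as a contraction for the norm
  sum r^(2 Omega(n)) |b_n|^2, and peeling off the terms of P o phi one at a time gives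
  sum r^(2 Omega(n)) |b_n|^2 <= (Poisson average of |P|^2 on the line Re s = 1/2 + y).
  Integrating against y^(beta - 1) dy turns the left side into
  sum |b_n|^2 / (1 + Omega(n))^beta, which dominates the norm of D_beta since
  d(n) >= 1 + Omega(n), and the right side into a weighted sum of Carleson integrals
  over unit squares.

  The Carleson condition from boundedness of C_psi. The coefficients of P o psi are
  supported on powers of 2, where d(2^k) = k + 1. Integrating
  |P (psi (s) + i g)|^2 over circles |2^-s| = (1 - q) / (1 + q) against
  q^(beta - 1) dq dg gives at most a constant times the norm of P, while psi maps the
  arcs |arg 2^-s| <= pi / 3 onto curves along which Re psi - 1/2 is comparable to q, so
  that a change of variables recovers the Carleson integral.
*)

(** The twist is tied to [bigOmega] rather than to the divisor function because only the former is
    completely additive: n -> r^Omega(n) dilates all prime variables of the Bohr lift at once, so it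
    respects Dirichlet convolution, and rotating the same variables reduces the improvement of the
    bound to Harnack's inequality in a disc. The inequality d(n) >= 1 + Omega(n) is an equality at
    prime powers; as psi only produces powers of 2, nothing is lost in the return direction. The
    link between coefficients and integrals is the algebraic [poisson_form]. Peeling bounds the
    twisted norm of P o phi by it for every symbol. When the symbol carries the circle |2^-s| = 1 to
    the imaginary line, each peeled factor has modulus one and the estimate becomes an identity,
    which exhibits the form as a Poisson average. A general phi is known only through uniform limits
    on the half-planes Re s > eps, so P o phi has no boundary values to integrate. Positivity is
    therefore expressed by quadratic forms in finitely many coefficients. *)

Definition modc {R : realType} (z : R[i]) : R := Num.sqrt (cabs2 z).

Lemma cabs2_ge0 (R : realType) (z : R[i]) : 0 <= cabs2 z.
Proof. by rewrite addr_ge0 ?sqr_ge0. Qed.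

Lemma modc_ge0 (R : realType) (z : R[i]) : 0 <= modc z.
Proof. exact: sqrtr_ge0. Qed.

Lemma sqr_modc (R : realType) (z : R[i]) : modc z ^+ 2 = cabs2 z.
Proof. exact/sqr_sqrtr/cabs2_ge0. Qed.

Lemma cabs2M (R : realType) (a b : R[i]) : cabs2 (a * b) = cabs2 a * cabs2 b.
Proof. case: a b => [a1 a2] [b1 b2]; rewrite /cabs2 /=; ring. Qed.

Lemma modcM (R : realType) (a b : R[i]) : modc (a * b) = modc a * modc b.
Proof. by rewrite /modc cabs2M sqrtrM ?cabs2_ge0. Qed.

Lemma modcN (R : realType) (a : R[i]) : modc (- a) = modc a.
Proof. by case: a => a1 a2; rewrite /modc /cabs2 /= !sqrrN. Qed.

Lemma modcB (R : realType) (a b : R[i]) : modc (a - b) = modc (b - a).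
Proof. by rewrite -modcN opprB. Qed.

Lemma modcE (R : realType) (z : R[i]) : `|z| = (modc z)%:C.
Proof. by rewrite normc_def. Qed.

Lemma modcD (R : realType) (a b : R[i]) : modc (a + b) <= modc a + modc b.
Proof. by have := ler_normD a b; rewrite !modcE -rmorphD lecR. Qed.

Lemma modc0 (R : realType) : modc (0 : R[i]) = 0.
Proof. by rewrite /modc /cabs2 /= expr0n addr0 sqrtr0. Qed.

Lemma modc1 (R : realType) : modc (1 : R[i]) = 1.
Proof. by rewrite /modc /cabs2 /= expr0n addr0 expr1n sqrtr1. Qed.

Lemma modc_real (R : realType) (x : R) : modc x%:C = `|x|.
Proof. by rewrite /modc /cabs2 /= expr0n addr0 sqrtr_sqr. Qed.

Lemma modc_conj (R : realType) (z : R[i]) : modc (conjc z) = modc z.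
Proof. by case: z => a b; rewrite /modc /cabs2 /= sqrrN. Qed.

Lemma modcX (R : realType) (z : R[i]) n : modc (z ^+ n) = modc z ^+ n.
Proof.
by elim: n => [|n IH]; rewrite ?expr0 ?modc1 // !exprS modcM IH.
Qed.

Lemma modcV (R : realType) (z : R[i]) : modc z^-1 = (modc z)^-1.
Proof.
have [->|z0] := eqVneq z 0; first by rewrite invr0 modc0 invr0.
have h : modc z * modc z^-1 = 1 by rewrite -modcM mulfV ?modc1.
have nz : modc z != 0.
  by apply/eqP => e; move: h; rewrite e mul0r => /eqP; rewrite eq_sym oner_eq0.
by rewrite -[RHS]mulr1 -h mulrA mulVf ?mul1r.
Qed.

Lemma modc_sum (R : realType) (I : Type) (r : seq I) (P : pred I)
    (F : I -> R[i]) :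
  modc (\sum_(i <- r | P i) F i) <= \sum_(i <- r | P i) modc (F i).
Proof.
elim/big_rec2: _ => [|i x y _ le]; first by rewrite modc0.
by apply: (le_trans (modcD _ _)); rewrite lerD2l.
Qed.

Lemma le_ReC_modc (R : realType) (z : R[i]) : `|ReC z| <= modc z.
Proof.
by rewrite -sqrtr_sqr ler_sqrt ?lerDl ?sqr_ge0 ?cabs2_ge0.
Qed.

Lemma le_ImC_modc (R : realType) (z : R[i]) : `|ImC z| <= modc z.
Proof.
by rewrite -sqrtr_sqr ler_sqrt ?lerDr ?sqr_ge0 ?cabs2_ge0.
Qed.

Lemma modc_le_ReIm (R : realType) (z : R[i]) : modc z <= `|ReC z| + `|ImC z|.
Proof.
rewrite -(ler_pXn2r (n := 2)) ?nnegrE ?modc_ge0 ?addr_ge0 // sqr_modc.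
rewrite sqrrD !real_normK ?num_real // /cabs2.
by have := mulr_ge0 (normr_ge0 (ReC z)) (normr_ge0 (ImC z)); lra.
Qed.

Lemma modc_eq0 (R : realType) (z : R[i]) : modc z <= 0 -> z = 0.
Proof.
case: z => a b h.
have ha := le_trans (le_ReC_modc _) h; have hb := le_trans (le_ImC_modc _) h.
by move: ha hb => /=; rewrite !normr_le0 => /eqP -> /eqP ->.
Qed.

Lemma ReC_sum (R : realType) (I : Type) (r : seq I) (P : pred I)
    (F : I -> R[i]) :
  ReC (\sum_(i <- r | P i) F i) = \sum_(i <- r | P i) ReC (F i).
Proof. by elim/big_rec2: _ => // i x y _ <-; case: (F i) y => ? ? []. Qed.

Lemma ImC_sum (R : realType) (I : Type) (r : seq I) (P : pred I)
    (F : I -> R[i]) :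
  ImC (\sum_(i <- r | P i) F i) = \sum_(i <- r | P i) ImC (F i).
Proof. by elim/big_rec2: _ => // i x y _ <-; case: (F i) y => ? ? []. Qed.

Lemma ReCD (R : realType) (a b : R[i]) : ReC (a + b) = ReC a + ReC b.
Proof. by case: a b => ? ? []. Qed.

Lemma ReCN (R : realType) (a : R[i]) : ReC (- a) = - ReC a.
Proof. by case: a. Qed.

Lemma ReC_realM (R : realType) (x : R) (a : R[i]) : ReC (x%:C * a) = x * ReC a.
Proof. by case: a => ? ? /=; rewrite mul0r subr0. Qed.

Lemma mulC_conj (R : realType) (z : R[i]) : z * conjc z = (cabs2 z)%:C.
Proof.
by case: z => a b; apply/eqP; rewrite eq_complex /= /cabs2 /=; apply/andP; split;
  apply/eqP; ring.
Qed.

Lemma cabs2D (R : realType) (a b : R[i]) :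
  cabs2 (a + b) = cabs2 a + cabs2 b + 2 * ReC (a * conjc b).
Proof. case: a b => [a1 a2] [b1 b2]; rewrite /cabs2 /=; ring. Qed.

Lemma cabs2_realM (R : realType) (x : R) (a : R[i]) :
  cabs2 (x%:C * a) = x ^+ 2 * cabs2 a.
Proof. by rewrite cabs2M {1}/cabs2 /= expr0n addr0. Qed.

Lemma cabs2_le (R : realType) (z : R[i]) (B : R) :
  modc z <= B -> cabs2 z <= B ^+ 2.
Proof. by move=> h; rewrite -sqr_modc lerXn2r ?nnegrE ?modc_ge0 // (le_trans _ h) ?modc_ge0. Qed.

Lemma modc_le_sqrt (R : realType) (z : R[i]) (B : R) :
  0 <= B -> cabs2 z <= B ^+ 2 -> modc z <= B.
Proof.
by move=> B0 h; rewrite -(ler_pXn2r (n := 2)) ?nnegrE ?modc_ge0 // sqr_modc.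
Qed.

Lemma cabs2_addle (R : realType) (a b : R[i]) :
  cabs2 (a + b) <= 2 * cabs2 a + 2 * cabs2 b.
Proof.
case: a b => [a1 a2] [b1 b2]; rewrite /cabs2 /=.
by have := sqr_ge0 (a1 - b1); have := sqr_ge0 (a2 - b2); nra.
Qed.

(** * The complex exponential *)

Definition cexp {R : realType} (z : R[i]) : R[i] :=
  (expR (ReC z) * cos (ImC z)) +i* (expR (ReC z) * sin (ImC z)).

Lemma cexpD (R : realType) (a b : R[i]) : cexp (a + b) = cexp a * cexp b.
Proof.
case: a b => [a1 a2] [b1 b2]; rewrite /cexp /= expRD cosD sinD.
by apply/eqP; rewrite eq_complex /=; apply/andP; split; apply/eqP; ring.
Qed.

Lemma cexp0 (R : realType) : cexp (0 : R[i]) = 1.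
Proof. by rewrite /cexp /= expR0 cos0 sin0 mulr1 mulr0. Qed.

Lemma modc_cexp (R : realType) (z : R[i]) : modc (cexp z) = expR (ReC z).
Proof.
rewrite /modc /cabs2 /= !exprMn -mulrDr cos2Dsin2 mulr1.
by rewrite sqrtr_sqr ger0_norm ?expR_ge0.
Qed.

Lemma cexp_natmul (R : realType) (z : R[i]) n : cexp (z *+ n) = cexp z ^+ n.
Proof.
by elim: n => [|n IH]; rewrite ?mulr0n ?cexp0 // mulrS cexpD IH exprS.
Qed.

Lemma npow_cexp (R : realType) n (s : R[i]) : (0 < n)%N ->
  npow n s = cexp (- ((ln (n%:R : R))%:C * s)).
Proof.
move=> n0; rewrite /npow /cexp; case: s => a b /=.
have n0' : (n%:R : R) != 0 by rewrite pnatr_eq0 -lt0n.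
rewrite /powR (negbTE n0') !mul0r !subr0 addr0 cosN sinN mulrN.
by rewrite [- a * _]mulNr ![ln _ * _]mulrC.
Qed.

Lemma npowM (R : realType) m n (s : R[i]) : (0 < m)%N -> (0 < n)%N ->
  npow (m * n) s = npow m s * npow n s.
Proof.
move=> m0 n0; rewrite !npow_cexp ?muln_gt0 ?m0 // -cexpD; congr cexp.
rewrite natrM lnM ?posrE ?ltr0n // rmorphD /= mulrDl opprD //.
Qed.

Lemma npow1 (R : realType) (s : R[i]) : npow 1 s = 1.
Proof. by rewrite npow_cexp // ln1 mul0r oppr0 cexp0. Qed.

Lemma modc_npow (R : realType) n (s : R[i]) : (0 < n)%N ->
  modc (npow n s) = (n%:R : R) `^ (- ReC s).
Proof.
move=> n0; rewrite npow_cexp // modc_cexp; case: s => a b /=.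
have n0' : (n%:R : R) != 0 by rewrite pnatr_eq0 -lt0n.
by rewrite /powR (negbTE n0') mul0r subr0 mulNr mulrC.
Qed.

Lemma npowD (R : realType) n (s t : R[i]) : (0 < n)%N ->
  npow n (s + t) = npow n s * npow n t.
Proof. by move=> n0; rewrite !npow_cexp // -cexpD; congr cexp; ring. Qed.

(** Only the tangent inequality at x and at -x is used: the second, multiplied by e^x, gives e^x (1
    - x) <= 1, hence e^x <= 2 and the quadratic remainder. *)
Lemma expR_sub1_le (R : realType) (x : R) : `|x| <= 2^-1 ->
  `|expR x - 1 - x| <= 2 * x ^+ 2.
Proof.
move=> hx; have [h1 h2] : - 2^-1 <= x /\ x <= 2^-1 by move: hx; rewrite ler_norml => /andP[].
have a := expR_ge1Dx x; have b := expR_ge1Dx (- x).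
have c := expRN x; have d := expR_gt0 x.
have e : expR x * expR (- x) = 1 by rewrite c mulfV ?gt_eqF.
have z : 0 <= expR x - 1 - x by lra.
rewrite ger0_norm //.
have f : expR x * (1 - x) <= 1 by rewrite -[leRHS]e ler_wpM2l // ltW.
have g : expR x <= 2 by nra.
nra.
Qed.

Lemma sin_mean_value (R : realType) (x : R) :
  exists2 c, `|c| <= `|x| & sin x = cos c * x.
Proof.
wlog x0 : x / 0 <= x.
  move=> H; case: (lerP 0 x) => h; first exact: H.
  have [|c c1 c2] := H (- x); first by rewrite oppr_ge0 ltW.
  exists c; first by rewrite -(normrN x).
  by move: c2; rewrite sinN mulrN => /oppr_inj.
have [c] : exists2 c, c \in `[0, x]%R & sin x - sin 0 = cos c * (x - 0).
  apply: MVT_segment => //.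
  by apply: continuous_subspaceT => y; exact: continuous_sin.
rewrite sin0 !subr0 in_itv /= => /andP[c0 cx] ->; exists c => //.
by rewrite !ger0_norm.
Qed.

Lemma sin_le_norm (R : realType) (x : R) : `|sin x| <= `|x|.
Proof.
have [c _ ->] := sin_mean_value x; rewrite normrM ler_piMl ?normr_ge0 //.
exact: cos_max.
Qed.

Lemma cos_sub1_le (R : realType) (x : R) : `|cos x - 1| <= x ^+ 2 / 2.
Proof.
have -> : cos x = 1 - 2 * sin (x / 2) ^+ 2.
  have e : x = x / 2 + x / 2 by field.
  rewrite {1}e cosD; have := cos2Dsin2 (x / 2); nra.
rewrite addrAC subrr add0r normrN; have p : 0 <= 2 * sin (x / 2) ^+ 2.
  by rewrite mulr_ge0 // sqr_ge0.
rewrite ger0_norm //.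
have := sin_le_norm (x / 2).
have h : `|sin (x / 2)| ^+ 2 <= `|x / 2| ^+ 2 -> 2 * sin (x / 2) ^+ 2 <= x ^+ 2 / 2.
  by rewrite !real_normK ?num_real // => ?; lra.
by move=> ?; apply: h; rewrite lerXn2r ?nnegrE.
Qed.

Lemma cexp_sub1_le (R : realType) (h : R[i]) : modc h <= 2^-1 ->
  modc (cexp h - 1 - h) <= 4 * modc h ^+ 2.
Proof.
move=> hh; have ha := le_trans (le_ReC_modc h) hh.
have hb := le_trans (le_ImC_modc h) hh.
rewrite sqr_modc; apply: (le_trans (modc_le_ReIm _)).
case: h ha hb {hh} => a b /= ha hb; rewrite /cabs2 /=.
have [c c1 c2] := sin_mean_value b.
have e1 := expR_sub1_le ha; have e2 := cos_sub1_le b.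
have e3 := cos_sub1_le c; have e4 := sin_le_norm b.
have -> : expR a * cos b - 1 - a = (expR a - 1 - a) * cos b + (1 + a) * (cos b - 1).
  by ring.
have -> : expR a * sin b - 0 - b = (expR a - 1) * sin b + (cos c - 1) * b.
  by rewrite !c2; ring.
have f1 : `|(expR a - 1 - a) * cos b| <= 2 * a ^+ 2.
  rewrite normrM; apply: le_trans e1; rewrite ler_piMr ?normr_ge0 //; exact: cos_max.
have f2 : `|(1 + a) * (cos b - 1)| <= b ^+ 2.
  rewrite normrM; have g : `|1 + a| <= 2.
    by move: ha; rewrite !ler_norml => /andP[? ?]; apply/andP; split; lra.
  have := ler_pM (normr_ge0 _) (normr_ge0 _) g e2; have := sqr_ge0 b; lra.
have f3 : `|(expR a - 1) * sin b| <= 2 * (`|a| * `|b|).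
  rewrite normrM; have g : `|expR a - 1| <= 2 * `|a|.
    have -> : expR a - 1 = (expR a - 1 - a) + a by ring.
    apply: (le_trans (ler_normD _ _)).
    have := normr_ge0 a; have := real_normK (num_real a); nra.
  have := ler_pM (normr_ge0 _) (normr_ge0 _) g e4; lra.
have f4 : `|(cos c - 1) * b| <= b ^+ 2.
  rewrite normrM; have g : `|cos c - 1| <= `|b|.
    apply: (le_trans e3); rewrite -(real_normK (num_real c)).
    have := normr_ge0 c; nra.
  by have := ler_pM (normr_ge0 _) (normr_ge0 _) g (lexx `|b|); rewrite -expr2 real_normK ?num_real.
have := ler_normD ((expR a - 1 - a) * cos b) ((1 + a) * (cos b - 1)).
have := ler_normD ((expR a - 1) * sin b) ((cos c - 1) * b).
have : 2 * (`|a| * `|b|) <= a ^+ 2 + b ^+ 2.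
  have := sqr_ge0 (`|a| - `|b|); rewrite sqrrB !real_normK ?num_real //; lra.
have := sqr_ge0 a; have := sqr_ge0 b; lra.
Qed.

Lemma modc_subX_le (R : realType) (a b : R[i]) (M : R) n :
  modc a <= M -> modc b <= M ->
  modc (a ^+ n - b ^+ n) <= n%:R * M ^+ n.-1 * modc (a - b).
Proof.
move=> ha hb; have M0 : 0 <= M := le_trans (modc_ge0 _) ha.
rewrite subrXX modcM mulrC ler_wpM2r ?modc_ge0 //.
apply: (le_trans (modc_sum _ _ _)).
have -> : n%:R * M ^+ n.-1 = \sum_(i < n) M ^+ n.-1.
  by rewrite sumr_const card_ord mulr_natl.
apply: ler_sum => i _; rewrite modcM !modcX.
have -> : M ^+ n.-1 = M ^+ (n.-1 - i) * M ^+ i.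
  by rewrite -exprD subnK // -ltnS prednK // (leq_ltn_trans _ (ltn_ord i)).
by rewrite ler_pM ?exprn_ge0 ?modc_ge0 ?lerXn2r ?nnegrE ?modc_ge0.
Qed.

(** With h = w / (J + 1), the difference of the powers (e^h)^(J+1) and (1 + h)^(J+1) telescopes into
    J + 1 terms, each at most e^B |e^h - 1 - h|, so the error is O(1 / J) uniformly on discs. This
    lets an exponential of a symbol be replaced by iterated polynomial steps. *)
Lemma cexp_euler (R : realType) (B e : R) : 0 < e ->
  exists J0 : nat, forall J, (J0 <= J)%N -> forall w : R[i], modc w <= B ->
    modc (cexp w - (1 + w / J.+1%:R) ^+ J.+1) <= e.
Proof.
move=> e0; set K := 4 * expR `|B| * B ^+ 2.
(* The summand 2|B| forces |h| <= 1/2; the summand K / e makes the final error K / (J + 1) at most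
   e. *)
exists (Num.trunc (K / e + 2 * `|B|)).+1 => J JJ w wB.
have B0 : 0 <= B := le_trans (modc_ge0 _) wB.
have J0 : (0 : R) < J.+1%:R by rewrite ltr0n.
have Kb : K / e + 2 * `|B| < J.+1%:R.
  by apply: (lt_le_trans (truncnS_gt _)); rewrite ler_nat ltnS ltnW.
have K0 : 0 <= K by rewrite mulr_ge0 ?sqr_ge0 // mulr_ge0 ?expR_ge0.
have Ke : 0 <= K / e by rewrite divr_ge0 // ltW.
have absB : `|B| = B by rewrite ger0_norm.
set h := w / J.+1%:R.
have mh : modc h = modc w / J.+1%:R.
  have -> : h = (J.+1%:R^-1)%:C * w by rewrite /h mulrC fmorphV rmorph_nat.
  by rewrite modcM modc_real ger0_norm ?invr_ge0 ?ler0n // mulrC.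
have h2 : modc h <= B / J.+1%:R by rewrite mh ler_wpM2r ?invr_ge0 ?ler0n.
have h1 : modc h <= 2^-1.
  apply: (le_trans h2); rewrite ler_pdivrMr //; lra.
have -> : cexp w = cexp h ^+ J.+1.
  by rewrite -cexp_natmul -[h *+ _]mulr_natr divfK ?pnatr_eq0.
have a1 : modc (cexp h) <= expR (B / J.+1%:R).
  rewrite modc_cexp ler_expR; apply: le_trans h2.
  exact: le_trans (ler_norm _) (le_ReC_modc _).
have a2 : modc (1 + h) <= expR (B / J.+1%:R).
  apply: (le_trans (modcD _ _)); rewrite modc1.
  by apply: (le_trans _ (expR_ge1Dx _)); rewrite lerD2l.
apply: (le_trans (modc_subX_le _ a1 a2)).
have -> : cexp h - (1 + h) = cexp h - 1 - h by ring.
have p1 : expR (B / J.+1%:R) ^+ J <= expR `|B|.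
  by rewrite -expRM_natl ler_expR absB mulrCA ler_piMr // ler_pdivrMr // mul1r ler_nat.
have p2 : modc (cexp h - 1 - h) <= 4 * (B / J.+1%:R) ^+ 2.
  apply: (le_trans (cexp_sub1_le h1)); rewrite ler_wpM2l //.
  by rewrite lerXn2r ?nnegrE ?modc_ge0 // divr_ge0.
have : J.+1%:R * expR (B / J.+1%:R) ^+ J * modc (cexp h - 1 - h) <=
   J.+1%:R * expR `|B| * (4 * (B / J.+1%:R) ^+ 2).
  by rewrite ler_pM ?modc_ge0 ?mulr_ge0 ?ler0n ?exprn_ge0 ?expR_ge0 // ler_wpM2l ?ler0n.
move/le_trans; apply.
have -> : J.+1%:R * expR `|B| * (4 * (B / J.+1%:R) ^+ 2) = K / J.+1%:R.
  by rewrite /K; field; rewrite lt0r_neq0.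
by rewrite ler_pdivrMr // mulrC -ler_pdivrMr //; lra.
Qed.

(** * Means of almost periodic sums *)

Definition cisN {R : realType} (x : R) : R[i] := cos x -i* sin x.

Lemma cisNE (R : realType) (x : R) : cisN x = cexp (0 -i* x).
Proof. by rewrite /cisN /cexp /= expR0 !mul1r cosN sinN. Qed.

Lemma cisND (R : realType) (x y : R) : cisN (x + y) = cisN x * cisN y.
Proof. by rewrite !cisNE -cexpD /=; congr cexp; apply/eqP; rewrite eq_complex /= addr0 opprD !eqxx. Qed.

Lemma cisN0 (R : realType) : cisN (0 : R) = 1.
Proof. by rewrite /cisN cos0 sin0 oppr0. Qed.

Lemma cisNpi (R : realType) : cisN (pi : R) = -1.
Proof. by rewrite /cisN cospi sinpi oppr0; apply/eqP; rewrite eq_complex /= oppr0 !eqxx. Qed.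

Lemma cisN_conj (R : realType) (x : R) : conjc (cisN x) = cisN (- x).
Proof. by rewrite /cisN /= cosN sinN. Qed.

(* Averaging X(t) and X(t + pi / mu) removes the frequency mu and leaves the
   constant term unchanged, so no limit of means is needed. *)
Lemma mean_ReC_ge (R : realType) (r : seq (R * R[i])) (x0 : R[i]) (B : R) :
  (forall t, B <= ReC (x0 + \sum_(p <- r) p.2 * cisN (p.1 * t))) ->
  B <= ReC (x0 + \sum_(p <- r | p.1 == 0) p.2).
Proof.
have [n] := ubnP (size r); elim: n r x0 => // n IH [|[mu x] r] x0 /= sr H.
  by have := H 0; rewrite !big_nil.
rewrite big_cons /=; case: eqP => [m0|/eqP m0].
  rewrite addrA; apply: IH => // t; have := H t.
  by rewrite big_cons /= m0 mul0r cisN0 mulr1 addrA.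
pose h := pi / mu.
have e : \sum_(p <- r | p.1 == 0) p.2 =
  \sum_(p <- [seq (p.1, p.2 * ((1 + cisN (p.1 * h)) / 2)) | p <- r] | p.1 == 0) p.2.
  rewrite big_map; apply: eq_bigr => p /eqP /= ->; rewrite mul0r cisN0.
  by field.
rewrite e; apply: IH => [|t]; first by rewrite size_map.
have := H t; have := H (t + h); rewrite !big_cons /= big_map /=.
rewrite mulrDr cisND [mu * h]mulrC divfK // cisNpi => h1 h2.
have -> : \sum_(p <- r) p.2 * ((1 + cisN (p.1 * h)) / 2) * cisN (p.1 * t) =
  2^-1 * (\sum_(p <- r) p.2 * cisN (p.1 * (t + h)) + \sum_(p <- r) p.2 * cisN (p.1 * t)).
  rewrite -big_split mulr_sumr /=; apply: eq_bigr => p _.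
  by rewrite [p.1 * (t + h)]mulrDr cisND; field.
set S1 := \sum_(_ <- r) _ in h1 *; set S2 := \sum_(_ <- r) _ in h2 *.
have -> : x0 + 2^-1 * (S1 + S2) = 2^-1 * ((x0 + (x * (cisN (mu * t) * -1) + S1)) + (x0 + (x * cisN (mu * t) + S2))).
  by field.
have -> : (2^-1 : R[i]) = (2^-1)%:C by rewrite fmorphV rmorph_nat.
rewrite ReC_realM ReCD; lra.
Qed.

Lemma mean_sum_ge (R : realType) (I : Type) (r : seq I) (x : I -> R[i])
    (mu : I -> R) (B : R) :
  (forall t, B <= ReC (\sum_(i <- r) x i * cisN (mu i * t))) ->
  B <= ReC (\sum_(i <- r | mu i == 0) x i).
Proof.
move=> H; have := @mean_ReC_ge R [seq (mu i, x i) | i <- r] 0 B.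
rewrite !big_map !add0r; apply => t; rewrite big_map add0r; exact: H.
Qed.

Lemma conjcM (R : realType) (a b : R[i]) : conjc (a * b) = conjc a * conjc b.
Proof. exact: rmorphM. Qed.

Lemma conjc_sum (R : realType) (I : Type) (r : seq I) (P : pred I)
    (F : I -> R[i]) :
  conjc (\sum_(i <- r | P i) F i) = \sum_(i <- r | P i) conjc (F i).
Proof. exact: (@rmorph_sum _ _ (@conjc R)). Qed.

Lemma conjc_zero (R : realType) : conjc (0 : R[i]) = 0.
Proof. by rewrite /conjc /= oppr0. Qed.

Lemma npow_line (R : realType) n (sigma t : R) : (0 < n)%N ->
  npow n (sigma +i* t) = ((n%:R `^ (- sigma))%:C * cisN (ln (n%:R) * t))%R.
Proof.
move=> n0; rewrite /npow /cisN /= [t * _]mulrC.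
by apply/eqP; rewrite eq_complex /= !mul0r subr0 addr0 mulrN !eqxx.
Qed.

Lemma lnn_eq (R : realType) m n : (0 < m)%N -> (0 < n)%N ->
  (ln (m%:R : R) - ln n%:R == 0) = (m == n).
Proof.
move=> m0 n0; apply/idP/eqP => [|->]; last by rewrite subrr.
rewrite subr_eq0 => /eqP /ln_inj; rewrite !posrE !ltr0n => /(_ m0 n0) /eqP.
by rewrite eqr_nat => /eqP.
Qed.

(** The product expands into the frequencies ln n - ln m; since ln is injective on positive
    integers, only the diagonal has frequency zero and survives the mean. *)
Lemma mean_dpartial_ge (R : realType) (g f : nat -> R[i]) (sigma B : R) N :
  (forall t, B <= ReC (dpartial g (sigma +i* t) N * conjc (dpartial f (sigma +i* t) N))) ->
  B <= \sum_(1 <= n < N.+1) ReC (g n * conjc (f n)) * (n%:R `^ (- sigma)) ^+ 2.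
Proof.
move=> H; pose x (q : nat -> R[i]) n := q n * (n%:R `^ (- sigma))%:C.
pose r := index_iota 1 N.+1.
have rP n : n \in r -> (0 < n)%N by rewrite mem_index_iota => /andP[].
have dE q t : dpartial q (sigma +i* t) N = \sum_(n <- r) x q n * cisN (ln n%:R * t).
  by rewrite /dpartial; apply: eq_big_seq => n /rP n0; rewrite npow_line // mulrA.
have := @mean_sum_ge R _ (allpairs pair r r) (fun p => x g p.1 * conjc (x f p.2))
  (fun p => ln p.1%:R - ln p.2%:R) B.
have E t : \sum_(i <- allpairs pair r r) x g i.1 * conjc (x f i.2) *
   cisN ((ln i.1%:R - ln i.2%:R) * t) =
   dpartial g (sigma +i* t) N * conjc (dpartial f (sigma +i* t) N).
  rewrite big_allpairs /= !dE mulr_suml; apply: eq_bigr => n _.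
  rewrite conjc_sum mulr_sumr; apply: eq_bigr => m _ /=.
  by rewrite [conjc (x f m * _)]conjcM cisN_conj mulrBl cisND; ring.
move=> K; apply: le_trans (K _) _ => [t|]; first by rewrite E.
rewrite big_mkcond big_allpairs /= ReC_sum.
rewrite le_eqVlt; apply/orP; left; apply/eqP.
apply: eq_big_nat => n /andP[n0 nN].
rewrite (@eq_big_nat _ _ _ _ _ _ (fun m => if m == n then x g n * conjc (x f m) else 0)).
  rewrite -big_mkcond big_nat1_eq n0 nN /x conjcM /= oppr0.
  case: (g n) (f n) => [a b] [a' b'] /=; ring.
by move=> m /andP[m0 _]; rewrite lnn_eq // eq_sym.
Qed.

(** The preceding lower bound, applied to the pair -q, q, becomes an upper bound for the mean
    square. *)
Lemma mean_dpartial_sqr (R : realType) (q : nat -> R[i]) (sigma B : R) N :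
  (forall t, cabs2 (dpartial q (sigma +i* t) N) <= B) ->
  \sum_(1 <= n < N.+1) cabs2 (q n) * (n%:R `^ (- sigma)) ^+ 2 <= B.
Proof.
move=> H; have := @mean_dpartial_ge R (fun n => - q n) q sigma (- B) N.
rewrite -lerN2 opprK -sumrN => h.
apply: le_trans (h _); last first.
  move=> t.
  have -> : dpartial (fun n => - q n) (sigma +i* t) N = - dpartial q (sigma +i* t) N.
    by rewrite /dpartial -sumrN; apply: eq_bigr => n _; rewrite mulNr.
  by rewrite mulNr ReCN mulC_conj /= lerN2.
apply: ler_sum => n _; rewrite mulNr ReCN mulNr opprK mulC_conj /=.
exact: lexx.
Qed.

(** * Dirichlet convolution *)

Definition dconv {V : comPzRingType} (u v : nat -> V) (n : nat) : V :=
  \sum_(1 <= d < n.+1 | (d %| n)%N) u d * v (n %/ d)%N.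

Lemma sum_multiples (V : nmodType) (G : nat -> V) d L : (0 < d)%N ->
  \sum_(1 <= n < L.+1 | (d %| n)%N) G (n %/ d)%N = \sum_(1 <= k < (L %/ d).+1) G k.
Proof.
move=> d0; elim: L => [|L IH]; first by rewrite div0n !big_geq.
rewrite big_mkcond big_nat_recr //= -big_mkcond /= IH divnS //.
have [h|h] := boolP (d %| L.+1)%N; last by rewrite add0n addr0.
by rewrite /= add1n [RHS]big_nat_recr //=.
Qed.

Lemma dvdn_sum_extend (V : nmodType) (F : nat -> V) n L : (0 < n <= L)%N ->
  \sum_(1 <= d < n.+1 | (d %| n)%N) F d = \sum_(1 <= d < L.+1 | (d %| n)%N) F d.
Proof.
move=> /andP[n0 nL]; rewrite [RHS](@big_cat_nat _ _ _ n.+1) //=.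
rewrite [X in _ + X]big1_seq ?addr0 // => d /andP[dn]; rewrite mem_index_iota.
by move=> /andP[h _]; have := dvdn_leq n0 dn; rewrite leqNgt h.
Qed.

(** Reordering by n = d k. With G = n^-s it multiplies Dirichlet polynomials; with a real power it
    bounds sums of divisor functions. *)
Lemma sum_dconv (V : comPzRingType) (u v : nat -> V) (G : nat -> V) L :
  (forall m n, (0 < m)%N -> (0 < n)%N -> G (m * n)%N = G m * G n) ->
  \sum_(1 <= n < L.+1) dconv u v n * G n =
  \sum_(1 <= d < L.+1) (u d * G d) * \sum_(1 <= k < (L %/ d).+1) v k * G k.
Proof.
move=> GM.
transitivity (\sum_(1 <= n < L.+1) \sum_(1 <= d < L.+1 | (d %| n)%N)
    (u d * G d) * (v (n %/ d)%N * G (n %/ d)%N)).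
  apply: eq_big_nat => n /andP[n0 nL].
  rewrite /dconv mulr_suml (@dvdn_sum_extend _ _ n L) ?n0 //.
  rewrite [LHS]big_nat_cond [RHS]big_nat_cond; apply: eq_bigr => d.
  move=> /andP[/andP[d0 _] dn].
  have -> : G n = G d * G (n %/ d)%N.
    have q0 : (0 < n %/ d)%N by rewrite divn_gt0 // dvdn_leq.
    by rewrite -(GM _ _ d0 q0) mulnC divnK.
  by ring.
rewrite (exchange_big_dep_nat (fun d => true)) //=.
apply: eq_big_nat => d /andP[d0 _]; rewrite -mulr_sumr.
by rewrite (sum_multiples (fun k => v k * G k)).
Qed.

Lemma dpartial_dconv (R : realType) (u v : nat -> R[i]) (s : R[i]) N M :
  (forall n, (N < n)%N -> u n = 0) -> (forall n, (M < n)%N -> v n = 0) ->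
  dpartial (dconv u v) s (N * M) = dpartial u s N * dpartial v s M.
Proof.
move=> u0 v0; case: (posnP M) => [->|M0].
  by rewrite muln0 /dpartial [LHS]big_geq // [X in _ * X]big_geq // mulr0.
rewrite /dpartial (@eq_big_nat _ _ _ _ _ _
  (fun n => dconv u v n * (if n is 0%N then 0 else npow n s))); last by case.
rewrite sum_dconv; last by case=> [|m] [|n] // _ _; rewrite -npowM.
rewrite mulr_suml (@big_cat_nat _ _ _ N.+1) //=; last by rewrite ltnS leq_pmulr.
rewrite [X in _ + X]big1_seq ?addr0; last first.
  move=> d /=; rewrite mem_index_iota => /andP[/u0 -> _].
  by rewrite !mul0r.
apply: eq_big_nat => -[//|d] /andP[_ dN]; congr (_ * _).
have Ml : (M <= (N * M) %/ d.+1)%N.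
  by rewrite leq_divRL // mulnC leq_mul2r -ltnS dN orbT.
rewrite (@big_cat_nat _ _ _ M.+1) //= [X in _ + X]big1_seq ?addr0; last first.
  by move=> k /=; rewrite mem_index_iota => /andP[/v0 -> _]; rewrite mul0r.
by apply: eq_big_nat => -[].
Qed.

Lemma dpartial_extend (R : realType) (q : nat -> R[i]) (s : R[i]) N N' :
  (N <= N')%N -> (forall n, (N < n)%N -> q n = 0) -> dpartial q s N' = dpartial q s N.
Proof.
move=> NN q0; rewrite /dpartial (@big_cat_nat _ _ _ N.+1) //=.
rewrite [X in _ + X]big1_seq ?addr0 // => k /=; rewrite mem_index_iota.
by move=> /andP[/q0 -> _]; rewrite mul0r.
Qed.

Lemma dpartialD (R : realType) (u v : nat -> R[i]) (s : R[i]) N :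
  dpartial (fun n => u n + v n) s N = dpartial u s N + dpartial v s N.
Proof. by rewrite /dpartial -big_split; apply: eq_bigr => n _; rewrite mulrDl. Qed.

Lemma dpartialZ (R : realType) (c : R[i]) (u : nat -> R[i]) (s : R[i]) N :
  dpartial (fun n => c * u n) s N = c * dpartial u s N.
Proof. by rewrite /dpartial mulr_sumr; apply: eq_bigr => n _; rewrite mulrA. Qed.

Lemma dpartialB (R : realType) (u v : nat -> R[i]) (s : R[i]) N :
  dpartial (fun n => u n - v n) s N = dpartial u s N - dpartial v s N.
Proof. by rewrite /dpartial -sumrB; apply: eq_bigr => n _; rewrite mulrBl. Qed.

Lemma powRN_le1 (R : realType) n (a : R) : (0 < n)%N -> 0 <= a -> (n%:R : R) `^ (- a) <= 1.
Proof.
move=> n0 a0; have n0' : (n%:R : R) != 0 by rewrite pnatr_eq0 -lt0n.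
rewrite /powR (negbTE n0') -[leRHS]expR0 ler_expR mulNr oppr_le0 mulr_ge0 //.
by rewrite ln_ge0 // ler1n.
Qed.

Lemma modc_npow_le1 (R : realType) n (s : R[i]) : (0 < n)%N -> 0 <= ReC s ->
  modc (npow n s) <= 1.
Proof. by move=> n0 s0; rewrite modc_npow // powRN_le1. Qed.

Lemma modc_dpartial_le (R : realType) (q : nat -> R[i]) N (s : R[i]) : 0 <= ReC s ->
  modc (dpartial q s N) <= \sum_(1 <= n < N.+1) modc (q n).
Proof.
move=> s0; apply: (le_trans (modc_sum _ _ _)).
apply: ler_sum_nat => n /andP[n0 _]; rewrite modcM ler_piMr ?modc_ge0 //.
exact: modc_npow_le1.
Qed.

(** * Uniform limits of Dirichlet polynomials *)

(* The coefficients converge one by one: no summability of [b] is asserted. *)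
Definition apx {R : realType} (eps : R) (S : pred nat) (F : R[i] -> R[i])
    (b : nat -> R[i]) : Prop :=
  forall e : R, 0 < e -> forall M : nat, exists N q,
    [/\ forall n, ~~ S n -> q n = 0, forall n, (N < n)%N -> q n = 0,
        forall s, eps < ReC s -> modc (F s - dpartial q s N) <= e &
        forall n, (0 < n <= M)%N -> modc (q n - b n) <= e].

(** The restriction e <= 1 allows terms in e^2 to be absorbed into e Z. *)
Lemma le_eps (R : realType) (X Y Z : R) :
  (forall e, 0 < e -> e <= 1 -> X <= Y + e * Z) -> X <= Y.
Proof.
move=> H; apply/ler_addgt0Pr => d d0.
have [Z0|Z0] := lerP Z 0.
  by apply: (le_trans (H 1 _ _)) => //; lra.
have := H (Num.min 1 (d / Z)); rewrite lt_min ltr01 divr_gt0 // ge_min lexx.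
move=> /(_ isT isT)/le_trans; apply; rewrite lerD2l -ler_pdivlMr //.
by rewrite ge_min lexx orbT.
Qed.

Section Apx.
Variables (R : realType) (eps : R) (S : pred nat).
Hypothesis eps0 : 0 <= eps.

Lemma apx_ext F G b c : apx eps S F b ->
  (forall s, eps < ReC s -> F s = G s) -> (forall n, (0 < n)%N -> b n = c n) ->
  apx eps S G c.
Proof.
move=> H FG bc e e0 M; have [N [q [h1 h2 h3 h4]]] := H e e0 M.
exists N, q; split => // [s es|n /andP[n0 nM]]; first by rewrite -FG ?h3.
by rewrite -bc // h4 // n0.
Qed.

Lemma apx_dpartial N (q : nat -> R[i]) : (forall n, ~~ S n -> q n = 0) ->
  (forall n, (N < n)%N -> q n = 0) -> apx eps S (fun s => dpartial q s N) q.
Proof.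
move=> q0 q1 e e0 M; exists N, q; split => // [s es|n _].
  by rewrite subrr modc0 ltW.
by rewrite subrr modc0 ltW.
Qed.

Lemma apx_const (c : R[i]) : S 1%N ->
  apx eps S (fun=> c) (fun n => if n == 1%N then c else 0).
Proof.
move=> S1; apply: (apx_ext (@apx_dpartial 1 (fun n => if n == 1%N then c else 0) _ _)) => //.
- by move=> n; case: eqP => [->|//]; rewrite S1.
- by case=> [|[|n]].
- by move=> s _; rewrite /dpartial big_nat1 npow1 mulr1.
Qed.

Lemma apx_add F G b c : apx eps S F b -> apx eps S G c ->
  apx eps S (fun s => F s + G s) (fun n => b n + c n).
Proof.
move=> H K e e0 M; have e2 : 0 < e / 2 by rewrite divr_gt0.
have [N [q [h1 h2 h3 h4]]] := H _ e2 M; have [N' [p [k1 k2 k3 k4]]] := K _ e2 M.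
exists (maxn N N'), (fun n => q n + p n); split.
- by move=> n nS; rewrite h1 // k1 // addr0.
- by move=> n; rewrite gtn_max => /andP[a b']; rewrite h2 // k2 // addr0.
- move=> s es; rewrite dpartialD (@dpartial_extend _ q _ N) ?leq_maxl //.
  rewrite (@dpartial_extend _ p _ N') ?leq_maxr // opprD addrACA.
  by apply: (le_trans (modcD _ _)); have := h3 s es; have := k3 s es; lra.
- move=> n nM; rewrite opprD addrACA.
  by apply: (le_trans (modcD _ _)); have := h4 n nM; have := k4 n nM; lra.
Qed.

Lemma apx_scale (c : R[i]) F b : apx eps S F b ->
  apx eps S (fun s => c * F s) (fun n => c * b n).
Proof.
move=> H e e0 M; have c0 : 0 < modc c + 1 by rewrite ltr_wpDl ?modc_ge0.
have [N [q [h1 h2 h3 h4]]] := H _ (divr_gt0 e0 c0) M.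
have cl : modc c * (e / (modc c + 1)) <= e.
  by rewrite mulrCA ler_piMr ?ltW // ltr_pdivrMr // mul1r ltrDl.
exists N, (fun n => c * q n); split.
- by move=> n nS; rewrite h1 ?mulr0.
- by move=> n nN; rewrite h2 ?mulr0.
- move=> s es; rewrite dpartialZ -mulrBr modcM; apply: le_trans cl.
  by rewrite ler_wpM2l ?modc_ge0 ?h3.
- move=> n nM; rewrite -mulrBr modcM; apply: le_trans cl.
  by rewrite ler_wpM2l ?modc_ge0 ?h4.
Qed.

Lemma apx_sub F G b c : apx eps S F b -> apx eps S G c ->
  apx eps S (fun s => F s - G s) (fun n => b n - c n).
Proof.
move=> H K; apply: (apx_ext (apx_add H (apx_scale (-1) K))) => *;
  by rewrite mulN1r.
Qed.

Lemma apx_bounded F b : apx eps S F b ->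
  exists2 B, 0 < B & forall s, eps < ReC s -> modc (F s) <= B.
Proof.
move=> H; have [N [q [_ _ h _]]] := H 1 ltr01 0%N.
exists (1 + \sum_(1 <= n < N.+1) modc (q n)).
  by rewrite ltr_wpDr // sumr_ge0 // => n _; exact: modc_ge0.
move=> s es; rewrite -(subrK (dpartial q s N) (F s)).
apply: (le_trans (modcD _ _)); apply: lerD; first exact: h.
by apply: modc_dpartial_le; rewrite ltW // (le_lt_trans eps0).
Qed.

(** Both functions are bounded on the half-plane, so the product of the approximants is uniformly
    close to F G; a convolution coefficient of index at most M only involves coefficients of index
    at most M, where the approximations are controlled. *)
Lemma apx_mul F G b c : (forall m n, S m -> S n -> S (m * n)%N) ->
  apx eps S F b -> apx eps S G c ->
  apx eps S (fun s => F s * G s) (dconv b c).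
Proof.
move=> SM H K e e0 M.
have [B B0 FB] := apx_bounded H; have [B' B'0 GB] := apx_bounded K.
pose C := \sum_(1 <= n < M.+1) (modc (b n) + modc (c n)).
have C0 : 0 <= C by apply: sumr_ge0 => n _; rewrite addr_ge0 ?modc_ge0.
have bC n : (0 < n <= M)%N -> modc (b n) + modc (c n) <= C.
  move=> nM; rewrite /C (bigD1_seq n) ?iota_uniq ?mem_index_iota ?ltnS //=.
  by rewrite lerDl sumr_ge0 // => i _; rewrite addr_ge0 ?modc_ge0.
(* The part B + B' + 1 pays for the values of F G; the rest pays for at most M divisors, each
   contributing an error e' (2 C + 1). *)
pose D := B + B' + 1 + M%:R * (2 * C + 1).
have MC : 0 <= M%:R * (2 * C + 1) by rewrite mulr_ge0 ?addr_ge0 // mulr_ge0.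
have D0 : 0 < D by rewrite /D; lra.
pose e' := Num.min 1 (e / D).
have e'0 : 0 < e' by rewrite lt_min ltr01 divr_gt0.
have e'1 : e' <= 1 by rewrite ge_min lexx.
have e'D : e' * D <= e by rewrite -ler_pdivlMr // ge_min lexx orbT.
have [N [q [h1 h2 h3 h4]]] := H _ e'0 M; have [N' [p [k1 k2 k3 k4]]] := K _ e'0 M.
exists (N * N')%N, (dconv q p); split.
- move=> n nS; apply: big1_seq => d /andP[dn]; rewrite mem_index_iota => /andP[d0 _].
  have [dS|dS] := boolP (S d); last by rewrite h1 ?mul0r.
  have [dS'|dS'] := boolP (S (n %/ d)%N); last by rewrite k1 ?mulr0.
  by move: nS; rewrite -(divnK dn) mulnC SM.
- move=> n nN; apply: big1_seq => d /andP[dn]; rewrite mem_index_iota => /andP[d0 _].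
  have [dS|dS] := ltnP N d; first by rewrite h2 ?mul0r.
  have [dS'|dS'] := ltnP N' (n %/ d)%N; first by rewrite k2 ?mulr0.
  by move: nN; rewrite ltnNge -(divnK dn) mulnC leq_mul.
- move=> s es; rewrite dpartial_dconv //.
  set Q := dpartial q s N; set P := dpartial p s N'.
  have -> : F s * G s - Q * P = (F s - Q) * G s + (F s - (F s - Q)) * (G s - P).
    by ring.
  apply: (le_trans (modcD _ _)); rewrite !modcM; apply: le_trans e'D.
  have a1 := h3 s es; have a2 := k3 s es; have a3 := FB s es; have a4 := GB s es.
  have a5 : modc (F s - (F s - Q)) <= B + 1.
    by apply: (le_trans (modcD _ _)); rewrite modcN; lra.
  have b1 := ler_pM (modc_ge0 _) (modc_ge0 _) a1 a4.
  have b2 := ler_pM (modc_ge0 _) (modc_ge0 _) a5 a2.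
  apply: (le_trans (lerD b1 b2)); rewrite /D.
  have := mulr_ge0 (ltW e'0) MC; lra.
- move=> n /andP[n0 nM].
  rewrite /dconv -sumrB; apply: (le_trans (modc_sum _ _ _)).
  apply: (@le_trans _ _ (\sum_(1 <= d < n.+1) e' * (2 * C + 1))).
    rewrite [leLHS]big_mkcond /=; apply: ler_sum_nat => d /andP[d0 dn].
    case: ifP => [dvd|_]; last by rewrite mulr_ge0 ?ltW //; lra.
    have dM : (0 < d <= M)%N by rewrite d0 (leq_trans _ nM).
    have qM : (0 < n %/ d <= M)%N.
      by rewrite divn_gt0 // -ltnS dn (leq_trans (leq_div _ _)).
    have -> : q d * p (n %/ d)%N - b d * c (n %/ d)%N =
      (q d - b d) * (p (n %/ d)%N - c (n %/ d)%N) +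
      ((q d - b d) * c (n %/ d)%N + b d * (p (n %/ d)%N - c (n %/ d)%N)) by ring.
    have x1 := h4 d dM; have x2 := k4 _ qM; have x3 := bC _ dM; have x4 := bC _ qM.
    apply: (le_trans (modcD _ _)).
    have := modcD ((q d - b d) * c (n %/ d)%N) (b d * (p (n %/ d)%N - c (n %/ d)%N)).
    rewrite !modcM => y.
    have z1 := ler_pM (modc_ge0 _) (modc_ge0 _) x1 x2.
    have z2 := ler_wpM2r (modc_ge0 (c (n %/ d)%N)) x1.
    have z3 := ler_wpM2l (modc_ge0 (b d)) x2.
    have z4 := ler_wpM2l (ltW e'0) e'1.
    have z5 := ler_wpM2l (ltW e'0) (_ : modc (b d) + modc (c (n %/ d)%N) <= 2 * C).
    have {}z5 : e' * (modc (b d) + modc (c (n %/ d)%N)) <= e' * (2 * C).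
      apply: z5; have := modc_ge0 (b (n %/ d)%N); have := modc_ge0 (c d); lra.
    by move: z1 z2 z3 z4 z5 y; lra.
  rewrite sumr_const_nat subSS subn0 -[_ *+ n]mulr_natl.
  apply: le_trans e'D; rewrite mulrCA ler_wpM2l ?ltW // /D.
  have : n%:R * (2 * C + 1) <= M%:R * (2 * C + 1).
    by rewrite ler_wpM2r ?ler_nat // addr_ge0 // mulr_ge0.
  lra.
Qed.

(** The approximating polynomials of F and G differ by at most B + 2 e on the line Re s = sigma, so
    the mean square bound applies to them; it passes to b and c because finitely many coefficients
    are approximated within e. *)
Lemma apx_l2 F G b c (B sigma : R) : eps < sigma -> 0 <= B ->
  apx eps S F b -> apx eps S G c ->
  (forall s, eps < ReC s -> modc (F s - G s) <= B) ->
  forall M, \sum_(1 <= n < M.+1) cabs2 (b n - c n) * (n%:R `^ (- sigma)) ^+ 2 <= B ^+ 2.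
Proof.
move=> es B0 H K FG M; set w := fun n => (n%:R `^ (- sigma)) ^+ 2.
pose x n := modc (b n - c n).
apply: (@le_eps _ _ _ (\sum_(1 <= n < M.+1) 4 * x n * w n + (4 * B + 4))) => e e0 e1.
have [N [q [h1 h2 h3 h4]]] := H _ e0 M; have [N' [p [k1 k2 k3 k4]]] := K _ e0 M.
pose L := maxn M (maxn N N').
have dq s : dpartial (fun n => q n - p n) s L = dpartial q s N - dpartial p s N'.
  rewrite dpartialB (@dpartial_extend _ q _ N) ?(@dpartial_extend _ p _ N') //;
    rewrite /L; lia.
have := @mean_dpartial_sqr R (fun n => q n - p n) sigma ((B + 2 * e) ^+ 2) L.
move=> Q; have {}Q : \sum_(1 <= n < L.+1) cabs2 (q n - p n) * w n <= (B + 2 * e) ^+ 2.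
  apply: Q => t; apply: cabs2_le; rewrite dq.
  set s := sigma +i* t; have ss : eps < ReC s by [].
  have -> : dpartial q s N - dpartial p s N' =
    (F s - G s) + (- (F s - dpartial q s N) + (G s - dpartial p s N')) by ring.
  apply: (le_trans (modcD _ _)); have := modcD (- (F s - dpartial q s N)) (G s - dpartial p s N').
  by rewrite modcN; have := h3 s ss; have := k3 s ss; have := FG s ss; lra.
have Q2 : \sum_(1 <= n < M.+1) cabs2 (q n - p n) * w n <= (B + 2 * e) ^+ 2.
  apply: le_trans Q; rewrite [leRHS](@big_cat_nat _ _ _ M.+1) //=; last first.
    by rewrite ltnS leq_maxl.
  by rewrite lerDl sumr_ge0 // => n _; rewrite mulr_ge0 ?cabs2_ge0 ?sqr_ge0.
have Q3 : \sum_(1 <= n < M.+1) (cabs2 (b n - c n) - e * (4 * x n)) * w n <=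
    (B + 2 * e) ^+ 2.
  apply: le_trans Q2; apply: ler_sum_nat => n nM.
  rewrite ler_wpM2r ?sqr_ge0 //.
  have := modcD (q n - p n) (- (q n - b n) + (p n - c n)).
  have -> : (q n - p n) + (- (q n - b n) + (p n - c n)) = b n - c n by ring.
  have := modcD (- (q n - b n)) (p n - c n); rewrite modcN.
  have := h4 n nM; have := k4 n nM; rewrite -!sqr_modc -/(x n).
  have := modc_ge0 (q n - p n); set z := modc (q n - p n).
  have := modc_ge0 (b n - c n); rewrite -/(x n) => a1 a2 a3 a4 a5 a6.
  have a7 : x n <= z + 2 * e by lra.
  case: (lerP (2 * e) (x n)) => a8; last by nra.
  have : 0 <= (z - (x n - 2 * e)) * (z + (x n - 2 * e)) by rewrite mulr_ge0; lra.
  nra.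
have -> : \sum_(1 <= n < M.+1) cabs2 (b n - c n) * w n =
  \sum_(1 <= n < M.+1) (cabs2 (b n - c n) - e * (4 * x n)) * w n +
  e * \sum_(1 <= n < M.+1) 4 * x n * w n.
  by rewrite mulr_sumr -big_split; apply: eq_bigr => n _ /=; ring.
have := mulr_ge0 (ltW e0) (_ : 0 <= 1 - e); nra.
Qed.

Lemma apx_coef_le F G b c (B : R) sigma n : eps < sigma -> 0 <= B ->
  apx eps S F b -> apx eps S G c ->
  (forall s, eps < ReC s -> modc (F s - G s) <= B) -> (0 < n)%N ->
  modc (b n - c n) * n%:R `^ (- sigma) <= B.
Proof.
move=> es B0 H K FG n0; have := apx_l2 es B0 H K FG n.
rewrite big_nat_recr //= => h.
rewrite -(ler_pXn2r (n := 2)) ?nnegrE ?mulr_ge0 ?modc_ge0 ?powR_ge0 //.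
rewrite exprMn sqr_modc; apply: le_trans h; rewrite lerDr sumr_ge0 // => k _.
by rewrite mulr_ge0 ?cabs2_ge0 ?sqr_ge0.
Qed.

(** The case B = 0 of the coefficient estimate. It identifies coefficient sequences produced by
    different constructions or on different half-planes. *)
Lemma apx_unique F b c n : apx eps S F b -> apx eps S F c -> (0 < n)%N ->
  b n = c n.
Proof.
move=> H K n0; apply/eqP; rewrite -subr_eq0; apply/eqP; apply: modc_eq0.
have : modc (b n - c n) * n%:R `^ (- (eps + 1)) <= 0.
  apply: (apx_coef_le _ _ H K) => //; first by rewrite ltrDl.
  by move=> s _; rewrite subrr modc0.
by rewrite pmulr_lle0 // powR_gt0 // ltr0n.
Qed.

End Apx.

(** * Completeness and uniform limits of approximable functions *)

Lemma real_complete (R : realType) (u : nat -> R) :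
  (forall e, 0 < e -> exists J0, forall J K, (J0 <= J)%N -> (J0 <= K)%N ->
     `|u J - u K| <= e) ->
  exists l, forall e, 0 < e -> exists J0, forall J, (J0 <= J)%N -> `|u J - l| <= e.
Proof.
move=> H; have cv : cvgn u.
  apply/cauchy_cvgP/cauchy_ballP => e e0.
  have e2 : 0 < e / 2 by rewrite divr_gt0.
  have [J0 h] := H _ e2.
  exists (u @` [set n | (J0 <= n)%N], u @` [set n | (J0 <= n)%N]) => /=.
    by split; exists J0 => // n /= nJ; exists n.
  move=> [x y] /= [[J hJ <-] [K hK <-]]; rewrite /ball /= /ball_.
  by apply: (le_lt_trans (h _ _ hJ hK)); lra.
exists (limn u) => e e0; have /cvgrPdist_le/(_ e e0)[J0 _ h] := cv.
by exists J0 => J hJ; rewrite distrC; apply: h.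
Qed.

Lemma complex_complete (R : realType) (u : nat -> R[i]) :
  (forall e, 0 < e -> exists J0, forall J K, (J0 <= J)%N -> (J0 <= K)%N ->
     modc (u J - u K) <= e) ->
  exists l, forall e, 0 < e -> exists J0, forall J, (J0 <= J)%N -> modc (u J - l) <= e.
Proof.
move=> H.
have ReB (a b : R[i]) : ReC (a - b) = ReC a - ReC b by case: a b => ? ? [].
have ImB (a b : R[i]) : ImC (a - b) = ImC a - ImC b by case: a b => ? ? [].
have [|x hx] := @real_complete R (fun n => ReC (u n)).
  move=> e e0; have [J0 h] := H e e0; exists J0 => J K hJ hK.
  by rewrite -ReB (le_trans (le_ReC_modc _)) // h.
have [|y hy] := @real_complete R (fun n => ImC (u n)).
  move=> e e0; have [J0 h] := H e e0; exists J0 => J K hJ hK.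
  by rewrite -ImB (le_trans (le_ImC_modc _)) // h.
exists (x +i* y) => e e0; have e2 : 0 < e / 2 by rewrite divr_gt0.
have [J0 h] := hx _ e2; have [J1 k] := hy _ e2.
exists (maxn J0 J1) => J; rewrite geq_max => /andP[/h a /k b].
by apply: (le_trans (modc_le_ReIm _)); rewrite ReB ImB /=; lra.
Qed.

(** Uniform closeness of the functions makes each coefficient a Cauchy sequence, but only after
    weighting by n^-(eps + 1). The rate is therefore not uniform in n, which is why coefficients are
    compared only up to an index M. *)
Lemma apx_lim (R : realType) (eps : R) (S : pred nat) (F : R[i] -> R[i])
    (FJ : nat -> R[i] -> R[i]) (bJ : nat -> nat -> R[i]) : 0 <= eps ->
  (forall J, apx eps S (FJ J) (bJ J)) ->
  (forall e, 0 < e -> exists J0, forall J, (J0 <= J)%N -> forall s, eps < ReC s ->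
     modc (F s - FJ J s) <= e) ->
  exists2 b, apx eps S F b &
    forall n, (0 < n)%N -> forall e, 0 < e -> exists J0, forall J, (J0 <= J)%N ->
      modc (bJ J n - b n) <= e.
Proof.
move=> eps0 H FF; pose w n : R := n%:R `^ (- (eps + 1)).
have w0 n : (0 < n)%N -> 0 < w n by move=> n0; rewrite powR_gt0 // ltr0n.
have es : eps < eps + 1 by rewrite ltrDl.
have C e : 0 < e -> exists J0, forall J K, (J0 <= J)%N -> (J0 <= K)%N -> forall n,
    (0 < n)%N -> modc (bJ J n - bJ K n) * w n <= e.
  move=> e0; have e2 : 0 < e / 2 by rewrite divr_gt0.
  have [J0 h] := FF _ e2; exists J0 => J K hJ hK n n0.
  apply: (apx_coef_le eps0 es (ltW e0) (H J) (H K)) => // s ss.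
  have -> : FJ J s - FJ K s = - (F s - FJ J s) + (F s - FJ K s) by ring.
  apply: (le_trans (modcD _ _)); rewrite modcN.
  by have := h J hJ s ss; have := h K hK s ss; lra.
have L n : exists l, (0 < n)%N -> forall e, 0 < e -> exists J0, forall J,
    (J0 <= J)%N -> modc (bJ J n - l) <= e.
  case: (posnP n) => [->|n0]; first by exists 0.
  have [|l hl] := @complex_complete R (fun J => bJ J n); last by exists l.
  move=> e e0; have [J0 h] := C _ (mulr_gt0 e0 (w0 n n0)).
  by exists J0 => J K hJ hK; rewrite -(ler_pM2r (w0 n n0)) h.
have [b hb] := choice L.
exists b => // e e0 M; have e2 : 0 < e / 2 by rewrite divr_gt0.
have [J0 h] := FF _ e2.
(* The least weight among the indices up to M converts the weighted estimate into a plain one. *)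
have wM : exists2 d, 0 < d & forall n, (0 < n <= M)%N -> d <= w n.
  case: (posnP M) => [->|M0]; first by exists 1 => // n; lia.
  exists (w M) => [|n /andP[n0 nM]]; first exact: w0.
  rewrite /w !powRN lef_pV2 ?posrE ?powR_gt0 ?ltr0n //.
  by rewrite ge0_ler_powR ?nnegrE ?ler0n ?ler_nat // addr_ge0.
have [d d0 dw] := wM.
have [J1 k] := C _ (mulr_gt0 (divr_gt0 e2 (ltr0Sn R 1)) d0).
pose J := maxn J0 J1.
have hb2 n : (0 < n <= M)%N -> modc (bJ J n - b n) <= e / 2.
  move=> /andP[n0 nM]; have [J2 l] := hb n n0 _ (divr_gt0 e2 (ltr0Sn R 1)).
  have -> : bJ J n - b n = (bJ J n - bJ (maxn J1 J2) n) + (bJ (maxn J1 J2) n - b n).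
    by ring.
  apply: (le_trans (modcD _ _)).
  have := l (maxn J1 J2) (leq_maxr _ _).
  have := k J (maxn J1 J2) (leq_maxr _ _) (leq_maxl _ _) n n0.
  move=> a; have : modc (bJ J n - bJ (maxn J1 J2) n) <= e / 2 / 2.
    rewrite -(ler_pM2r (w0 n n0)); apply: (le_trans a); rewrite ler_wpM2l //.
      by rewrite !divr_ge0 // ltW.
    by rewrite dw // n0.
  lra.
have [N [q [h1 h2 h3 h4]]] := H J _ e2 M.
exists N, q; split => // [s ss|n nM].
  have -> : F s - dpartial q s N = (F s - FJ J s) + (FJ J s - dpartial q s N) by ring.
  apply: (le_trans (modcD _ _)).
  by have := h J (leq_maxl _ _) s ss; have := h3 s ss; lra.
have -> : q n - b n = (q n - bJ J n) + (bJ J n - b n) by ring.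
by apply: (le_trans (modcD _ _)); have := h4 n nM; have := hb2 n nM; lra.
Qed.

Lemma sum_cauchy_schwarz (R : realType) (x y : nat -> R) (X Y : R) (r : seq nat) :
  0 < X -> 0 < Y -> \sum_(n <- r) x n ^+ 2 <= X ^+ 2 -> \sum_(n <- r) y n ^+ 2 <= Y ^+ 2 ->
  \sum_(n <- r) x n * y n <= X * Y.
Proof.
move=> X0 Y0 hx hy.
apply: (@le_trans _ _ (\sum_(n <- r) (Y / X / 2 * x n ^+ 2 + X / Y / 2 * y n ^+ 2))).
  apply: ler_sum => n _.
  have h : 0 <= (Y * x n - X * y n) ^+ 2 / (2 * (X * Y)).
    by rewrite divr_ge0 ?sqr_ge0 // mulr_ge0 // mulr_ge0 // ltW.
  have -> : Y / X / 2 * x n ^+ 2 + X / Y / 2 * y n ^+ 2 =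
    x n * y n + (Y * x n - X * y n) ^+ 2 / (2 * (X * Y)).
    by field; rewrite !lt0r_neq0.
  by rewrite lerDl.
rewrite big_split -!mulr_sumr /=.
have a : 0 <= Y / X / 2 by rewrite !divr_ge0 // ltW.
have b : 0 <= X / Y / 2 by rewrite !divr_ge0 // ltW.
apply: (le_trans (lerD (ler_wpM2l a hx) (ler_wpM2l b hy))).
have -> : Y / X / 2 * X ^+ 2 + X / Y / 2 * Y ^+ 2 = X * Y.
  by field; rewrite !lt0r_neq0.
exact: lexx.
Qed.

(** * The divisor function *)

(** Cauchy condensation: the block from 2^k to 2^(k+1) contributes at most rho^k with rho = 2^(1 -
    s) < 1. *)
Lemma zeta_bounded (R : realType) (s : R) : 1 < s ->
  exists2 Z : R, 0 < Z & forall M, \sum_(1 <= n < M.+1) (n%:R : R) `^ (- s) <= Z.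
Proof.
move=> s1; pose rho : R := 2 `^ (1 - s).
have r0 : 0 < rho by rewrite powR_gt0.
have r1 : rho < 1.
  rewrite /rho /powR (negbTE (_ : 2 != 0 :> R)) ?pnatr_eq0 // -[ltRHS]expR0 ltr_expR.
  by rewrite nmulr_rlt0 ?ln_gt0 ?ltr1n //; lra.
exists (1 - rho)^-1; first by rewrite invr_gt0 subr_gt0.
have T k : \sum_(1 <= n < 2 ^ k) (n%:R : R) `^ (- s) <= \sum_(0 <= j < k) rho ^+ j.
  elim: k => [|k IH]; first by rewrite !big_geq.
  rewrite big_nat_recr //= (@big_cat_nat _ _ _ (2 ^ k)) /= ?expn_gt0 ?leq_exp2l //.
  apply: lerD => //.
  apply: (@le_trans _ _ (\sum_(2 ^ k <= n < 2 ^ k.+1) ((2 ^ k)%:R : R) `^ (- s))).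
    apply: ler_sum_nat => n /andP[kn _].
    have p2 : (0 < 2 ^ k)%N by rewrite expn_gt0.
    rewrite !powRN lef_pV2 ?posrE ?powR_gt0 ?ltr0n ?(leq_trans p2) //.
    by rewrite ge0_ler_powR ?nnegrE ?ler0n ?ler_nat //; lra.
  rewrite sumr_const_nat expnS mul2n -addnn addnK -[_ *+ (_ ^ _)%N]mulr_natl.
  rewrite /rho -powR_mulrn ?powR_ge0 // -powRrM natrX -[2 ^+ k]powR_mulrn //.
  rewrite -powRrM -powRD; last by rewrite pnatr_eq0 implybT.
  by rewrite le_eqVlt; apply/orP; left; apply/eqP; congr (_ `^ _); ring.
move=> M; apply: (@le_trans _ _ (\sum_(1 <= n < 2 ^ M.+1) (n%:R : R) `^ (- s))).
  rewrite [leRHS](@big_cat_nat _ _ _ M.+1) //=; last by rewrite ltnW // ltn_expl.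
  by rewrite lerDl sumr_ge0 // => n _; rewrite powR_ge0.
apply: (le_trans (T _)).
rewrite -(ler_pM2l (_ : 0 < 1 - rho)) ?subr_gt0 // mulfV ?subr_eq0 ?gt_eqF //.
have -> : (1 - rho) * \sum_(0 <= j < M.+1) rho ^+ j = 1 - rho ^+ M.+1.
  rewrite -[in RHS](expr1n R M.+1) subrXX big_mkord; congr (_ * _).
  by apply: eq_bigr => i _; rewrite expr1n mul1r.
by rewrite gerBl exprn_ge0 // ltW.
Qed.

(** A divisor e of m n is the product of gcd(e, m), which divides m, and e / gcd(e, m), which
    divides n; so multiplication maps pairs of divisors onto the divisors of m n. *)
Lemma size_divisors_mul m n : (0 < m)%N -> (0 < n)%N ->
  (size (divisors (m * n)) <= size (divisors m) * size (divisors n))%N.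
Proof.
move=> m0 n0; rewrite -(size_allpairs muln).
apply: uniq_leq_size; first exact: divisors_uniq.
move=> e; rewrite -dvdn_divisors ?muln_gt0 ?m0 // => emn.
have e0 : (0 < e)%N by apply: dvdn_gt0 emn; rewrite muln_gt0 m0.
have g0 : (0 < gcdn e m)%N by rewrite gcdn_gt0 e0.
apply/allpairsP; exists (gcdn e m, e %/ gcdn e m)%N => /=; split.
- by rewrite -dvdn_divisors // dvdn_gcdr.
- rewrite -dvdn_divisors //.
  have cop : coprime (e %/ gcdn e m) (m %/ gcdn e m).
    rewrite /coprime -(eqn_pmul2r g0) mul1n muln_gcdl !divnK ?dvdn_gcdl ?dvdn_gcdr //.
  rewrite -(Gauss_dvdr _ cop) -(dvdn_pmul2r g0) divnK ?dvdn_gcdl //.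
  by rewrite mulnAC divnK ?dvdn_gcdr.
- by rewrite mulnC divnK ?dvdn_gcdl.
Qed.

Lemma ndiv_ge1 (R : realType) n : (0 < n)%N -> 1 <= ndiv R n.
Proof.
move=> n0; rewrite /ndiv ler1n; have : 1%N \in divisors n by rewrite -dvdn_divisors.
by case: (divisors n).
Qed.

(** Induction on k: one factor d(n) is the number of factorisations n = d (n / d), and d(n)^k is at
    most d(d)^k d(n / d)^k on each. The series for k + 1 is thus dominated by the square of the
    series for k. *)
Lemma sum_ndiv_bounded (R : realType) (k : nat) (s : R) : 1 < s ->
  exists2 Z : R, 0 < Z &
    forall M, \sum_(1 <= n < M.+1) ndiv R n ^+ k * (n%:R : R) `^ (- s) <= Z.
Proof.
move=> s1; elim: k => [|k [Z Z0 IH]].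
  have [Z Z0 h] := zeta_bounded s1; exists Z => // M; apply: le_trans (h M).
  by apply: ler_sum => n _; rewrite expr0 mul1r.
exists (Z ^+ 2) => [|M]; first by rewrite exprn_gt0.
pose u n : R := ndiv R n ^+ k.
have u0 n : 0 <= u n by rewrite exprn_ge0 // ler0n.
apply: (@le_trans _ _ (\sum_(1 <= n < M.+1) dconv u u n * (n%:R : R) `^ (- s))).
  apply: ler_sum_nat => n /andP[n0 _]; rewrite ler_wpM2r ?powR_ge0 //.
  rewrite exprS {1}/ndiv mulr_natl.
  have -> : size (divisors n) = count (fun d => (d %| n)%N) (index_iota 1 n.+1).
    rewrite -size_filter; apply/perm_size/uniq_perm; rewrite ?divisors_uniq //.
      by rewrite filter_uniq // iota_uniq.
    move=> d; rewrite -dvdn_divisors // mem_filter mem_index_iota ltnS.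
    case: (boolP (d %| n)%N) => //= dn.
    by rewrite (dvdn_gt0 n0 dn) dvdn_leq.
  rewrite -iter_addr_0 -big_const_seq /dconv.
  rewrite [leLHS]big_nat_cond [leRHS]big_nat_cond; apply: ler_sum => d.
  move=> /andP[/andP[d0 _] dn]; rewrite -exprMn lerXn2r ?nnegrE ?mulr_ge0 ?ler0n //.
  rewrite /ndiv -natrM ler_nat -{1}(divnK dn) mulnC.
  by apply: size_divisors_mul => //; rewrite divn_gt0 // dvdn_leq.
have GM m n : (0 < m)%N -> (0 < n)%N ->
    ((m * n)%:R : R) `^ (- s) = (m%:R : R) `^ (- s) * (n%:R : R) `^ (- s).
  by move=> _ _; rewrite natrM powRM.
rewrite sum_dconv // expr2.
apply: (@le_trans _ _ (\sum_(1 <= d < M.+1) u d * (d%:R : R) `^ (- s) * Z)).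
  by apply: ler_sum => d _; rewrite ler_wpM2l ?mulr_ge0 ?powR_ge0.
by rewrite -mulr_suml ler_wpM2r // ltW.
Qed.

Lemma sum_ndiv_powR_bounded (R : realType) (a s : R) : 0 <= a -> 1 < s ->
  exists2 Z : R, 0 < Z &
    forall M, \sum_(1 <= n < M.+1) ndiv R n `^ a * (n%:R : R) `^ (- s) <= Z.
Proof.
move=> a0 s1; have [Z Z0 h] := sum_ndiv_bounded (Num.trunc a).+1 s1.
exists Z => // M; apply: le_trans (h M); apply: ler_sum_nat => n /andP[n0 _].
rewrite ler_wpM2r ?powR_ge0 // -powR_mulrn ?ler0n //.
by rewrite ler_powR ?ndiv_ge1 // ltW // truncnS_gt.
Qed.

(** * Convergence of the coefficient series to the function *)

Lemma powR_natN_sqr (R : realType) (n : nat) (s : R) :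
  ((n%:R : R) `^ (- s)) ^+ 2 = (n%:R : R) `^ (- (2 * s)).
Proof. by rewrite -powR_mulrn ?powR_ge0 // -powRrM; congr (_ `^ _); ring. Qed.

Lemma powR_natD (R : realType) (n : nat) (s t : R) : (0 < n)%N ->
  (n%:R : R) `^ (s + t) = (n%:R : R) `^ s * (n%:R : R) `^ t.
Proof. by move=> n0; rewrite powRD // pnatr_eq0 -lt0n n0 implybT. Qed.

(** The coefficients are controlled in mean square on any line Re s = sigma > eps, and
    Cauchy-Schwarz against n^-(Re s - sigma) costs half a unit of abscissa. Taking sigma midway
    between eps and Re s - 1/2 leaves room on both sides. *)
Lemma apx_series (R : realType) (eps : R) (S : pred nat) F b (s : R[i]) :
  0 <= eps -> apx eps S F b -> eps + 2^-1 < ReC s ->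
  forall e, 0 < e -> exists M0, forall M, (M0 <= M)%N ->
    modc (dpartial b s M - F s) <= e.
Proof.
move=> eps0 H ss e e0; pose sigma := (eps + (ReC s - 2^-1)) / 2.
have es : eps < sigma by rewrite /sigma; lra.
have [Z Z0 hZ] : exists2 Z : R, 0 < Z & forall M,
    \sum_(1 <= n < M.+1) (n%:R : R) `^ (- (2 * (ReC s - sigma))) <= Z.
  by apply: zeta_bounded; rewrite /sigma; lra.
have Y0 : 0 < Num.sqrt Z by rewrite sqrtr_gt0.
pose e' := e / (1 + Num.sqrt Z).
have D0 : 0 < 1 + Num.sqrt Z by rewrite addr_gt0.
have e'0 : 0 < e' by rewrite divr_gt0.
have [N [q [h1 h2 h3 _]]] := H _ e'0 0%N.
exists N => M NM.
have l2 := @apx_l2 R eps S eps0 F (fun s => dpartial q s N) b q _ sigma es (ltW e'0) H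
  (apx_dpartial _ h1 h2) h3 M.
have es' : eps < ReC s by lra.
have d1 : modc (dpartial b s M - dpartial q s N) <= e' * Num.sqrt Z.
  rewrite -(dpartial_extend s NM h2) -dpartialB.
  apply: (le_trans (modc_sum _ _ _)).
  rewrite (@eq_big_nat _ _ _ _ _ _ (fun n => modc (b n - q n) * (n%:R : R) `^ (- sigma) *
     (n%:R : R) `^ (- (ReC s - sigma)))).
    apply: sum_cauchy_schwarz => //.
      apply: le_trans l2; apply: ler_sum => n _.
      by rewrite exprMn sqr_modc.
    rewrite sqr_sqrtr; last exact: ltW.
    apply: le_trans (hZ M); apply: ler_sum => n _.
    by rewrite powR_natN_sqr.
  move=> n /andP[n0 _]; rewrite modcM modc_npow // -mulrA -powR_natD //.
  by congr (_ * _ `^ _); ring.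
have -> : dpartial b s M - F s = (dpartial b s M - dpartial q s N) - (F s - dpartial q s N).
  by ring.
apply: (le_trans (modcD _ _)); rewrite modcN.
apply: (le_trans (lerD d1 (h3 s es'))).
by have : e' * (1 + Num.sqrt Z) = e; [rewrite /e' divfK // lt0r_neq0|lra].
Qed.

Lemma apx_mono (R : realType) (eps eps' : R) S F b : eps <= eps' ->
  apx eps S F b -> apx eps' S F b.
Proof.
move=> le H e e0 M; have [N [q [h1 h2 h3 h4]]] := H e e0 M.
by exists N, q; split => // s /(le_lt_trans le); exact: h3.
Qed.

(** * Functions approximable on every half-plane, with one coefficient sequence *)

Definition unif_apx {R : realType} (S : pred nat) (F : R[i] -> R[i])
  (b : nat -> R[i]) : Prop := forall eps : R, 0 < eps -> apx eps S F b.

(** The limit coefficients are constructed for eps = 1; for another eps the limit gives possibly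
    different ones, and uniqueness on the smaller of the two half-planes shows that they agree. *)
Lemma unif_apx_lim (R : realType) (S : pred nat) (F : R[i] -> R[i])
    (FJ : nat -> R[i] -> R[i]) (bJ : nat -> nat -> R[i]) :
  (forall J, unif_apx S (FJ J) (bJ J)) ->
  (forall eps : R, 0 < eps -> forall e, 0 < e -> exists J0, forall J, (J0 <= J)%N ->
     forall s, eps < ReC s -> modc (F s - FJ J s) <= e) ->
  exists2 b, unif_apx S F b &
    forall n, (0 < n)%N -> forall e, 0 < e -> exists J0, forall J, (J0 <= J)%N ->
      modc (bJ J n - b n) <= e.
Proof.
move=> H K.
have [b hb hl] := apx_lim (@ler01 R) (fun J => H J 1 ltr01) (K 1 ltr01).
exists b => // eps eps0.
have [b' hb' _] := apx_lim (ltW eps0) (fun J => H J eps eps0) (K eps eps0).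
have m0 : 0 <= Num.max 1 eps by rewrite le_max ler01.
have e n : (0 < n)%N -> b' n = b n.
  apply: (@apx_unique _ _ S m0 F).
    by apply: apx_mono hb'; rewrite le_max lexx orbT.
  by apply: apx_mono hb; rewrite le_max lexx.
exact: (apx_ext hb').
Qed.

(** * The quadratic form of a multiplier *)

Lemma dconv_trunc (R : realType) (b f : nat -> R[i]) N n : (n <= N)%N ->
  dconv b (trunc N f) n = dconv b f n.
Proof.
move=> nN; apply: eq_bigr => d _; rewrite /trunc (leq_trans (leq_div _ _)) //.
Qed.

(** The real part of the pairing of F f with f, where multiplication by F acts as convolution with
    its coefficients b. Since convolution at n only sees divisors of n, entries of f beyond N never
    enter. *)
Definition qform {R : realType} (b f : nat -> R[i]) (N : nat) : R :=
  \sum_(1 <= n < N.+1) ReC (dconv b f n * conjc (f n)).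

Lemma ReC_le_modc (R : realType) (z : R[i]) : ReC z <= modc z.
Proof. exact: le_trans (ler_norm _) (le_ReC_modc z). Qed.

(** On the line Re s = sigma the form, with weights n^(-2 sigma), is the mean of Re F |f|^2, which
    is nonnegative. Only finitely many coefficients occur, so sigma may tend to 0 although nothing
    is assumed on the line Re s = 0. *)
Lemma qform_ge0 (R : realType) (S : pred nat) (F : R[i] -> R[i]) (b : nat -> R[i]) :
  (forall m n, S m -> S n -> S (m * n)%N) -> unif_apx S F b ->
  (forall s, 0 < ReC s -> 0 <= ReC (F s)) ->
  forall N f, (forall n, ~~ S n -> f n = 0) -> 0 <= qform b f N.
Proof.
move=> SM H F0 N f0 f0S.
wlog fN : f0 f0S / forall n, (N < n)%N -> f0 n = 0.
  move=> W; have := W (trunc N f0) _ _.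
  have -> : qform b (trunc N f0) N = qform b f0 N.
    apply: eq_big_nat => n /andP[_ nN]; rewrite ltnS in nN.
    by rewrite dconv_trunc // /trunc nN.
  apply => n; rewrite /trunc; first by move=> nS; rewrite f0S // if_same.
  by move=> nN; rewrite leqNgt nN.
pose B := \sum_(1 <= n < N.+1) modc (f0 n).
have B0 : 0 <= B by apply: sumr_ge0 => n _; exact: modc_ge0.
pose x n := ReC (dconv b f0 n * conjc (f0 n)).
have pos sigma : 0 < sigma -> 0 <= \sum_(1 <= n < N.+1) x n * (n%:R `^ (- sigma)) ^+ 2.
  move=> s0; have eps0 : 0 < sigma / 2 by rewrite divr_gt0.
  have HF := apx_mul (ltW eps0) SM (H _ eps0) (@apx_dpartial _ (sigma / 2) S N f0 f0S fN).
  apply: (@le_eps _ _ _ (B + \sum_(1 <= n < N.+1) modc (f0 n))) => e e0 _.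
  have [L [g [_ g2 g3 g4]]] := HF e e0 N.
  pose L' := maxn L N.
  have := @mean_dpartial_ge _ g f0 sigma (- (e * B)) L'.
  move=> K; have {}K : - (e * B) <= \sum_(1 <= n < L'.+1)
      ReC (g n * conjc (f0 n)) * n%:R `^ (- sigma) ^+ 2.
    apply: K => t; set s := sigma +i* t.
    have s1 : sigma / 2 < ReC s by rewrite /=; lra.
    have s2 : 0 <= ReC s by rewrite /= ltW.
    rewrite (@dpartial_extend _ g s L) ?leq_maxl // (@dpartial_extend _ f0 s N) ?leq_maxr //.
    set G := dpartial g s L; set f := dpartial f0 s N.
    have -> : G * conjc f = F s * (f * conjc f) - (F s * f - G) * conjc f by ring.
    rewrite ReCD ReCN mulC_conj [F s * _]mulrC ReC_realM.
    have a1 : 0 <= cabs2 f * ReC (F s).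
      by rewrite mulr_ge0 ?cabs2_ge0 // F0.
    have a2 : ReC ((F s * f - G) * conjc f) <= e * B.
      apply: (le_trans (ReC_le_modc _)); rewrite modcM modc_conj.
      by rewrite ler_pM ?modc_ge0 ?g3 // modc_dpartial_le.
    lra.
  have {}K : - (e * B) <= \sum_(1 <= n < N.+1) ReC (g n * conjc (f0 n)) * n%:R `^ (- sigma) ^+ 2.
    apply: (le_trans K); rewrite [leLHS](@big_cat_nat _ _ _ N.+1) //= ?ltnS ?leq_maxr //.
    rewrite [X in _ + X]big1_seq ?addr0 // => n /=; rewrite mem_index_iota.
    by move=> /andP[/fN -> _]; rewrite conjc_zero mulr0 mul0r.
  have K2 : \sum_(1 <= n < N.+1) ReC (g n * conjc (f0 n)) * n%:R `^ (- sigma) ^+ 2 <=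
      \sum_(1 <= n < N.+1) (x n * (n%:R `^ (- sigma)) ^+ 2 + e * modc (f0 n)).
    apply: ler_sum_nat => n /andP[n0 nN]; rewrite ltnS in nN.
    have w1 : n%:R `^ (- sigma) ^+ 2 <= 1 :> R.
      by rewrite expr_le1 ?powR_ge0 // powRN_le1 // ltW.
    have w0 : 0 <= n%:R `^ (- sigma) ^+ 2 :> R by exact: sqr_ge0.
    have -> : g n * conjc (f0 n) = dconv b f0 n * conjc (f0 n) + (g n - dconv b f0 n) * conjc (f0 n).
      by ring.
    rewrite ReCD mulrDl lerD2l.
    have a1 : ReC ((g n - dconv b f0 n) * conjc (f0 n)) <= e * modc (f0 n).
      apply: (le_trans (ReC_le_modc _)); rewrite modcM modc_conj.
      by rewrite ler_wpM2r ?modc_ge0 // g4 // n0.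
    apply: (le_trans (ler_wpM2r w0 a1)); rewrite ler_piMr //.
    by rewrite mulr_ge0 ?modc_ge0 // ltW.
  move: (le_trans K K2); rewrite big_split -mulr_sumr /=.
  by rewrite mulrDr /B; lra.
(* The weight differs from 1 by at most 2 sigma ln n, so removing it costs at most sigma times
   [Z]. *)
pose Z := \sum_(1 <= n < N.+1) `|x n| * (2 * ln n%:R).
apply: (@le_eps _ _ _ Z) => e e0 _.
apply: (le_trans (pos e e0)); rewrite /Z mulr_sumr -big_split /=.
apply: ler_sum_nat => n /andP[n0 _]; rewrite -/(x n).
set w := _ ^+ 2.
have w1 : w <= 1 by rewrite expr_le1 ?powR_ge0 // powRN_le1 // ltW.
have w2 : 1 - e * (2 * ln n%:R) <= w.
  have n0' : (n%:R : R) != 0 by rewrite pnatr_eq0 -lt0n.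
  rewrite /w powR_natN_sqr /powR (negbTE n0').
  by apply: le_trans (expR_ge1Dx _); lra.
have : `|x n| * (1 - w) <= `|x n| * (e * (2 * ln n%:R)).
  by rewrite ler_wpM2l //; lra.
have : - (x n * (1 - w)) <= `|x n| * (1 - w).
  by rewrite -mulNr ler_wpM2r ?subr_ge0 // -normrN ler_norm.
lra.
Qed.

(** * Twisting by the number of prime factors *)

Definition bigOmega n := (\sum_(0 <= p < n.+1) logn p n)%N.

Lemma bigOmega_extend n L : (n <= L)%N ->
  bigOmega n = (\sum_(0 <= p < L.+1) logn p n)%N.
Proof.
move=> nL; rewrite /bigOmega [RHS](@big_cat_nat _ _ _ n.+1) //=.
rewrite [X in (_ + X)%N]big1_seq ?addn0 // => p /=; rewrite mem_index_iota.
move=> /andP[np _]; case: (posnP n) => [->|n0]; first by rewrite logn0.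
by rewrite lognE; case: and3P => // -[_ _ /dvdn_leq]; lia.
Qed.

Lemma bigOmegaM m n : (0 < m)%N -> (0 < n)%N ->
  bigOmega (m * n) = (bigOmega m + bigOmega n)%N.
Proof.
move=> m0 n0; rewrite (@bigOmega_extend m (m * n)) ?leq_pmulr //.
rewrite (@bigOmega_extend n (m * n)) ?leq_pmull // -big_split /=.
by apply: eq_bigr => p _; rewrite lognM.
Qed.

Lemma bigOmega1 : bigOmega 1 = 0%N.
Proof. by rewrite /bigOmega big1 // => p _; rewrite logn1. Qed.

Lemma bigOmega_prime p : prime p -> bigOmega p = 1%N.
Proof.
move=> pp; rewrite /bigOmega (eq_bigr (fun q => if q == p then 1%N else 0%N)).
  by rewrite -big_mkcond big_nat1_eq /= ltnS leqnn.
by move=> q _; rewrite logn_prime //; case: (q == p).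
Qed.

Lemma bigOmega_pdiv n : (1 < n)%N -> bigOmega n = (bigOmega (n %/ pdiv n)).+1.
Proof.
move=> n1; have pn := pdiv_dvd n; have n0 := ltnW n1.
have q0 : (0 < n %/ pdiv n)%N by rewrite divn_gt0 ?pdiv_gt0 // dvdn_leq.
rewrite -{1}(divnK pn) bigOmegaM ?pdiv_gt0 //.
rewrite (bigOmega_prime (pdiv_prime n1)).
by rewrite addn1.
Qed.

Lemma bigOmega_gt0 n : (1 < n)%N -> (0 < bigOmega n)%N.
Proof. by move=> /bigOmega_pdiv ->. Qed.

(** Dividing n by its least prime factor lowers Omega by one and loses at least the divisor n
    itself. *)
Lemma bigOmega_lt_divisors n : (0 < n)%N -> (bigOmega n < size (divisors n))%N.
Proof.
have [m] := ubnP n; elim: m n => // m IH n nm n0.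
have [n1|n1] := leqP n 1.
  by have -> : n = 1%N by [lia]; rewrite bigOmega1.
have pn := pdiv_dvd n; set q := (n %/ pdiv n)%N.
have q0 : (0 < q)%N by rewrite divn_gt0 ?pdiv_gt0 // dvdn_leq.
have qn : (q < n)%N by rewrite ltn_Pdiv // prime_gt1 // pdiv_prime.
rewrite bigOmega_pdiv // -/q.
apply: (@leq_ltn_trans (size (divisors q))); first by apply: IH => //; lia.
rewrite -[leqLHS]/(size (n :: divisors q)).
apply: uniq_leq_size.
  rewrite /= divisors_uniq andbT -dvdn_divisors //.
  by apply/negP => /(dvdn_leq q0); lia.
move=> d; rewrite inE => /orP[/eqP ->|]; rewrite -!dvdn_divisors //.
by by move=> /dvdn_trans; apply; apply/dvdnP; exists (pdiv n); rewrite mulnC divnK.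
Qed.

(** * Harnack's inequality for the twisted form *)

Definition hseq {R : realType} (r : R) (a : nat) : R :=
  if a is a'.+1 then (1 + r) * r ^+ a' else 1.

Lemma hseq_corr0 (R : realType) (r : R) m : r != 1 ->
  \sum_(a < m.+1) hseq r a * hseq r a = (2 - (1 + r) * r ^+ (2 * m)) / (1 - r).
Proof.
move=> r1; have r1' : 1 - r != 0 by rewrite subr_eq0 eq_sym.
elim: m => [|m IH].
  by rewrite big_ord1 muln0 expr0 /=; field.
rewrite big_ord_recr IH /= [in RHS]mulnS exprD mul2n -addnn !exprD; field.
exact: r1'.
Qed.

Lemma hseq_corrS (R : realType) (r : R) k m : r != 1 ->
  \sum_(a < m.+1) hseq r a * hseq r (a + k.+1) =
  (1 + r) * r ^+ k * (1 - r * r ^+ (2 * m)) / (1 - r).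
Proof.
move=> r1; have r1' : 1 - r != 0 by rewrite subr_eq0 eq_sym.
elim: m => [|m IH].
  by rewrite big_ord1 muln0 expr0 /=; field.
rewrite big_ord_recr IH /= [in RHS]mulnS exprD mul2n -addnn !exprD !exprS; field.
exact: r1'.
Qed.

(* The Poisson kernel minus its minimum is, up to a constant,
   |1 + z|^2 / |1 - r z|^2, and hseq lists the Taylor coefficients of
   (1 + z) / (1 - r z). *)
Lemma harnack_trig (R : realType) (I : eqType) (s : seq I) (x : I -> R[i])
    (k : I -> nat) (r : R) : 0 < r < 1 ->
  (forall theta, 0 <= ReC (\sum_(i <- s) x i * cisN ((k i)%:R * theta))) ->
  (1 - r) / (1 + r) * ReC (\sum_(i <- s | k i == 0%N) x i) <=
  ReC (\sum_(i <- s) x i * (r ^+ k i)%:C).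
Proof.
move=> /andP[r0 r1] H; pose K := (\max_(i <- s) k i)%N.
have kK i : i \in s -> (k i <= K)%N by move=> si; exact: leq_bigmax_seq.
have r1' : r != 1 by rewrite lt_eqF.
have q1 : 1 - r != 0 by rewrite subr_eq0 eq_sym.
have q2 : 1 + r != 0 by rewrite gt_eqF //; lra.
have q3 : r != 0 by rewrite gt_eqF.
(* Multiplying the sum by the squared modulus of a truncation of (1 + z) / (1 - r z) keeps its real
   part nonnegative; in the mean over theta exactly the pairs b = a + k i remain. *)
have pos L : 0 <= ReC (\sum_(i <- s) x i *
    (\sum_(0 <= a < L.+1) \sum_(0 <= b < L.+1 | (b == a + k i)%N) hseq r a * hseq r b)%:C).
  move: (index_iota 0 L.+1) => l; pose t := allpairs pair s (allpairs pair l l).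
  have := @mean_sum_ge R _ t (fun p => x p.1 * (hseq r p.2.1 * hseq r p.2.2)%:C)
    (fun p => (k p.1)%:R + p.2.1%:R - p.2.2%:R) 0.
  have E1 : \sum_(p <- t | (k p.1)%:R + p.2.1%:R - p.2.2%:R == 0 :> R)
      x p.1 * (hseq r p.2.1 * hseq r p.2.2)%:C = \sum_(i <- s) x i *
    (\sum_(a <- l) \sum_(b <- l | (b == a + k i)%N) hseq r a * hseq r b)%:C.
    rewrite big_mkcond /t big_allpairs; apply: eq_bigr => i _ /=.
    rewrite big_allpairs rmorph_sum mulr_sumr; apply: eq_bigr => a _ /=.
    rewrite rmorph_sum mulr_sumr [RHS]big_mkcond; apply: eq_bigr => b _ /=.
    by rewrite subr_eq0 -natrD eqr_nat addnC [b == _]eq_sym.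
  rewrite E1; apply => theta.
  have -> : \sum_(p <- t) x p.1 * (hseq r p.2.1 * hseq r p.2.2)%:C *
      cisN (((k p.1)%:R + p.2.1%:R - p.2.2%:R) * theta) =
    (cabs2 (\sum_(a <- l) (hseq r a)%:C * cisN (a%:R * theta)))%:C *
    \sum_(i <- s) x i * cisN ((k i)%:R * theta).
    rewrite /t big_allpairs mulr_sumr; apply: eq_bigr => i _ /=.
    rewrite big_allpairs -mulC_conj conjc_sum mulr_suml mulr_suml.
    apply: eq_bigr => a _; rewrite mulr_sumr mulr_suml; apply: eq_bigr => b _.
    rewrite [LHS]/= conjcM conjc_real cisN_conj !mulrDl mulNr !cisND rmorphM; ring.
  by rewrite ReC_realM mulr_ge0 ?cabs2_ge0.
have kb i : (i < K.+1)%N -> forall L, (K <= L)%N ->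
   \sum_(0 <= a < L.+1) \sum_(0 <= b < L.+1 | (b == a + i)%N) hseq r a * hseq r b =
   (if i == 0%N then 2 / (1 - r) else (1 + r) / (r * (1 - r)) * r ^+ i) -
   (1 + r) / (1 - r) * r ^+ (2 * L - i).
  move=> iK L KL.
  rewrite (@eq_big_nat _ _ _ _ _ _ (fun a => if (a < (L - i).+1)%N then hseq r a * hseq r (a + i) else 0)).
    rewrite (@big_cat_nat _ _ _ (L - i).+1) //=; last by lia.
    rewrite [X in _ + X]big1_seq ?addr0; last first.
      by move=> a /=; rewrite mem_index_iota => /andP[h _]; rewrite ltnNge h.
    rewrite (@eq_big_nat _ _ _ _ _ _ (fun a => hseq r a * hseq r (a + i))); last first.
      by move=> a /andP[_ ->].
    rewrite big_mkord; case: i iK => [|i] iK /=.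
      rewrite (eq_bigr (fun a : 'I__ => hseq r a * hseq r a)).
        by rewrite hseq_corr0 // !subn0 [RHS]addrC; field; rewrite subr_eq0 eq_sym.
      by move=> a _; rewrite addn0.
    rewrite hseq_corrS //.
    have -> : (2 * L - i.+1 = 2 * (L - i.+1) + i.+1)%N by lia.
    rewrite exprD exprS; field.
    by rewrite subr_eq0 eq_sym r1' gt_eqF.
  move=> a /andP[_ aL]; rewrite big_nat1_eq /=.
  by case: ltnP => h; case: ltnP => h' //; lia.
(* [A i] is the limit of the truncated correlations as L grows; the remainder is [E] r^(2 L - k i),
   which is at most [E] r^L once L exceeds all k i. *)
pose A i : R := if k i == 0%N then 2 / (1 - r) else (1 + r) / (r * (1 - r)) * r ^+ k i.
pose E : R := (1 + r) / (1 - r).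
have E0 : 0 <= E by rewrite /E divr_ge0; lra.
pose C := E * \sum_(i <- s) modc (x i).
have C0 : 0 <= C by rewrite mulr_ge0 // sumr_ge0 // => i _; exact: modc_ge0.
have lim L : (K <= L)%N -> 0 <= ReC (\sum_(i <- s) x i * (A i)%:C) + r ^+ L * C.
  move=> KL; apply: (le_trans (pos L)).
  rewrite /C mulrCA !mulr_sumr !ReC_sum -big_split /= [leLHS]big_seq [leRHS]big_seq.
  apply: ler_sum => i si.
  rewrite kb ?ltnS ?kK // -/(A i) -/E rmorphB /= mulrBr ReCD lerD2l ReCN.
  rewrite mulrC ReC_realM -mulrN -mulrA ler_wpM2l //.
  have h : r ^+ (2 * L - k i) <= r ^+ L.
    by rewrite ler_wiXn2l ?ltW //; have := kK i si; lia.
  have h0 : 0 <= r ^+ (2 * L - k i) by rewrite exprn_ge0 // ltW.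
  apply: (@le_trans _ _ (r ^+ (2 * L - k i) * modc (x i))).
    by rewrite ler_wpM2l // -modcN -ReCN ReC_le_modc.
  by rewrite ler_wpM2r ?modc_ge0.
have A0 : 0 <= ReC (\sum_(i <- s) x i * (A i)%:C).
  apply: (@le_eps _ _ _ C) => e e0 _.
  have /cvgrPdist_le/(_ e e0)[L0 _ hL0] : (fun n => r ^+ n) @ \oo --> (0 : R).
    by apply: cvg_expr; rewrite ger0_norm // ltW.
  apply: (le_trans (lim (maxn K L0) (leq_maxl _ _))); rewrite lerD2l ler_wpM2r //.
  have := hL0 (maxn K L0) (leq_maxr _ _).
  by rewrite sub0r normrN ger0_norm // exprn_ge0 // ltW.
have AE : ReC (\sum_(i <- s) x i * (A i)%:C) =
   (1 + r) / (r * (1 - r)) * ReC (\sum_(i <- s) x i * (r ^+ k i)%:C) -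
   r^-1 * ReC (\sum_(i <- s | k i == 0%N) x i).
  rewrite -2!ReC_realM -ReCN -ReCD !mulr_sumr [X in _ - X]big_mkcond -sumrB; congr ReC.
  apply: eq_bigr => i _; rewrite /A; case: eqP => [->|_].
    rewrite expr0 mulr1 mulrC -mulrBl -rmorphB /=; congr (_%:C * _).
    by field; rewrite ?q1 ?q2 ?q3.
  by rewrite subr0 rmorphM /= mulrCA.
have D0 : 0 < r * (1 - r) / (1 + r) by rewrite divr_gt0 ?mulr_gt0 //; lra.
have := mulr_ge0 (ltW D0) A0; rewrite AE.
set X := ReC _; set Y := ReC _.
have -> : r * (1 - r) / (1 + r) * ((1 + r) / (r * (1 - r)) * X - r^-1 * Y) =
  X - (1 - r) / (1 + r) * Y.
  by field; rewrite ?q1 ?q2 ?q3.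
by rewrite subr_ge0.
Qed.

Definition omtwist {R : realType} (r : R) (b : nat -> R[i]) (n : nat) : R[i] :=
  (r ^+ bigOmega n)%:C * b n.

Lemma dconv_omtwist (R : realType) (r : R) (b f : nat -> R[i]) n : (0 < n)%N ->
  dconv (omtwist r b) (omtwist r f) n = omtwist r (dconv b f) n.
Proof.
move=> n0; rewrite /omtwist /dconv mulr_sumr.
rewrite [LHS]big_nat_cond [RHS]big_nat_cond; apply: eq_bigr => d.
move=> /andP[/andP[d0 _] dn].
have q0 : (0 < n %/ d)%N by rewrite divn_gt0 // dvdn_leq.
rewrite -{3}(divnK dn) bigOmegaM // exprD rmorphM; ring.
Qed.

(** Replacing f(n) by f(n) e^(i Omega(n) theta) turns b_d into b_d e^(-i Omega(d) theta) in the
    form, because Omega is additive. The form is thus a nonnegative trigonometric sum in theta, and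
    Harnack's inequality applies; its term of frequency zero comes from d = 1 alone. *)
Lemma qform_harnack (R : realType) (b : nat -> R[i]) (r : R) N : 0 < r < 1 ->
  (forall f, 0 <= qform b f N) -> forall f,
  (1 - r) / (1 + r) * ReC (b 1%N) * \sum_(1 <= n < N.+1) cabs2 (f n) <=
  qform (omtwist r b) f N.
Proof.
move=> r01 H f.
pose s := [seq p <- allpairs pair (index_iota 1 N.+1) (index_iota 1 N.+1) | (p.2 %| p.1)%N].
pose x (p : nat * nat) := b p.2 * f (p.1 %/ p.2)%N * conjc (f p.1).
have E (h : nat -> R[i]) :
    \sum_(1 <= n < N.+1) dconv (fun d => h d * b d) f n * conjc (f n) =
    \sum_(p <- s) x p * h p.2.
  rewrite [RHS]big_filter [RHS]big_mkcond [RHS]big_allpairs.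
  apply: eq_big_nat => n /andP[n0 nN].
  rewrite /dconv (@dvdn_sum_extend _ _ n N) ?n0 // mulr_suml [LHS]big_mkcond.
  by apply: eq_bigr => d _ /=; case: ifP => _ //; rewrite /x /=; ring.
have sP p : p \in s -> (0 < p.2)%N.
  rewrite mem_filter => /andP[_ /allpairsP[[i j] /= [_ h ->]]] /=.
  by move: h; rewrite mem_index_iota => /andP[].
have h1 theta : 0 <= ReC (\sum_(p <- s) x p * cisN ((bigOmega p.2)%:R * theta)).
  rewrite -(E (fun d => cisN ((bigOmega d)%:R * theta))).
  have := H (fun n => f n * cisN (- ((bigOmega n)%:R * theta))).
  rewrite /qform ReC_sum; congr (_ <= _); apply: eq_big_nat => n /andP[n0 _].
  congr ReC; rewrite /dconv !mulr_suml big_nat_cond [RHS]big_nat_cond.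
  apply: eq_bigr => d /andP[/andP[d0 _] dn].
  have q0 : (0 < n %/ d)%N by rewrite divn_gt0 // dvdn_leq.
  rewrite conjcM cisN_conj opprK.
  have -> : cisN ((bigOmega n)%:R * theta) =
     cisN ((bigOmega d)%:R * theta) * cisN ((bigOmega (n %/ d))%:R * theta).
    by rewrite -cisND -mulrDl -natrD -bigOmegaM // mulnC divnK.
  have e : cisN (- ((bigOmega (n %/ d))%:R * theta)) * cisN ((bigOmega (n %/ d))%:R * theta) = 1.
    by rewrite -cisND addNr cisN0.
  transitivity (b d * f (n %/ d)%N * conjc (f n) * cisN ((bigOmega d)%:R * theta) *
    (cisN (- ((bigOmega (n %/ d))%:R * theta)) * cisN ((bigOmega (n %/ d))%:R * theta))).
    by ring.
  by rewrite e; ring.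
have := harnack_trig r01 h1.
have -> : ReC (\sum_(p <- s) x p * (r ^+ bigOmega p.2)%:C) = qform (omtwist r b) f N.
  by rewrite -(E (fun d => (r ^+ bigOmega d)%:C)) ReC_sum.
have -> : \sum_(p <- s | bigOmega p.2 == 0%N) x p =
    \sum_(p <- s) x p * (if p.2 == 1%N then 1 else 0).
  rewrite big_mkcond; apply: eq_big_seq => p /sP p0.
  case: (eqVneq p.2 1%N) => [->|p1]; first by rewrite bigOmega1 mulr1.
  rewrite mulr0 ifF //; apply/negbTE; rewrite -lt0n bigOmega_gt0 //.
  by rewrite ltn_neqAle eq_sym p1.
rewrite -(E (fun d => if d == 1%N then 1 else 0)) ReC_sum => h.
apply: le_trans h; rewrite -[leLHS]mulrA ler_wpM2l //.
  by move/andP: r01 => [? ?]; rewrite divr_ge0 //; lra.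
rewrite mulr_sumr le_eqVlt; apply/orP; left; apply/eqP.
apply: eq_big_nat => n /andP[n0 nN].
have -> : dconv (fun d => (if d == 1%N then 1 else 0) * b d) f n = b 1%N * f n.
  rewrite /dconv big_mkcond (bigD1_seq 1%N) ?iota_uniq ?mem_index_iota ?ltnS ?n0 //=.
  rewrite dvd1n big1 ?addr0 ?mul1r ?divn1 // => d /negbTE ->.
  by rewrite !mul0r if_same.
by rewrite -mulrA mulC_conj [b 1%N * _]mulrC ReC_realM mulrC.
Qed.

(** * Contractions generated by a multiplier with nonnegative form *)

Lemma limn_cabs2 (R : realType) (u : nat -> R[i]) (z : R[i]) :
  (forall e, 0 < e -> exists J0, forall J, (J0 <= J)%N -> modc (u J - z) <= e) ->
  (fun J => cabs2 (u J)) @ \oo --> cabs2 z.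
Proof.
move=> H.
have c1 : (fun J => ReC (u J)) @ \oo --> ReC z.
  apply/cvgrPdist_le => e e0; have [J0 h] := H e e0; exists J0 => // J hJ.
  rewrite distrC; apply: le_trans (h J hJ).
  by have := le_ReC_modc (u J - z); rewrite ReCD ReCN.
have c2 : (fun J => ImC (u J)) @ \oo --> ImC z.
  apply/cvgrPdist_le => e e0; have [J0 h] := H e e0; exists J0 => // J hJ.
  rewrite distrC; apply: le_trans (h J hJ).
  have := le_ImC_modc (u J - z).
  by case: (u J) => a b; case: (z) => c d.
by apply: cvgD; apply: cvgM.
Qed.

Lemma wsum_cabs2_le (R : realType) (w : nat -> R) (u : nat -> nat -> R[i])
    (b : nat -> R[i]) (X : R) N :
  (forall n, (0 < n)%N -> forall e, 0 < e -> exists J0, forall J, (J0 <= J)%N ->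
      modc (u J n - b n) <= e) ->
  (forall e, 0 < e -> exists J0, forall J, (J0 <= J)%N ->
     \sum_(1 <= n < N.+1) w n * cabs2 (u J n) <= X + e) ->
  \sum_(1 <= n < N.+1) w n * cabs2 (b n) <= X.
Proof.
move=> H K; apply/ler_addgt0Pr => e e0; have [J0 h] := K e e0.
have cv : (fun J => \sum_(1 <= n < N.+1) w n * cabs2 (u J n)) @ \oo -->
    \sum_(1 <= n < N.+1) w n * cabs2 (b n).
  elim: N {K h} => [|N IH].
    rewrite big_geq // (_ : (fun _ => _) = (fun=> 0)); first exact: cvg_cst.
    by apply/funext => J; rewrite big_geq.
  rewrite big_nat_recr //= (_ : (fun _ => _) = (fun J => \sum_(1 <= n < N.+1) w n * cabs2 (u J n) +
     w N.+1 * cabs2 (u J N.+1))); last by apply/funext => J; rewrite big_nat_recr.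
  by apply: cvgD => //; apply: cvgMr; apply: limn_cabs2; apply: H.
have e2 : 0 < e / 2 by rewrite divr_gt0.
have [J1 k] := K _ e2.
have /cvgrPdist_le/(_ _ e2)[J2 _ l] := cv.
have := l (maxn J1 J2) (leq_maxr _ _); have := k (maxn J1 J2) (leq_maxl _ _).
rewrite ler_norml => ? /andP[_ ?]; lra.
Qed.

Lemma dconv1 (R : realType) (b u : nat -> R[i]) : dconv b u 1 = b 1%N * u 1%N.
Proof. by rewrite /dconv big_mkcond big_nat1 dvd1n divn1. Qed.

(** The constant depends on N and is far from sharp; it suffices because it only appears multiplied
    by the square of a step size tending to 0. *)
Lemma sum_dconv_sqr_le (R : realType) (b : nat -> R[i]) N :
  exists2 a : R, 0 <= a & forall f : nat -> R[i],
    \sum_(1 <= n < N.+1) cabs2 (dconv b f n) <= a * \sum_(1 <= n < N.+1) cabs2 (f n).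
Proof.
pose D := \sum_(1 <= d < N.+1) modc (b d).
have D0 : 0 <= D by apply: sumr_ge0 => d _; exact: modc_ge0.
exists (N%:R * D ^+ 2) => [|f]; first by rewrite mulr_ge0 ?sqr_ge0.
set W := \sum_(1 <= n < N.+1) cabs2 (f n).
have W0 : 0 <= W by apply: sumr_ge0 => n _; exact: cabs2_ge0.
have fW n : (0 < n <= N)%N -> modc (f n) <= Num.sqrt W.
  move=> nN; rewrite ler_sqrt // /W (bigD1_seq n) ?iota_uniq ?mem_index_iota ?ltnS //=.
  by rewrite lerDl sumr_ge0 // => i _; exact: cabs2_ge0.
apply: (@le_trans _ _ (\sum_(1 <= n < N.+1) D ^+ 2 * W)); last first.
  by rewrite sumr_const_nat subSS subn0 -[_ *+ N]mulr_natl mulrA.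
apply: ler_sum_nat => n /andP[n0 nN]; rewrite ltnS in nN.
rewrite -[W]sqr_sqrtr // -exprMn; apply: cabs2_le.
rewrite /dconv (@dvdn_sum_extend _ _ n N) ?n0 //.
apply: (le_trans (modc_sum _ _ _)); rewrite /D mulr_suml [leLHS]big_mkcond /=.
apply: ler_sum_nat => d /andP[d0 dN].
case: ifP => dn; last by rewrite mulr_ge0 ?modc_ge0 ?sqrtr_ge0.
rewrite modcM ler_wpM2l ?modc_ge0 // fW // divn_gt0 // dvdn_leq //=.
by rewrite (leq_trans (leq_div _ _)).
Qed.

(** One explicit Euler step for the evolution u' = - b * u under convolution, whose solution has the
    coefficients of e^(-t F) U. *)
Definition euler_step {R : realType} (tau : R) (b u : nat -> R[i]) (n : nat) : R[i] :=
  u n - tau%:C * dconv b u n.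

(** In the expansion of |f - tau (b * f)|^2 the term of order tau is -2 tau times the form, hence
    not positive; the growth is only of order tau^2. *)
Lemma euler_step_contract (R : realType) (b : nat -> R[i]) (r : R) N :
  (forall f, 0 <= qform (omtwist r b) f N) ->
  exists2 a : R, 0 <= a & forall tau u, 0 <= tau ->
    \sum_(1 <= n < N.+1) cabs2 (omtwist r (euler_step tau b u) n) <=
    (1 + tau ^+ 2 * a) * \sum_(1 <= n < N.+1) cabs2 (omtwist r u n).
Proof.
move=> H; have [a a0 ha] := sum_dconv_sqr_le (omtwist r b) N.
exists a => // tau u tau0; set f := omtwist r u.
have -> : \sum_(1 <= n < N.+1) cabs2 (omtwist r (euler_step tau b u) n) =
   \sum_(1 <= n < N.+1) cabs2 (f n) +
   tau ^+ 2 * \sum_(1 <= n < N.+1) cabs2 (dconv (omtwist r b) f n) -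
   2 * tau * qform (omtwist r b) f N.
  rewrite /qform !mulr_sumr -big_split -sumrB; apply: eq_big_nat => n /andP[n0 _] /=.
  rewrite dconv_omtwist // /omtwist /euler_step mulrBr [_%:C * (tau%:C * _)]mulrCA.
  rewrite /f /omtwist.
  set A := (r ^+ _)%:C * u n; set B := (r ^+ _)%:C * dconv b u n.
  have -> : - (tau%:C * B) = (- tau)%:C * B by rewrite rmorphN mulNr.
  rewrite cabs2D (cabs2_realM (- tau)) sqrrN.
  have -> : ReC (A * conjc ((- tau)%:C * B)) = - tau * ReC (B * conjc A).
    by case: A B => [x y] [z w] /=; ring.
  by ring.
have := H f; have := ha f.
set X := \sum_(1 <= n < N.+1) cabs2 (f n); set Y := \sum_(1 <= n < N.+1) _; set Q := qform _ _ _.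
move=> h1 h2; have := ler_wpM2l (sqr_ge0 tau) h1.
have := mulr_ge0 tau0 h2; lra.
Qed.

(** After J + 1 Euler steps of length t / (J + 1) the norm has grown by at most exp(t^2 a / (J +
    1)), which tends to 1. The coefficients v' are obtained before r and N are chosen, so one
    sequence satisfies all the estimates; its first entry is explicit because convolution at n = 1
    is a plain product. *)
Lemma exp_step (R : realType) (S : pred nat) (Phi V : R[i] -> R[i])
    (b v : nat -> R[i]) (t : R) :
  (forall m n, S m -> S n -> S (m * n)%N) ->
  unif_apx S Phi b -> unif_apx S V v -> 0 <= t ->
  exists v', [/\ unif_apx S (fun s => cexp (- (t%:C * Phi s)) * V s) v',
    v' 1%N = cexp (- (t%:C * b 1%N)) * v 1%N &
    forall r N, (forall f, 0 <= qform (omtwist r b) f N) ->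
      \sum_(1 <= n < N.+1) cabs2 (omtwist r v' n) <=
      \sum_(1 <= n < N.+1) cabs2 (omtwist r v n)].
Proof.
move=> SM HP HV t0.
pose tau J : R := t / J.+1%:R.
pose FJ J s := (1 + - (t%:C * Phi s) / J.+1%:R) ^+ J.+1 * V s.
pose bJ J := iter J.+1 (euler_step (tau J) b) v.
have tauE J : (tau J)%:C = t%:C / J.+1%:R :> R[i].
  by rewrite /tau rmorphM fmorphV rmorph_nat.
have HJ J : unif_apx S (FJ J) (bJ J).
  move=> eps eps0; rewrite /FJ /bJ.
  elim: {2 3}J.+1 => [|k IH].
    by apply: (apx_ext (HV _ eps0)) => // s _; rewrite expr0 mul1r.
  have h := apx_sub IH (apx_scale (tau J)%:C (apx_mul (ltW eps0) SM (HP _ eps0) IH)).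
  apply: (apx_ext h) => // s _ /=; rewrite tauE exprS; ring.
have [|v' hv' lv'] := unif_apx_lim HJ (F := fun s => cexp (- (t%:C * Phi s)) * V s).
  move=> eps eps0 e e0.
  have [B B0 hB] := apx_bounded (ltW eps0) (HP _ eps0).
  have [B' B'0 hB'] := apx_bounded (ltW eps0) (HV _ eps0).
  have [J0 h] := cexp_euler (t * B) (divr_gt0 e0 B'0).
  exists J0 => J hJ s ss; rewrite -mulrBl modcM.
  have h1 : modc (- (t%:C * Phi s)) <= t * B.
    by rewrite modcN modcM modc_real ger0_norm // ler_wpM2l // hB.
  apply: (le_trans (ler_pM (modc_ge0 _) (modc_ge0 _) (h J hJ _ h1) (hB' s ss))).
  by rewrite divfK // lt0r_neq0.
have bJ1 J : bJ J 1%N = (1 + - (t%:C * b 1%N) / J.+1%:R) ^+ J.+1 * v 1%N.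
  rewrite /bJ; elim: {1 3}J.+1 => [|k IH]; first by rewrite expr0 mul1r.
  by rewrite iterS /euler_step dconv1 IH tauE exprS; ring.
exists v'; split => //.
  apply/eqP; rewrite -subr_eq0; apply/eqP; apply: modc_eq0.
  apply/ler_addgt0Pr => e e0; rewrite add0r.
  have M0 : 0 < modc (v 1%N) + 1 by rewrite ltr_wpDl ?modc_ge0.
  have e2 : 0 < e / 2 by rewrite divr_gt0.
  have [J0 h] := lv' 1%N isT _ e2.
  have [J1 k] := cexp_euler (modc (- (t%:C * b 1%N))) (divr_gt0 e2 M0).
  set J := maxn J0 J1.
  have a1 := h J (leq_maxl _ _); have := k J (leq_maxr _ _) _ (lexx _) => a2.
  have -> : v' 1%N - cexp (- (t%:C * b 1%N)) * v 1%N =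
    - (bJ J 1%N - v' 1%N) - (cexp (- (t%:C * b 1%N)) -
       (1 + - (t%:C * b 1%N) / J.+1%:R) ^+ J.+1) * v 1%N by rewrite bJ1; ring.
  apply: (le_trans (modcD _ _)); rewrite !modcN modcM.
  have := ler_pM (modc_ge0 _) (modc_ge0 _) a2 (_ : modc (v 1%N) <= modc (v 1%N) + 1).
  by rewrite divfK ?lt0r_neq0 // => /(_ _); have h2 : modc (v 1%N) <= modc (v 1%N) + 1 by [lra]; move=> /(_ h2); lra.
move=> r N Q; have [a a0 ha] := euler_step_contract Q.
set W := \sum_(1 <= n < N.+1) cabs2 (omtwist r v n).
have W0 : 0 <= W by apply: sumr_ge0 => n _; exact: cabs2_ge0.
have tau0 J : 0 <= tau J by rewrite divr_ge0.
have bound J : \sum_(1 <= n < N.+1) cabs2 (omtwist r (bJ J) n) <= expR (t ^+ 2 * a / J.+1%:R) * W.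
  apply: (@le_trans _ _ ((1 + tau J ^+ 2 * a) ^+ J.+1 * W)).
    rewrite /bJ; elim: J.+1 => [|k IH]; first by rewrite expr0 mul1r.
    apply: (le_trans (ha _ _ (tau0 J))); rewrite [X in _ <= X * _]exprS -[leRHS]mulrA ler_wpM2l //.
    by rewrite addr_ge0 // mulr_ge0 ?sqr_ge0.
  rewrite ler_wpM2r //.
  have -> : t ^+ 2 * a / J.+1%:R = J.+1%:R * (tau J ^+ 2 * a).
    have : (J.+1%:R : R) != 0 by rewrite pnatr_eq0.
    by rewrite /tau; move: (J.+1%:R) => x x0; field.
  rewrite expRM_natl lerXn2r ?nnegrE ?expR_ge0 ?expR_ge1Dx //.
  by rewrite addr_ge0 // mulr_ge0 ?sqr_ge0.
have Eom u n : cabs2 (omtwist r u n) = (r ^+ bigOmega n) ^+ 2 * cabs2 (u n).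
  exact: cabs2_realM.
under eq_bigr do rewrite Eom.
apply: (@wsum_cabs2_le _ _ bJ) => // e e0.
have c0 : (fun J : nat => expR (t ^+ 2 * a / J.+1%:R) * W) @ \oo --> expR 0 * W.
  apply: cvgMl; apply: continuous_cvg; first exact: continuous_expR.
  rewrite -[X in _ --> X](mulr0 (t ^+ 2 * a)); apply: cvgMr.
  exact: cvg_harmonic.
rewrite expR0 mul1r in c0.
have /cvgrPdist_le/(_ e e0)[J0 _ h] := c0.
exists J0 => J hJ; under eq_bigr do rewrite -Eom.
apply: (le_trans (bound J)); have := h J hJ.
by rewrite ler_norml => /andP[? _]; lra.
Qed.

(** * Composition with a symbol of characteristic zero *)

Lemma GH_char0_apx_supp (R : realType) (S : pred nat) (c : nat -> R[i])
    (phi : R[i] -> R[i]) :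
  (forall n, ~~ S n -> c n = 0) -> GH_char0 c phi -> unif_apx S phi c.
Proof.
move=> cS [H _] eps eps0 e e0 M; have [N0 h] := H eps eps0 e e0.
pose N := maxn N0 M.
exists N, (trunc N c); split.
- by move=> n nS; rewrite /trunc cS // if_same.
- by move=> n nN; rewrite /trunc leqNgt nN.
- move=> s ss; rewrite (_ : dpartial (trunc N c) s N = dpartial c s N).
    by apply/ltW/h => //; rewrite leq_maxl.
  by apply: eq_big_nat => n /andP[_ nN]; rewrite /trunc -ltnS nN.
- move=> n /andP[n0 nM]; rewrite /trunc (leq_trans nM (leq_maxr _ _)).
  by rewrite subrr modc0 ltW.
Qed.

Lemma GH_char0_apx (R : realType) (c : nat -> R[i]) (phi : R[i] -> R[i]) :
  GH_char0 c phi -> unif_apx predT phi c.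
Proof. exact: GH_char0_apx_supp. Qed.

Definition shift1 {R : realType} (c : nat -> R[i]) (y : R) (n : nat) : R[i] :=
  c n - (if n == 1%N then y%:C else 0).

Lemma unif_apx_shift (R : realType) (S : pred nat) (F : R[i] -> R[i]) c (y : R) :
  S 1%N -> unif_apx S F c -> unif_apx S (fun s => F s - y%:C) (shift1 c y).
Proof.
by move=> S1 H eps eps0; apply: apx_sub (H _ eps0) (apx_const eps y%:C S1).
Qed.

Lemma dconv_delta (R : realType) (z : R[i]) f n : (0 < n)%N ->
  dconv (fun d => if d == 1%N then z else 0) f n = z * f n.
Proof.
move=> n0; rewrite /dconv big_mkcond (bigD1_seq 1%N) ?iota_uniq ?mem_index_iota ?ltnS ?n0 //=.
by rewrite dvd1n big1 ?addr0 ?divn1 // => d /negbTE ->; rewrite mul0r if_same.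
Qed.

Lemma qform_shift (R : realType) (c f : nat -> R[i]) (r y : R) N :
  qform (omtwist r (shift1 c y)) f N =
  qform (omtwist r c) f N - y * \sum_(1 <= n < N.+1) cabs2 (f n).
Proof.
rewrite /qform mulr_sumr -sumrB; apply: eq_big_nat => n /andP[n0 _].
have -> : dconv (omtwist r (shift1 c y)) f n = dconv (omtwist r c) f n - y%:C * f n.
  rewrite -(dconv_delta _ _ n0) /dconv -sumrB; apply: eq_bigr => d _.
  rewrite -mulrBl; congr (_ * _); rewrite /omtwist /shift1 mulrBr; congr (_ - _).
  by case: eqP => [->|_]; rewrite ?bigOmega1 ?expr0 ?mul1r ?mulr0.
by rewrite mulrBl ReCD ReCN -mulrA mulC_conj ReC_realM.
Qed.

Lemma qform_ext (R : realType) (b c f : nat -> R[i]) N :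
  (forall n, (0 < n)%N -> b n = c n) -> qform b f N = qform c f N.
Proof.
move=> bc; apply: eq_big_nat => n _; congr (ReC (_ * _)).
rewrite /dconv big_nat_cond [RHS]big_nat_cond; apply: eq_bigr => d.
by move=> /andP[/andP[d0 _] _]; rewrite bc.
Qed.

Lemma ReC_mulM_conj (R : realType) (a z : R[i]) :
  ReC (a * z * conjc z) = cabs2 z * ReC a.
Proof. by rewrite -mulrA mulC_conj mulrC ReC_realM. Qed.

Section Symbol.
Variables (R : realType) (c : nat -> R[i]) (phi : R[i] -> R[i]).
Hypothesis GH : GH_char0 c phi.

Let kappa := ReC (c 1%N) - 2^-1.

Lemma symbol_form_ge0 N f : 0 <= qform (shift1 c 2^-1) f N.
Proof.
apply: (@qform_ge0 _ predT (fun s => phi s - (2^-1)%:C)) => //.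
  exact: unif_apx_shift (GH_char0_apx GH).
by move=> s s0; rewrite ReCD ReCN /= subr_ge0 ltW // GH.2.
Qed.

(* If Re c_1 = 1/2, testing the form on delta_1 - c_m delta_m shows c_m = 0
   for all m > 1, so phi is a constant on the critical line. *)
Lemma symbol_kappa_gt0 : 0 < kappa.
Proof.
have k1 f m : (1 < m)%N -> (forall n, n != 1%N -> n != m -> f n = 0) ->
    qform (shift1 c 2^-1) f m = kappa * (cabs2 (f 1%N) + cabs2 (f m)) +
      ReC (c m * f 1%N * conjc (f m)).
  move=> m1 f0; rewrite /qform big_nat_recr ?(ltnW m1) //= big_ltn //.
  rewrite big1_seq; last first.
    move=> n /=; rewrite mem_index_iota => /andP[n1 nm].
    by rewrite (f0 n) ?conjc_zero ?mulr0 //; lia.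
  rewrite addr0 dconv1 ReC_mulM_conj.
  have -> : dconv (shift1 c 2^-1) f m = shift1 c 2^-1 1%N * f m + c m * f 1%N.
    rewrite /dconv big_mkcond big_nat_recr ?(ltnW m1) //= big_ltn //.
    rewrite big1_seq; last first.
      move=> d /=; rewrite mem_index_iota => /andP[d1 dm]; case: ifP => // dvd.
      rewrite (f0 (m %/ d)%N) ?mulr0 //.
        by apply/eqP => e; move: dm; rewrite -(divnK dvd) e mul1n ltnn.
      by apply/eqP => e; have := ltn_Pdiv d1 (ltnW m1); rewrite e ltnn.
    rewrite addr0 dvd1n divn1 dvdnn divnn (ltnW m1) /shift1 [m == _]gtn_eqF //.
    by rewrite subr0.
  have D (a b z : R[i]) : ReC ((a + b) * z) = ReC (a * z) + ReC (b * z).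
    by rewrite mulrDl ReCD.
  rewrite (D (_ * _)) ReC_mulM_conj.
  by rewrite /shift1 eqxx ReCD ReCN /= -/kappa; ring.
have k0 : 0 <= kappa.
  have := symbol_form_ge0 2 (fun n => if n == 1%N then 1 else 0).
  rewrite k1 //; last by move=> n /negbTE ->.
  rewrite eqxx [(2 == 1)%N]/= conjc_zero mulr0 /cabs2 /= expr1n expr0n !addr0 mulr1 //.
rewrite lt_neqAle k0 andbT; apply/eqP => k00.
have cm m : (1 < m)%N -> c m = 0.
  move=> m1; have := symbol_form_ge0 m (fun n => if n == 1%N then 1 else if n == m then - c m else 0).
  rewrite k1 //; last by move=> n /negbTE -> /negbTE ->.
  rewrite -k00 mul0r add0r eqxx [m == 1%N]gtn_eqF // eqxx mulr1 => h.
  apply: modc_eq0; apply: modc_le_sqrt => //; rewrite expr0n /=.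
  by move: h; rewrite (_ : conjc (- c m) = - conjc (c m)) ?mulrN ?ReCN ?mulC_conj ?oppr_ge0 //; case: (c m).
have [H1 H2] := GH; pose s : R[i] := 1.
have s0 : 0 < ReC s by rewrite /= ltr01.
have p0 : 0 < ReC (phi s) - 2^-1 by rewrite subr_gt0; apply: H2.
have s2 : 2^-1 < ReC s by rewrite /=; lra.
have h2 : (0 : R) < 2^-1 by rewrite invr_gt0.
have [N0 h] := H1 _ h2 _ p0.
have := h _ (leqnSn N0) s s2; rewrite -/(modc _).
have -> : dpartial c s N0.+1 = c 1%N.
  rewrite /dpartial big_ltn // npow1 mulr1 big1_seq ?addr0 // => n /=.
  by rewrite mem_index_iota => /andP[n1 _]; rewrite cm ?mul0r.
move=> hh; have := le_lt_trans (ReC_le_modc _) hh.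
by rewrite ReCD ReCN; move: k00; rewrite /kappa; lra.
Qed.

Lemma symbol_harnack (y : R) N f : 0 < y < kappa ->
  0 <= qform (omtwist ((kappa - y) / (kappa + y)) (shift1 c (2^-1 + y))) f N.
Proof.
move=> /andP[y0 yk]; set r := _ / _.
have k0 := symbol_kappa_gt0.
have r01 : 0 < r < 1.
  have d0 : 0 < kappa + y by rewrite addr_gt0.
  by apply/andP; split; rewrite /r ?ltr_pdivrMr // ?divr_gt0 ?subr_gt0 //; lra.
have := qform_harnack r01 (symbol_form_ge0 N) f.
have -> : shift1 c 2^-1 1%N = c 1%N - (2^-1)%:C by rewrite /shift1 eqxx.
rewrite ReCD ReCN /= -/kappa.
(* This equation is what determines r: Harnack's inequality guarantees the fraction (1 - r) / (1 +
   r) of kappa. *)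
have -> : (1 - r) / (1 + r) * kappa = y.
  rewrite /r; field; rewrite ?gt_eqF //; lra.
rewrite (@qform_ext _ (omtwist r (shift1 c (2^-1 + y))) (omtwist r (shift1 (shift1 c 2^-1) y))).
  by rewrite (qform_shift (shift1 c 2^-1)) subr_ge0.
move=> n _; congr (_ * _); rewrite /shift1; case: eqP => _; last by rewrite !subr0.
by rewrite rmorphD opprD addrA.
Qed.

End Symbol.

(** * The dilation recursion *)

Section Recursion.
Variables (R : realType) (al : nat -> R[i]).

(** The piece of a Dirichlet polynomial with indices m, ..., m + k - 1, with m^-w divided out, so
    that every exponent ln((m + i) / m) is nonnegative. *)
Definition expsum (w : R[i]) (m k : nat) : R[i] :=
  \sum_(i < k) al (m + i)%N * cexp (- ((ln (m + i)%:R - ln m%:R)%:C * w)).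

(** A Horner step: the remaining piece is multiplied by e^(-t w) with t = ln((m + 1) / m) >= 0. *)
Lemma expsumS w m k : (0 < m)%N -> expsum w m k.+1 =
  al m + cexp (- ((ln m.+1%:R - ln m%:R)%:C * w)) * expsum w m.+1 k.
Proof.
move=> m0; rewrite /expsum big_ord_recl /= addn0 subrr mul0r oppr0 cexp0 mulr1.
congr (_ + _); rewrite mulr_sumr; apply: eq_bigr => i _ /=.
rewrite /bump leq0n add1n addnS -addSn mulrCA -cexpD; congr (_ * cexp _).
by rewrite !rmorphB; ring.
Qed.

(* [poisson_form w m k] is sum_{i,j} al_i conj(al_j) times the kernel
   exp(-|x| Re w -+ i x Im w), x = ln i - ln j, over m <= i, j < m + k. *)
Fixpoint poisson_form (w : R[i]) (m k : nat) : R :=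
  if k is k'.+1 then poisson_form w m.+1 k' + cabs2 (al m) +
    2 * ReC (al m * conjc (expsum w m k - al m)) else 0.

(** By [exp_step] the exponential factor of a Horner step does not increase the twisted norm. Adding
    the constant al_m then changes only the coefficient at n = 1, where the twist is r^0 = 1 and the
    value is the explicit [expsum (b 1)]. The cross term is therefore exact, and the resulting bound
    depends neither on r nor on N. *)
Lemma dilation_recursion (S : pred nat) (Phi : R[i] -> R[i]) (b : nat -> R[i]) m k :
  (forall m n, S m -> S n -> S (m * n)%N) -> S 1%N ->
  unif_apx S Phi b -> (0 < m)%N ->
  exists v, [/\ unif_apx S (fun s => expsum (Phi s) m k) v,
    v 1%N = expsum (b 1%N) m k &
    forall r, (forall N f, 0 <= qform (omtwist r b) f N) -> forall N,
      \sum_(1 <= n < N.+1) cabs2 (omtwist r v n) <= poisson_form (b 1%N) m k].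
Proof.
move=> SM S1 H; elim: k m => [|k IH] m m0.
  exists (fun=> 0); split; first 2 last.
  - by move=> r _ N; rewrite big1 // => n _; rewrite /omtwist mulr0 /cabs2 /= expr0n addr0.
  - move=> eps eps0; apply: (apx_ext (apx_const eps 0 S1)) => // n.
      by rewrite /expsum big_ord0.
    by case: eqP.
  - by rewrite /expsum big_ord0.
have [v [h1 h2 h3]] := IH m.+1 isT.
have t0 : 0 <= ln m.+1%:R - ln m%:R :> R.
  by rewrite subr_ge0 ler_ln ?posrE ?ltr0n // ler_nat.
have [v' [k1 k2 k3]] := exp_step SM H h1 t0.
exists (fun n => (if n == 1%N then al m else 0) + v' n); split.
- move=> eps eps0; apply: (apx_ext (apx_add (apx_const eps (al m) S1) (k1 _ eps0))) => // s _.
  by rewrite expsumS.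
- by rewrite expsumS // k2 h2.
move=> r Q; set v1 := fun n => _ + _.
(* The range always contains n = 1, the index at which the constant is added; the empty range is
   treated at the end. *)
have H1 N : \sum_(1 <= n < N.+2) cabs2 (omtwist r v1 n) <= poisson_form (b 1%N) m k.+1.
  rewrite [leRHS]/= expsumS // [al m + _ - _]addrAC subrr add0r -h2 -k2.
  rewrite [leLHS](_ : _ = \sum_(1 <= n < N.+2) cabs2 (omtwist r v' n) +
     cabs2 (al m) + 2 * ReC (al m * conjc (v' 1%N))).
    by rewrite !lerD2r (le_trans (k3 _ _ (Q _))) // h3.
  rewrite big_ltn // [in RHS]big_ltn //.
  rewrite (@eq_big_nat _ _ _ _ _ (fun n => cabs2 (omtwist r v1 n)) (fun n => cabs2 (omtwist r v' n))).
    rewrite /v1 /omtwist bigOmega1 expr0 !mul1r cabs2D; ring.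
  move=> n /andP[n2 _].
  by rewrite /omtwist /v1 gtn_eqF // add0r.
case=> [|N]; last exact: H1.
apply: le_trans (H1 0%N); rewrite big_geq // sumr_ge0 // => n _; exact: cabs2_ge0.
Qed.

End Recursion.

Lemma npow_split (R : realType) n (s : R[i]) (x : R) : (0 < n)%N ->
  npow n s = (n%:R `^ (- x))%:C * cexp (- ((ln n%:R)%:C * (s - x%:C))).
Proof.
move=> n0; have -> : s = x%:C + (s - x%:C) by rewrite addrC subrK.
rewrite npowD // [x%:C + _ - _]addrAC subrr add0r [npow n (s - _)]npow_cexp //; congr (_ * _).
rewrite (_ : x%:C = x +i* 0) // npow_line // mulr0 cisN0 mulr1 //.
Qed.

Definition alpha_coef {R : realType} (a : nat -> R[i]) (y : R) (n : nat) : R[i] :=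
  a n * (n%:R `^ (- (2^-1 + y)))%:C.

Lemma dpartial_expsum (R : realType) (a : nat -> R[i]) (y : R) (s : R[i]) M :
  dpartial a s M = expsum (alpha_coef a y) (s - (2^-1 + y)%:C) 1 M.
Proof.
rewrite /dpartial /expsum big_add1 /= big_mkord; apply: eq_bigr => i _.
rewrite add1n ln1 subr0 (@npow_split _ i.+1 s (2^-1 + y)) // /alpha_coef mulrA //.
Qed.

(** The recursion is run separately for each y, with a symbol and a twist depending on y, but all
    runs expand the same function P o phi; uniqueness of coefficients provides one b for all y. The
    value y = kappa / 2 merely selects it. *)
Lemma symbol_comp (R : realType) (c : nat -> R[i]) (phi : R[i] -> R[i])
    (a : nat -> R[i]) M : GH_char0 c phi ->
  exists2 b, unif_apx predT (fun s => dpartial a (phi s) M) b &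
    forall (y : R) N, let kappa := ReC (c 1%N) - 2^-1 in 0 < y < kappa ->
      \sum_(1 <= n < N.+1) (((kappa - y) / (kappa + y)) ^+ bigOmega n) ^+ 2 * cabs2 (b n) <=
      poisson_form (alpha_coef a y) (c 1%N - (2^-1 + y)%:C) 1 M.
Proof.
move=> GH; set kappa := ReC (c 1%N) - 2^-1.
have H y : 0 < y < kappa -> exists2 b, unif_apx predT (fun s => dpartial a (phi s) M) b &
    forall N, \sum_(1 <= n < N.+1) (((kappa - y) / (kappa + y)) ^+ bigOmega n) ^+ 2 * cabs2 (b n) <=
      poisson_form (alpha_coef a y) (c 1%N - (2^-1 + y)%:C) 1 M.
  move=> yk; have HP := unif_apx_shift (2^-1 + y) (isT : predT 1%N) (GH_char0_apx GH).
  have [b [b1 _ b2]] := @dilation_recursion R (alpha_coef a y) predT _ _ 1 M (fun _ _ _ _ => isT) isT HP isT.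
  exists b => [eps eps0|N].
    apply: (apx_ext (b1 _ eps0)) => // s _; rewrite -dpartial_expsum //.
  have := b2 ((kappa - y) / (kappa + y)) _ N.
  rewrite {2}/shift1 eqxx; under eq_bigr do rewrite cabs2_realM.
  by apply => N' f; apply: symbol_harnack GH _ _ _ yk.
have k0 := symbol_kappa_gt0 GH.
have [|b b1 b2] := H (kappa / 2); first by apply/andP; split; rewrite -/kappa in k0; lra.
exists b => // y N /= /H [b' b'1 b'2].
rewrite (@eq_big_nat _ _ _ _ _ _ (fun n => (((kappa - y) / (kappa + y)) ^+ bigOmega n) ^+ 2 * cabs2 (b' n))) //.
move=> n /andP[n0 _]; congr (_ * cabs2 _).
exact: (@apx_unique _ 1 predT ler01 _ _ _ _ (b1 _ ltr01) (b'1 _ ltr01)).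
Qed.

(** * The symbol of a half-plane map *)

Definition pow2 (n : nat) : bool := n == (2 ^ trunc_log 2 n)%N.

Lemma pow2_exp k : pow2 (2 ^ k).
Proof. by rewrite /pow2 trunc_expnK. Qed.

Lemma pow2P n : pow2 n -> exists k, n = (2 ^ k)%N.
Proof. by move/eqP => e; exists (trunc_log 2 n). Qed.

Lemma pow2M m n : pow2 m -> pow2 n -> pow2 (m * n).
Proof. by move=> /pow2P[i ->] /pow2P[j ->]; rewrite -expnD pow2_exp. Qed.

Lemma sum_pow2 (V : nmodType) (F : nat -> V) N : (0 < N)%N ->
  (forall n, ~~ pow2 n -> F n = 0) ->
  \sum_(1 <= n < N.+1) F n = \sum_(k < (trunc_log 2 N).+1) F (2 ^ k)%N.
Proof.
move=> N0 F0; elim: N N0 => // -[|N] IH _.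
  by rewrite big_nat1 trunc_log1 big_ord1.
rewrite big_nat_recr //= IH //; set M := N.+1; set k := trunc_log 2 M.
have kM : (2 ^ k <= M)%N by apply: trunc_logP.
have Mk : (M < 2 ^ k.+1)%N by apply: trunc_log_ltn.
have [e|ne] := eqVneq M.+1 (2 ^ k.+1)%N.
  by rewrite e trunc_expnK // [RHS]big_ord_recr.
have l : trunc_log 2 M.+1 = k.
  by apply: trunc_log_eq => //; rewrite (leq_trans kM) //= ltn_neqAle ne.
rewrite l F0 ?addr0 //; apply/negP => /eqP; rewrite l => e.
by move: kM; rewrite -e ltnn.
Qed.

Lemma npow_pow2 (R : realType) k (s : R[i]) : npow (2 ^ k) s = npow 2 s ^+ k.
Proof.
elim: k => [|k IH]; first by rewrite expn0 npow1.
by rewrite expnS npowM ?expn_gt0 // IH exprS.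
Qed.

(** From (1 - z) / (1 + z) = 2 / (1 + z) - 1, the symbol is 3/2 + 2 times the sum over k >= 1 of
    (-z)^k at z = 2^-s. *)
Definition cpsi {R : realType} (n : nat) : R[i] :=
  if n == 1%N then 3 / 2 else if pow2 n then 2 * (-1) ^+ trunc_log 2 n else 0.

Lemma psi_partial (R : realType) (s : R[i]) N : (0 < N)%N -> 1 + npow 2 s != 0 ->
  psi s - dpartial cpsi s N = 2 * (- npow 2 s) ^+ (trunc_log 2 N).+1 / (1 + npow 2 s).
Proof.
move=> N0; set z := npow 2 s => z1.
rewrite /dpartial sum_pow2 //; last first.
  move=> n np; rewrite /cpsi (negbTE np); case: eqP => [e|_]; last by rewrite mul0r.
  by move: np; rewrite e.
have -> : \sum_(k < (trunc_log 2 N).+1) cpsi (2 ^ k) * npow (2 ^ k) s =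
   2 * \sum_(k < (trunc_log 2 N).+1) (- z) ^+ k - 2^-1.
  rewrite big_ord_recl [in RHS]big_ord_recl /= expn0 npow1 /cpsi eqxx mulr1 expr0.
  rewrite mulrDr mulr1 [in RHS]addrAC; congr (_ + _); first by field.
  rewrite mulr_sumr; apply: eq_bigr => i _; rewrite /bump leq0n add1n.
  rewrite gtn_eqF ?(ltn_exp2l 0) // pow2_exp trunc_expnK // npow_pow2 -/z.
  by rewrite [(- z) ^+ _]exprNn mulrA.
set K := (trunc_log 2 N).+1.
have e : (1 + z) * \sum_(k < K) (- z) ^+ k = 1 - (- z) ^+ K.
  rewrite -[in RHS](expr1n R[i] K) subrXX opprK; congr (_ * _).
  by apply: eq_bigr => i _; rewrite expr1n mul1r.
have -> : \sum_(k < K) (- z) ^+ k = (1 - (- z) ^+ K) / (1 + z).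
  by rewrite -e mulrAC mulfV // mul1r.
by rewrite /psi /Tmap -/z; field.
Qed.

Lemma modc_npow2_lt (R : realType) (eps : R) (s : R[i]) : eps < ReC s ->
  modc (npow 2 s) < 2 `^ (- eps).
Proof.
move=> es; rewrite modc_npow // /powR (negbTE (_ : (2 : R) != 0)) ?pnatr_eq0 //.
by rewrite ltr_expR ltr_pM2r ?ltrN2 // ln_gt0 // ltr1n.
Qed.

Lemma pow2_lt1 (R : realType) (eps : R) : 0 < eps -> 2 `^ (- eps) < 1 :> R.
Proof.
move=> e0; rewrite /powR (negbTE (_ : (2 : R) != 0)) ?pnatr_eq0 // -[ltRHS]expR0.
by rewrite ltr_expR mulNr oppr_lt0 mulr_gt0 // ln_gt0 // ltr1n.
Qed.

Lemma modc_1D_ge (R : realType) (z : R[i]) : 1 - modc z <= modc (1 + z).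
Proof.
have := modcD (1 + z) (- z); rewrite addrK modc1 modcN; lra.
Qed.

Lemma ReC_inv (R : realType) (w : R[i]) : ReC w^-1 = ReC w / cabs2 w.
Proof. by case: w. Qed.

Lemma ImC_inv (R : realType) (w : R[i]) : ImC w^-1 = - ImC w / cabs2 w.
Proof. by case: w => a b; rewrite mulNr. Qed.

(** Uniform convergence follows from the geometric tail, as |2^-s| < rho < 1 when Re s > eps. The
    half-plane condition amounts to |1 + z|^2 < 2 Re (1 + z), that is |z| < 1. *)
Lemma psi_GH (R : realType) : GH_char0 cpsi (@psi R).
Proof.
split=> [eps eps0 e e0|s s0]; last first.
  have z1 : modc (npow 2 s) < 1.
    by have := modc_npow2_lt s0; rewrite oppr0 powRr0.
  have d1 := modc_1D_ge (npow 2 s).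
  have w0 : 1 + npow 2 s != 0 by apply/eqP => h; move: d1; rewrite h modc0; lra.
  have -> : psi s = 2 * (1 + npow 2 s)^-1 - 2^-1 by rewrite /psi /Tmap; field.
  have R2 (x : R[i]) : ReC (2 * x) = 2 * ReC x by rewrite !mulr_natl !mulr2n ReCD.
  rewrite ReCD ReCN R2 ReC_inv.
  have c0 : 0 < cabs2 (1 + npow 2 s).
    rewrite -sqr_modc exprn_gt0 //; lra.
  have h : cabs2 (1 + npow 2 s) < 2 * ReC (1 + npow 2 s).
    have : cabs2 (npow 2 s) < 1 by rewrite -sqr_modc expr_lt1 ?modc_ge0.
    by case: (npow 2 s) => a b; rewrite /cabs2 /=; lra.
  have h1 : 1 < 2 * (ReC (1 + npow 2 s) / cabs2 (1 + npow 2 s)).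
    by rewrite mulrA ltr_pdivlMr // mul1r.
  have -> : ReC (2^-1 : R[i]) = 2^-1 by rewrite ReC_inv /cabs2 /=; field.
  lra.
pose rho : R := 2 `^ (- eps).
have r0 : 0 < rho by rewrite powR_gt0.
have r1 : rho < 1 by apply: pow2_lt1.
have d0 : 0 < e * (1 - rho) / 4 by rewrite divr_gt0 // mulr_gt0 // subr_gt0.
have /cvgrPdist_le/(_ _ d0)[K0 _ hK0] : (fun n => rho ^+ n) @ \oo --> (0 : R).
  by apply: cvg_expr; rewrite ger0_norm // ltW.
exists (2 ^ K0)%N => N NK s ss; rewrite -/(modc _).
have N0 : (0 < N)%N by apply: leq_trans NK; rewrite expn_gt0.
have zr := modc_npow2_lt ss; rewrite -/rho in zr.
have z1 := modc_1D_ge (npow 2 s).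
have zn : 1 + npow 2 s != 0 by apply/eqP => h; move: z1; rewrite h modc0; lra.
rewrite psi_partial // !modcM modcV modcX modcN.
have -> : modc (2 : R[i]) = 2.
  by rewrite (_ : 2 = (2 : R)%:C) ?modc_real ?ger0_norm // rmorph_nat.
have KN : (K0 <= (trunc_log 2 N).+1)%N.
  by rewrite ltnW // ltnS -(trunc_expnK K0 (isT : (1 < 2)%N)) leq_trunc_log.
have := hK0 _ KN; rewrite sub0r normrN ger0_norm ?exprn_ge0 ?(ltW r0) // => h.
have h2 : modc (npow 2 s) ^+ (trunc_log 2 N).+1 <= e * (1 - rho) / 4.
  by apply: le_trans h; rewrite lerXn2r ?nnegrE ?modc_ge0 ?(ltW r0) // ltW.
rewrite ltr_pdivrMr; last by lra.
have : e * (1 - rho) <= e * modc (1 + npow 2 s) by rewrite ler_wpM2l ?(ltW e0) //; lra.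
by have : 0 < e * (1 - rho) by [rewrite mulr_gt0 // subr_gt0]; lra.
Qed.

Lemma psi_apx (R : realType) : unif_apx pow2 (@psi R) cpsi.
Proof.
apply: GH_char0_apx_supp (@psi_GH R) => n np; rewrite /cpsi (negbTE np).
by case: eqP => // e; move: np; rewrite e.
Qed.

(** * Averages over the circle *)

Section Average.
Variable R : realType.
Local Notation mu := (@lebesgue_measure R).

(** The variable u is half the angle on the circle, so that the boundary values of (1 - z) / (1 + z)
    at z = e^(-2 i u) are i tan u; the open interval omits the pole z = -1. *)
Definition halfcircle : set R := `](- (pi / 2)), (pi / 2)[%classic.

Definition bmf (f : R -> R) : Prop :=
  measurable_fun halfcircle f /\
  exists B, forall u, halfcircle u -> `|f u| <= B.

Definition avg (f : R -> R) : R := (\int[mu]_(u in halfcircle) f u)%R / pi.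

Lemma measurable_halfcircle : measurable halfcircle.
Proof. exact: measurable_itv. Qed.
Local Hint Resolve measurable_halfcircle : core.

Lemma pi_half_lt : - (pi / 2) < pi / 2 :> R.
Proof. by have := pi_gt0 R; lra. Qed.

Lemma mu_halfcircle : mu halfcircle = (pi : R)%:E.
Proof.
rewrite /halfcircle lebesgue_measure_itv /= lte_fin pi_half_lt -EFinB.
by congr _%:E; lra.
Qed.

Lemma bmf_integrable f : bmf f -> mu.-integrable halfcircle (EFin \o f).
Proof.
move=> [mf [B hB]]; apply: measurable_bounded_integrable => //.
  by rewrite [ltLHS]mu_halfcircle ltry.
exists B; split; rewrite ?num_real // => x Bx u Du.
by apply: (le_trans (hB u Du)); rewrite ltW.
Qed.

Lemma bmf_cst c : bmf (fun=> c).
Proof. by split; [exact: measurable_cst|exists `|c| => u _]. Qed.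

Lemma bmfD f g : bmf f -> bmf g -> bmf (fun u => f u + g u).
Proof.
move=> [mf [B hB]] [mg [C hC]]; split; first exact: measurable_funD.
by exists (B + C) => u Du; rewrite (le_trans (ler_normD _ _)) // lerD ?hB ?hC.
Qed.

Lemma bmfZ c f : bmf f -> bmf (fun u => c * f u).
Proof.
move=> [mf [B hB]]; split; first by apply: measurable_funM => //; exact: measurable_cst.
by exists (`|c| * B) => u Du; rewrite normrM ler_wpM2l // hB.
Qed.

Lemma bmf_ext f g : (forall u, halfcircle u -> f u = g u) -> bmf f -> bmf g.
Proof.
move=> fg [mf [B hB]]; split.
  by apply: eq_measurable_fun mf => u; rewrite inE => /fg.
by exists B => u Du; rewrite -fg // hB.
Qed.

Lemma avg_ext f g : (forall u, halfcircle u -> f u = g u) -> avg f = avg g.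
Proof. by move=> fg; congr (_ / _); apply: eq_Rintegral => u; rewrite inE => /fg. Qed.

Lemma avgD f g : bmf f -> bmf g -> avg (fun u => f u + g u) = avg f + avg g.
Proof.
by move=> hf hg; rewrite /avg RintegralD ?mulrDl //; exact: bmf_integrable.
Qed.

Lemma avgZ c f : bmf f -> avg (fun u => c * f u) = c * avg f.
Proof. by move=> hf; rewrite /avg RintegralZl ?mulrA //; exact: bmf_integrable. Qed.

Lemma avg_cst c : avg (fun=> c) = c.
Proof.
rewrite /avg Rintegral_cst // [X in fine X]mu_halfcircle /= mulfK //.
by rewrite gt_eqF ?pi_gt0.
Qed.

Lemma avg_cvg (f_ : nat -> R -> R) f B : (forall n, bmf (f_ n)) ->
  (forall n u, halfcircle u -> `|f_ n u| <= B) ->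
  (forall u, halfcircle u -> (fun n => f_ n u) @ \oo --> f u) ->
  bmf f /\ (fun n => avg (f_ n)) @ \oo --> avg f.
Proof.
move=> hf hB cf.
have mf : measurable_fun halfcircle f.
  by apply: (measurable_fun_cvg (fun n => (hf n).1)) => u Du; exact: cf.
have bf : bmf f.
  split => //; exists B => u Du.
  have c : (fun n => `|f_ n u|) @ \oo --> `|f u| by apply: cvg_norm; exact: cf.
  by apply: (cvgr_to_le c); apply: nearW => n; exact: hB.
split => //.
have ig : mu.-integrable halfcircle (EFin \o (fun=> B)) by apply/bmf_integrable/bmf_cst.
have [] := @dominated_convergence _ _ _ mu halfcircle measurable_halfcircle
  (fun n => EFin \o f_ n) (EFin \o f) (EFin \o (fun=> B)).
- by move=> n; apply/measurable_EFinP; exact: (hf n).1.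
- exact/measurable_EFinP.
- apply: aeW => u Du; apply: cvg_EFin; first exact: nearW.
  exact: cf.
- exact: ig.
- by apply: aeW => u n Du /=; rewrite lee_fin hB.
move=> i1 _ c; have i2 := bmf_integrable bf.
rewrite /avg; apply: cvgMl; apply: fine_cvg.
by rewrite fineK //; exact: integrable_fin_num.
Qed.

Lemma bmf_sum (f : nat -> R -> R) K : (forall k, bmf (f k)) ->
  bmf (fun u => \sum_(k < K) f k u) /\
  avg (fun u => \sum_(k < K) f k u) = \sum_(k < K) avg (f k).
Proof.
move=> hf; elim: K => [|K [IH1 IH2]].
  split; first by apply: (bmf_ext (f := fun=> 0)) (bmf_cst 0) => u _; rewrite big_ord0.
  by rewrite big_ord0 -[RHS](avg_cst 0); apply: avg_ext => u _; rewrite big_ord0.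
have e u : \sum_(k < K.+1) f k u = \sum_(k < K) f k u + f K u by rewrite big_ord_recr.
split; first by apply: (bmf_ext (f := fun u => \sum_(k < K) f k u + f K u)) (bmfD IH1 (hf K)) => u _.
rewrite big_ord_recr /= -IH2 -avgD //; exact: avg_ext.
Qed.

Lemma bmf_continuous f B : continuous f -> (forall u, `|f u| <= B) -> bmf f.
Proof.
move=> cf hB; split; last by exists B => u _.
by apply: measurable_funTS; exact: continuous_measurable_fun.
Qed.

Lemma avg_trig (x y : R) k : (0 < k)%N ->
  avg (fun u => x * cos (k%:R * (2 * u)) + y * sin (k%:R * (2 * u))) = 0.
Proof.
move=> k0; set f := fun u => _.
have k0' : (k%:R : R) != 0 by rewrite pnatr_eq0 -lt0n.
pose F u : R := (x * sin (k%:R * (2 * u)) - y * cos (k%:R * (2 * u))) / (2 * k%:R).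
have dF (u : R) : is_derive u (1 : R) F (f u).
  rewrite /F; apply: is_derive_eq.
  rewrite /f /GRing.scale /=; field; exact: k0'.
have cf : continuous f.
  move=> u; rewrite /f; apply: cvgD; apply: cvgM; try exact: cvg_cst.
    apply: continuous_comp; last exact: continuous_cos.
    by apply: cvgM; [exact: cvg_cst|apply: cvgM; [exact: cvg_cst|exact: cvg_id]].
  apply: continuous_comp; last exact: continuous_sin.
  by apply: cvgM; [exact: cvg_cst|apply: cvgM; [exact: cvg_cst|exact: cvg_id]].
have cF : continuous F.
  by move=> u; apply/differentiable_continuous/derivable1_diffP; apply: ex_derive.
have sk : sin (k%:R * pi) = 0 :> R.
  by elim: (k) => [|n IH]; rewrite ?mul0r ?sin0 // -natr1 mulrDl mul1r sinDpi IH oppr0.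
have bf : bmf f.
  apply: (@bmf_continuous _ (`|x| + `|y|) cf) => u; rewrite /f (le_trans (ler_normD _ _)) //.
  by rewrite !normrM lerD // ler_piMr // ?cos_max ?sin_max.
rewrite /avg (_ : Rintegral _ _ _ = 0) ?mul0r // /Rintegral /halfcircle.
rewrite -(@integral_itv_bndoo _ _ _ _ true false); last first.
  by apply/measurable_EFinP; exact: bf.1.
rewrite (@continuous_FTC2 _ f F) ?pi_half_lt //.
- rewrite -EFinB /= /F.
  have -> : k%:R * (2 * (pi / 2)) = k%:R * pi :> R by field.
  have -> : k%:R * (2 * (- (pi / 2))) = - (k%:R * pi) :> R by field.
  by rewrite sinN cosN sk oppr0 subrr.
- exact: continuous_subspaceT.
- split; first by move=> u _; apply: ex_derive.
  + by apply: cvg_at_right_filter; exact: cF.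
  + by apply: cvg_at_left_filter; exact: cF.
- by move=> u _; rewrite derive1E; apply: derive_val.
Qed.

Definition vline (sigma u : R) : R[i] := sigma +i* (2 * u / ln 2).

Lemma npow2_vline sigma u k :
  npow (2 ^ k) (vline sigma u) = (2 `^ (- sigma) ^+ k)%:C * cisN (k%:R * (2 * u)).
Proof.
have l2 : ln (2 : R) != 0 by rewrite gt_eqF // ln_gt0 // ltr1n.
rewrite /vline npow_line ?expn_gt0 //; congr (_%:C * cisN _).
  rewrite natrX -[2 ^+ k]powR_mulrn // -!powRrM -powR_mulrn ?powR_ge0 // -powRrM.
  by rewrite mulrC.
rewrite natrX lnXn // -[_ *+ k]mulr_natl; field; exact: l2.
Qed.

Lemma avg_dpartial (q : nat -> R[i]) N sigma : (forall n, ~~ pow2 n -> q n = 0) ->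
  (forall n, (N < n)%N -> q n = 0) ->
  bmf (fun u => ReC (dpartial q (vline sigma u) N)) /\
  avg (fun u => ReC (dpartial q (vline sigma u) N)) = ReC (q 1%N).
Proof.
move=> q2 qN; case: (posnP N) => [N0|N0].
  rewrite (qN 1%N) ?N0 // /=.
  have e u : ReC (dpartial q (vline sigma u) 0) = 0 by rewrite /dpartial big_geq.
  split; first by apply: (bmf_ext (f := fun=> 0)) (bmf_cst 0) => u _; rewrite e.
  by rewrite -[RHS](avg_cst 0); apply: avg_ext => u _; rewrite e.
pose rho : R := 2 `^ (- sigma).
pose f k u := rho ^+ k * ReC (q (2 ^ k)%N) * cos (k%:R * (2 * u)) +
  rho ^+ k * ImC (q (2 ^ k)%N) * sin (k%:R * (2 * u)).
have e u : ReC (dpartial q (vline sigma u) N) = \sum_(k < (trunc_log 2 N).+1) f k u.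
  rewrite /dpartial sum_pow2 //; last by move=> n /q2 ->; rewrite mul0r.
  rewrite ReC_sum; apply: eq_bigr => k _; rewrite npow2_vline /f -/rho.
  by case: (q _) => a b; rewrite /cisN /=; ring.
have bf k : bmf (f k).
  apply: (@bmf_continuous _ (`|rho ^+ k * ReC (q (2 ^ k)%N)| + `|rho ^+ k * ImC (q (2 ^ k)%N)|)).
    move=> u; rewrite /f; apply: cvgD; apply: cvgM; try exact: cvg_cst.
      apply: continuous_comp; last exact: continuous_cos.
      by apply: cvgM; [exact: cvg_cst|apply: cvgM; [exact: cvg_cst|exact: cvg_id]].
    apply: continuous_comp; last exact: continuous_sin.
    by apply: cvgM; [exact: cvg_cst|apply: cvgM; [exact: cvg_cst|exact: cvg_id]].
  move=> u; rewrite /f (le_trans (ler_normD _ _)) //.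
  by rewrite lerD // normrM ler_piMr // ?cos_max ?sin_max.
have [b1 b2] := bmf_sum (trunc_log 2 N).+1 bf.
split; first by apply: bmf_ext b1 => u _.
rewrite (avg_ext (g := fun u => \sum_(k < (trunc_log 2 N).+1) f k u)) // b2.
rewrite big_ord_recl big1 ?addr0 => [|k _]; last by rewrite /f avg_trig.
rewrite -[RHS]avg_cst; apply: avg_ext => u _.
by rewrite /f mul0r cos0 sin0 expr0 mulr0 addr0 mulr1 mul1r.
Qed.

(** The mean value property in the variable z = 2^-s: the first coefficient is the value at the
    centre z = 0. It holds for polynomials term by term and survives bounded limits. *)
Lemma avg_apx (G : R[i] -> R[i]) g sigma : 0 < sigma -> unif_apx pow2 G g ->
  bmf (fun u => ReC (G (vline sigma u))) /\
  avg (fun u => ReC (G (vline sigma u))) = ReC (g 1%N).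
Proof.
move=> s0 H; have s2 : 0 < sigma / 2 by rewrite divr_gt0.
have ls u : sigma / 2 < ReC (vline sigma u) by rewrite /=; lra.
have [B B0 hB] := apx_bounded (ltW s2) (H _ s2).
have A n : exists q : (nat -> R[i]) * nat, [/\ forall n, ~~ pow2 n -> q.1 n = 0,
   forall n, (q.2 < n)%N -> q.1 n = 0,
   forall u, modc (G (vline sigma u) - dpartial q.1 (vline sigma u) q.2) <= n.+1%:R^-1 &
   modc (q.1 1%N - g 1%N) <= n.+1%:R^-1].
  have n0 : (0 : R) < n.+1%:R^-1 by rewrite invr_gt0.
  have [N [q [q1 q2 q3 q4]]] := H _ s2 _ n0 1%N.
  by exists (q, N); split => //= [u|]; [exact: q3|exact: q4].
have [Q hQ] := choice A.
pose f_ n u := ReC (dpartial (Q n).1 (vline sigma u) (Q n).2).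
have hf n : bmf (f_ n) /\ avg (f_ n) = ReC ((Q n).1 1%N).
  by have [q1 q2 _ _] := hQ n; exact: avg_dpartial.
have h0 : (fun n => n.+1%:R^-1) @ \oo --> (0 : R) by exact: cvg_harmonic.
have cf u : (fun n => f_ n u) @ \oo --> ReC (G (vline sigma u)).
  apply/cvgrPdist_le => e e0; have /cvgrPdist_le/(_ _ e0)[N0 _ hN] := h0.
  exists N0 => // n /hN; rewrite sub0r normrN ger0_norm ?invr_ge0 // => h.
  have [_ _ q3 _] := hQ n; apply: le_trans h; apply: le_trans (q3 u).
  by have := le_ReC_modc (G (vline sigma u) - dpartial (Q n).1 (vline sigma u) (Q n).2); rewrite ReCD ReCN.
have bd n u : halfcircle u -> `|f_ n u| <= B + 1.
  move=> _; have [_ _ q3 _] := hQ n; rewrite (le_trans (le_ReC_modc _)) //.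
  rewrite -(subrK (G (vline sigma u)) (dpartial _ _ _)) (le_trans (modcD _ _)) // addrC.
  rewrite lerD ?hB // modcB (le_trans (q3 u)) // invf_le1 ?ler1n //.
have [bG cG] := avg_cvg (fun n => (hf n).1) bd (fun u _ => cf u).
split => //; apply: (cvg_unique (@Rhausdorff R) cG).
rewrite (_ : (fun n => avg (f_ n)) = fun n => ReC ((Q n).1 1%N)); last first.
  by apply/funext => n; rewrite (hf n).2.
apply/cvgrPdist_le => e e0; have /cvgrPdist_le/(_ _ e0)[N0 _ hN] := h0.
exists N0 => // n /hN; rewrite sub0r normrN ger0_norm ?invr_ge0 // => h.
have [_ _ _ q4] := hQ n; apply: le_trans h; apply: le_trans q4.
by rewrite distrC -ReCN -ReCD le_ReC_modc.
Qed.

End Average.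

(** * Componentwise convergence of complex sequences *)

Lemma ccvg_cst (R : realType) (z : R[i]) : ccvg (fun=> z) z.
Proof. by split; exact: cvg_cst. Qed.

Lemma ccvgD (R : realType) (u v : nat -> R[i]) a b : ccvg u a -> ccvg v b ->
  ccvg (fun n => u n + v n) (a + b).
Proof.
move=> [u1 u2] [v1 v2]; have h1 := cvgD u1 v1; have h2 := cvgD u2 v2.
have e1 : (fun n => ReC (u n + v n)) = (fun n => ReC (u n) + ReC (v n)).
  by apply/funext => n; rewrite ReCD.
have e2 : (fun n => ImC (u n + v n)) = (fun n => ImC (u n) + ImC (v n)).
  by apply/funext => n; case: (u n) (v n) => ? ? [].
case: a b u1 u2 v1 v2 h1 h2 => [a1 a2] [b1 b2] /= _ _ _ _ h1 h2.
by split; rewrite ?e1 ?e2; [exact: h1|exact: h2].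
Qed.

Lemma ccvgM (R : realType) (u v : nat -> R[i]) a b : ccvg u a -> ccvg v b ->
  ccvg (fun n => u n * v n) (a * b).
Proof.
move=> [u1 u2] [v1 v2].
have h1 := cvgB (cvgM u1 v1) (cvgM u2 v2); have h2 := cvgD (cvgM u1 v2) (cvgM u2 v1).
have e1 : (fun n => ReC (u n * v n)) = (fun n => ReC (u n) * ReC (v n) - ImC (u n) * ImC (v n)).
  by apply/funext => n; case: (u n) (v n) => ? ? [].
have e2 : (fun n => ImC (u n * v n)) = (fun n => ReC (u n) * ImC (v n) + ImC (u n) * ReC (v n)).
  by apply/funext => n; case: (u n) (v n) => ? ? [].
case: a b u1 u2 v1 v2 h1 h2 => [a1 a2] [b1 b2] /= _ _ _ _ h1 h2.
by split; rewrite ?e1 ?e2; [exact: h1|exact: h2].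
Qed.

Lemma ccvg_cexp (R : realType) (u : nat -> R[i]) a : ccvg u a ->
  ccvg (fun n => cexp (u n)) (cexp a).
Proof.
move=> [u1 u2]; split; rewrite /cexp /=.
  apply: cvgM; apply: continuous_cvg => //; first exact: continuous_expR.
  exact: continuous_cos.
apply: cvgM; apply: continuous_cvg => //; first exact: continuous_expR.
exact: continuous_sin.
Qed.

Lemma ccvg_sum (R : realType) (u : nat -> nat -> R[i]) a k :
  (forall i, ccvg (u i) (a i)) ->
  ccvg (fun n => \sum_(i < k) u i n) (\sum_(i < k) a i).
Proof.
move=> H; elim: k => [|k IH].
  rewrite big_ord0 (_ : (fun n => _) = fun=> 0); first exact: ccvg_cst.
  by apply/funext => n; rewrite big_ord0.
rewrite big_ord_recr (_ : (fun n => _) = fun n => \sum_(i < k) u i n + u k n).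
  exact: ccvgD.
by apply/funext => n; rewrite big_ord_recr.
Qed.

Lemma ccvg_expsum (R : realType) (al : nat -> R[i]) (w : nat -> R[i]) z m k :
  ccvg w z -> ccvg (fun n => expsum al (w n) m k) (expsum al z m k).
Proof.
move=> H; apply: (@ccvg_sum _ (fun i n => al (m + i)%N *
  cexp (- ((ln (m + i)%:R - ln m%:R)%:C * w n))) (fun i => al (m + i)%N *
  cexp (- ((ln (m + i)%:R - ln m%:R)%:C * z)))) => i.
apply: ccvgM; first exact: ccvg_cst.
apply: ccvg_cexp; rewrite -mulNr (_ : (fun n => _) =
  fun n => - (ln (m + i)%:R - ln m%:R)%:C * w n).
  by apply: ccvgM => //; exact: ccvg_cst.
by apply/funext => n; rewrite mulNr.
Qed.

Lemma modc_expsum_le (R : realType) (al : nat -> R[i]) (w : R[i]) m k : (0 < m)%N ->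
  0 <= ReC w -> modc (expsum al w m k) <= \sum_(i < k) modc (al (m + i)%N).
Proof.
move=> m0 w0; apply: (le_trans (modc_sum _ _ _)); apply: ler_sum => i _.
rewrite modcM ler_piMr ?modc_ge0 // modc_cexp -[leRHS]expR0 ler_expR.
rewrite ReCN ReC_realM oppr_le0 mulr_ge0 // subr_ge0 ler_ln ?posrE ?ltr0n ?ltn_addr //.
by rewrite ler_nat leq_addr.
Qed.

(** * The Poisson form as an average over a vertical line *)

Section PoissonAverage.
Variable R : realType.

Definition tline (w : R[i]) (u : R) : R[i] := 0 +i* (ImC w + ReC w * tan u).

(** The map Re w (1 - z) / (1 + z) + i Im w at z = 2^-s: it sends the disc to the right half-plane
    when Re w > 0, and the centre to w, so arc length on the circle is carried to the Poisson
    measure of w. *)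
Definition hp_symbol (w s : R[i]) : R[i] :=
  (ReC w)%:C * (psi s - (2^-1)%:C) + (0 +i* ImC w).

Lemma hp_symbol_apx w : exists2 b, unif_apx pow2 (hp_symbol w) b & b 1%N = w.
Proof.
exists (fun n => (ReC w)%:C * shift1 cpsi 2^-1 n + (if n == 1%N then 0 +i* ImC w else 0)).
  move=> eps eps0; apply: apx_add; last exact: apx_const.
  by apply: apx_scale; apply: (unif_apx_shift 2^-1 _ (@psi_apx R)).
rewrite /shift1 /cpsi !eqxx (_ : 3 / 2 - (2^-1)%:C = 1) ?mulr1.
  by case: w => a b; apply/eqP; rewrite eq_complex /= addr0 add0r !eqxx.
by rewrite fmorphV rmorph_nat; field.
Qed.

Lemma cos_halfcircle (u : R) : halfcircle u -> 0 < cos u.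
Proof. by rewrite /halfcircle /= in_itv /= => h; exact: cos_gt0_pihalf. Qed.

(** At z = e^(-2 i u) the quotient (1 - z) / (1 + z) equals i tan u, since |1 + z|^2 = 4 cos(u)^2
    does not vanish inside the interval. The circles |z| = 2^(-1/(n+1)) approach it from within. *)
Lemma hp_symbol_cvg w u : halfcircle u ->
  ccvg (fun n : nat => hp_symbol w (vline n.+1%:R^-1 u)) (tline w u).
Proof.
move=> /cos_halfcircle cu.
have h0 : (fun n => n.+1%:R^-1) @ \oo --> (0 : R) by exact: cvg_harmonic.
pose r n : R := 2 `^ (- n.+1%:R^-1).
have hr : r @ \oo --> (1 : R).
  rewrite /r -[X in _ --> X]expR0 /powR (negbTE (_ : (2 : R) != 0)) ?pnatr_eq0 //.
  apply: continuous_cvg; first exact: continuous_expR.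
  rewrite -[X in _ --> X](mul0r (ln 2)); apply: cvgMl.
  by rewrite -oppr0; exact: cvgN.
pose x n := 1 + r n * cos (2 * u); pose y n := r n * sin (2 * u).
have hx : x @ \oo --> 1 + cos (2 * u).
  by apply: cvgD; [exact: cvg_cst|rewrite -[X in _ --> X]mul1r; exact: cvgMl].
have hy : y @ \oo --> sin (2 * u).
  by rewrite -[X in _ --> X]mul1r; exact: cvgMl.
pose D : R := (1 + cos (2 * u)) ^+ 2 + sin (2 * u) ^+ 2.
have c2 : cos (2 * u) = 2 * cos u ^+ 2 - 1.
  by rewrite mulr_natl mulr2n cosD; have := cos2Dsin2 u; nra.
have s2 : sin (2 * u) = 2 * sin u * cos u by rewrite mulr_natl mulr2n sinD; ring.
have DE : D = 4 * cos u ^+ 2.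
  by rewrite /D c2 s2 !exprMn (_ : sin u ^+ 2 = 1 - cos u ^+ 2); [ring|rewrite -(cos2Dsin2 u); ring].
have D0 : D != 0 by rewrite DE gt_eqF // mulr_gt0 // exprn_gt0.
have hD : (fun n => x n ^+ 2 + y n ^+ 2) @ \oo --> D.
  by apply: cvgD; rewrite expr2; apply: cvgM.
have zE n : 1 + npow 2 (vline n.+1%:R^-1 u) = x n +i* - y n.
  have := npow2_vline n.+1%:R^-1 u 1; rewrite !expr1 mul1r => ->.
  by apply/eqP; rewrite eq_complex /= /x /y /r /cisN /=; apply/andP; split; apply/eqP; ring.
have psiE n : psi (vline n.+1%:R^-1 u) - (2^-1)%:C = 2 * (1 + npow 2 (vline n.+1%:R^-1 u))^-1 - 1.
  rewrite /psi /Tmap; set z := npow _ _.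
  have z1 : 1 + z != 0.
    have := @modc_npow2_lt R 0 (vline n.+1%:R^-1 u); rewrite oppr0 powRr0 /= invr_gt0 ltr0n.
    move=> /(_ isT); rewrite -/z => z1; have := modc_1D_ge z => z2.
    by apply/eqP => h; move: z2; rewrite h modc0; lra.
  by rewrite fmorphV rmorph_nat; field.
have R2 (q : R[i]) : ReC (2 * q - 1) = 2 * ReC q - 1.
  by rewrite !mulr_natl !mulr2n !ReCD ReCN.
have I2 (q : R[i]) : ImC (2 * q - 1) = 2 * ImC q.
  by rewrite !mulr_natl !mulr2n; case: q => a b /=; rewrite subr0.
have hpsi : ccvg (fun n : nat => psi (vline n.+1%:R^-1 u) - (2^-1)%:C) (0 +i* tan u).
  split.
    rewrite (_ : (fun n => _) = (fun n => 2 * (x n / (x n ^+ 2 + y n ^+ 2)) - 1)); last first.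
      by apply/funext => n; rewrite psiE R2 ReC_inv zE /cabs2 /= sqrrN.
    rewrite [X in _ --> X](_ : _ = 2 * ((1 + cos (2 * u)) / D) - 1); last first.
      by rewrite DE c2 /=; field; rewrite gt_eqF.
    apply: cvgB; last exact: cvg_cst.
    by apply: cvgMr; apply: cvgM => //; exact: cvgV.
  rewrite (_ : (fun n => _) = (fun n => 2 * (y n / (x n ^+ 2 + y n ^+ 2)))); last first.
    by apply/funext => n; rewrite psiE I2 ImC_inv zE /cabs2 /= sqrrN opprK.
  rewrite [X in _ --> X](_ : _ = 2 * (sin (2 * u) / D)); last first.
    by rewrite DE s2 /= /tan; field; rewrite gt_eqF.
  by apply: cvgMr; apply: cvgM => //; exact: cvgV.
have -> : tline w u = (ReC w)%:C * (0 +i* tan u) + (0 +i* ImC w).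
  apply/eqP; rewrite eq_complex /tline /=; apply/andP; split; apply/eqP; ring.
by apply: ccvgD; [apply: ccvgM => //|]; exact: ccvg_cst.
Qed.

Lemma hp_symbol_ge0 w s : 0 <= ReC w -> 0 < ReC s -> 0 <= ReC (hp_symbol w s).
Proof.
move=> w0 s0; rewrite /hp_symbol ReCD ReC_realM ReCD ReCN /= addr0.
by rewrite mulr_ge0 // subr_ge0 ltW //; apply: (@psi_GH R).2.
Qed.

(** The induction runs parallel to [poisson_form]. On the boundary line the Horner factor has
    modulus one, so |expsum|^2 equals the square for the shorter piece, plus |al_m|^2, plus a cross
    term linear in an analytic function. The average of that term is its value at the centre, first
    on interior circles and then by bounded convergence. *)
Lemma poisson_avg (al : nat -> R[i]) (w : R[i]) m k : (0 < m)%N -> 0 <= ReC w ->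
  bmf (fun u => cabs2 (expsum al (tline w u) m k)) /\
  avg (fun u => cabs2 (expsum al (tline w u) m k)) = poisson_form al w m k.
Proof.
move=> m0 w0; elim: k m m0 => [|k IH] m m0.
  have e u : cabs2 (expsum al (tline w u) m 0) = 0.
    by rewrite /expsum big_ord0 /cabs2 /= expr0n addr0.
  split; first by apply: (bmf_ext (f := fun=> 0)) (bmf_cst 0) => u _; rewrite e.
  by rewrite -[RHS](avg_cst 0); apply: avg_ext => u _; rewrite e.
have [b1 a1] := IH m.+1 isT.
have [b Hb b1w] := hp_symbol_apx w.
have [v [v1 v2 _]] := dilation_recursion al k.+1 pow2M (pow2_exp 0) Hb m0.
pose A := conjc (al m).
have GA : unif_apx pow2 (fun s => A * (expsum al (hp_symbol w s) m k.+1 - al m))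
    (fun n => A * (v n - (if n == 1%N then al m else 0))).
  move=> eps eps0; apply: apx_scale; apply: apx_sub; first exact: v1.
  exact: apx_const.
pose f_ n u := ReC (A * (expsum al (hp_symbol w (vline n.+1%:R^-1 u)) m k.+1 - al m)).
pose f u := ReC (A * (expsum al (tline w u) m k.+1 - al m)).
have s0 n : (0 : R) < n.+1%:R^-1 by rewrite invr_gt0.
have hf n := avg_apx (s0 n) GA.
have cf u : halfcircle u -> (fun n => f_ n u) @ \oo --> f u.
  move=> Du; have h := ccvg_expsum al m k.+1 (hp_symbol_cvg w Du).
  by have [] := ccvgM (ccvg_cst A) (ccvgD h (ccvg_cst (- al m))).
pose B := modc A * (\sum_(i < k.+1) modc (al (m + i)%N) + modc (al m)).
have bd n u : halfcircle u -> `|f_ n u| <= B.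
  move=> _; rewrite (le_trans (le_ReC_modc _)) // modcM ler_wpM2l ?modc_ge0 //.
  rewrite (le_trans (modcD _ _)) // modcN lerD2r modc_expsum_le // hp_symbol_ge0 //.
  exact: s0.
have [bf cvf] := avg_cvg (fun n => (hf n).1) bd cf.
have af : avg f = ReC (A * (expsum al w m k.+1 - al m)).
  apply: (cvg_unique (@Rhausdorff R) cvf).
  rewrite (_ : (fun n => _) = fun=> ReC (A * (expsum al w m k.+1 - al m))).
    exact: cvg_cst.
  by apply/funext => n; rewrite (hf n).2 v2 b1w.
have E u : cabs2 (expsum al (tline w u) m k.+1) =
    cabs2 (expsum al (tline w u) m.+1 k) + (cabs2 (al m) + 2 * f u).
  rewrite /f expsumS // [al m + _ - _]addrAC subrr add0r.
  set X := cexp _ * _; have -> : cabs2 (expsum al (tline w u) m.+1 k) = cabs2 X.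
    rewrite /X cabs2M -[X in X * _]sqr_modc modc_cexp ReCN ReC_realM mulr0 oppr0.
    by rewrite expR0 expr1n mul1r.
  rewrite cabs2D (_ : ReC (al m * conjc X) = ReC (A * X)); first by ring.
  by rewrite /A; case: (al m) X => [p q] [p' q'] /=; ring.
have bb : bmf (fun u => cabs2 (expsum al (tline w u) m.+1 k) + (cabs2 (al m) + 2 * f u)).
  by apply: bmfD => //; apply: bmfD; [exact: bmf_cst|exact: bmfZ].
split; first by apply: bmf_ext bb => u _; rewrite E.
rewrite (avg_ext (g := fun u => cabs2 (expsum al (tline w u) m.+1 k) + (cabs2 (al m) + 2 * f u))).
  rewrite (avgD b1 (bmfD (bmf_cst _) (bmfZ 2 bf))) (avgD (bmf_cst _) (bmfZ 2 bf)).
  rewrite avgZ // avg_cst a1 af /=.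
  rewrite addrA; congr (_ + 2 * _); rewrite /A.
  by case: (al m) (expsum _ _ _ _) => [p q] [p' q'] /=; ring.
by move=> u _; rewrite E.
Qed.

End PoissonAverage.

(** * From averages over the circle to integrals against the Poisson kernel *)

Section TanSubst.
Variable R : realType.
Local Notation mu := (@lebesgue_measure R).

Lemma in_halfcircle (U u : R) : U < pi / 2 -> u \in `[- U, U]%R -> 0 < cos u.
Proof.
move=> Upi; rewrite in_itv /= => /andP[u1 u2]; apply: cos_gt0_pihalf.
by apply/andP; split; lra.
Qed.

(** Under t = k tan u the measure k dt / (k^2 + t^2) becomes du. *)
Lemma tan_subst (H : R -> R) (k U : R) : 0 < k -> 0 < U -> U < pi / 2 -> continuous H ->
  (\int[mu]_(t in `[(- (k * tan U))%R, (k * tan U)%R]) (H t * (k / (k ^+ 2 + t ^+ 2)))%R%:E =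
   \int[mu]_(u in `[(- U)%R, U]) (H (k * tan u)%R)%:E)%E.
Proof.
move=> k0 U0 Upi cH.
pose F (u : R) : R := k * tan u.
pose G t : R := H t * (k / (k ^+ 2 + t ^+ 2)).
have Fd (u : R) : 0 < cos u -> is_derive u (1 : R) F (k * (cos u) ^- 2).
  move=> cu; rewrite /F; have h : cos u != 0 by rewrite gt_eqF.
  have := is_derive_tan h => h2; apply: is_derive_eq.
  by rewrite /GRing.scale /=; ring.
have cos0 u := @in_halfcircle U u Upi.
have F1 u : u \in `[- U, U]%R -> F^`() u = k * (cos u) ^- 2.
  by move=> /cos0 cu; rewrite derive1E; have := Fd u cu => h; apply: derive_val.
have cF u : 0 < cos u -> {for u, continuous F}.
  by move=> /Fd h; apply/differentiable_continuous/derivable1_diffP; apply: ex_derive.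
have cF' u : 0 < cos u -> {for u, continuous (fun u : R => k * (cos u) ^- 2)}.
  move=> cu; apply: cvgM; first exact: cvg_cst.
  apply: cvgV; first by rewrite expf_neq0 // gt_eqF.
  rewrite expr2; apply: cvgM; exact: continuous_cos.
have UU : - U < U by lra.
have i1 : - U \in `[- U, U]%R by rewrite in_itv /= lexx ltW.
have i2 : U \in `[- U, U]%R by rewrite in_itv /= lexx ltW.
have FN : - (k * tan U) = F (- U) by rewrite /F tanN mulrN.
transitivity (\int[mu]_(x in `[F (- U)%R, F U]) (G x)%:E)%E; first by rewrite -FN.
have oo (x : R) : x \in `]- U, U[%R -> x \in `[- U, U]%R.
  by rewrite !in_itv /= => /andP[p1 p2]; rewrite !ltW.
have cFo : {in `]- U, U[%R, continuous F^`()}.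
  move=> x xo; apply: (@cvg_trans _ ((fun u : R => k * (cos u) ^- 2) @ x)).
    apply: near_eq_cvg; near=> v; symmetry; apply: F1; apply: oo.
    by near: v; apply: near_in_itvoo.
  by rewrite F1 ?oo //; exact/cF'/cos0/oo.
have ends (a : R) : a \in `[- U, U]%R -> forall Fl : set_system R, Filter Fl ->
   Fl --> a -> (\forall v \near Fl, v \in `[- U, U]%R) -> cvg (F^`() @ Fl).
  move=> ai Fl FF Fa nearI; apply/cvg_ex; exists (k * (cos a) ^- 2).
  apply: (@cvg_trans _ ((fun u : R => k * (cos u) ^- 2) @ Fl)).
    by apply: near_eq_cvg; apply: filterS nearI => v vi; symmetry; exact: F1.
  by apply: cvg_trans (cF' a (cos0 a ai)); apply: cvg_app.
have S := @integration_by_substitution_increasing R F G (- U) U (ltW UU).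
rewrite {}S; first last.
- apply: continuous_subspaceT => t; apply: cvgM; first exact: cH.
  apply: cvgM; first exact: cvg_cst.
  apply: cvgV; first by rewrite gt_eqF // ltr_pwDl ?sqr_ge0 ?exprn_gt0.
  by apply: cvgD; [exact: cvg_cst|rewrite expr2; apply: cvgM; exact: cvg_id].
- split.
  + by move=> x /oo /cos0 cx; have := Fd x cx => h; apply: ex_derive.
  + by apply: cvg_at_right_filter; apply: cF; exact: cos0.
  + by apply: cvg_at_left_filter; apply: cF; exact: cos0.
- apply: (ends _ i2); first by apply: cvg_at_left_filter; exact: cvg_id.
  near=> v; rewrite in_itv /=; apply/andP; split; near: v.
    by apply: nbhs_left_ge.
  by apply: nbhs_left_le.
- apply: (ends _ i1); first by apply: cvg_at_right_filter; exact: cvg_id.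
  near=> v; rewrite in_itv /=; apply/andP; split; near: v.
    by apply: nbhs_right_ge.
  by apply: nbhs_right_le.
- exact: cFo.
- move=> x y xi yi xy; rewrite /F ltr_pM2l // ltr_tan //; rewrite in_itv /=.
    by move: xi; rewrite in_itv /= => /andP[? ?]; apply/andP; split; lra.
  by move: yi; rewrite in_itv /= => /andP[? ?]; apply/andP; split; lra.
apply: eq_integral => x; rewrite inE /= => xi; congr _%:E.
have cx := cos0 x xi; have h : 1 + tan x ^+ 2 != 0 by rewrite gt_eqF // ltr_pwDl ?sqr_ge0.
transitivity (G (F x) * derive1 F x); first by [].
rewrite (F1 x xi) cos2_tan2 ?gt_eqF // /G /F.
have k1 : k != 0 by rewrite gt_eqF.
have -> : k ^+ 2 + (k * tan x) ^+ 2 = k ^+ 2 * (1 + tan x ^+ 2) by ring.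
by field; rewrite ?h ?k1.
Unshelve. all: by end_near.
Qed.

(** Restricting to [-U, U] keeps the substitution on a compact interval; the omitted arcs have total
    length pi - 2 U and there H is at most B. The factor 1 / pi of the average is given away. *)
Lemma avg_tan_le (H : R -> R) (k U B : R) : 0 < k -> 0 < U -> U < pi / 2 ->
  continuous H -> (forall t, 0 <= H t <= B) -> bmf (fun u => H (k * tan u)) ->
  ((avg (fun u => H (k * tan u)))%:E <=
   \int[mu]_(t in `[(- (k * tan U))%R, (k * tan U)%R]) (H t * (k / (k ^+ 2 + t ^+ 2)))%R%:E
   + (B * (pi - 2 * U))%R%:E)%E.
Proof.
move=> k0 U0 Upi cH HB hb; rewrite tan_subst //.
set f := fun u => H (k * tan u).
have f0 u : 0 <= f u by have /andP[] := HB (k * tan u).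
have fB u : f u <= B by have /andP[] := HB (k * tan u).
have iD := bmf_integrable hb.
have I0 : (0 <= \int[mu]_(u in @halfcircle R) (f u)%:E)%E.
  by apply: integral_ge0 => u _; rewrite lee_fin.
have pi1 : 1 <= pi :> R by apply: le_trans (pi_ge2 R); lra.
apply: (@le_trans _ _ (\int[mu]_(u in @halfcircle R) (f u)%:E)%E).
  rewrite /avg -[leRHS]fineK; last first.
    by apply: (integrable_fin_num _ iD); exact: measurable_itv.
  rewrite lee_fin ler_pdivrMr ?pi_gt0 // ler_peMr //.
  by apply: Rintegral_ge0 => u _; exact: f0.
have UD : `[- U, U]%classic `<=` @halfcircle R.
  move=> u /=; rewrite /halfcircle /= !in_itv /= => /andP[? ?].
  by apply/andP; split; lra.
have mD : measurable (@halfcircle R : set (measurableTypeR R)) by exact: measurable_itv.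
have mU : measurable (`[- U, U]%classic : set (measurableTypeR R)) by exact: measurable_itv.
have mDU : measurable (@halfcircle R `\` `[- U, U]%classic : set (measurableTypeR R)) by exact: measurableD.
have DE : @halfcircle R = `[- U, U]%classic `|` (@halfcircle R `\` `[- U, U]%classic).
  by rewrite setDE setUIr setUv setIT; apply/esym/setUidPr.
rewrite [in leLHS]DE ge0_integral_setU //; first last.
- apply/disj_setPS => u [/= u1 [_ u2]]; exact: u2.
- by move=> u _; rewrite lee_fin.
- by rewrite -DE; apply/measurable_EFinP; exact: hb.1.
rewrite leeD2l //.
apply: (@le_trans _ _ (\int[mu]_(u in @halfcircle R `\` `[(- U)%R, U]%classic) (cst B%:E) u)%E).
  apply: ge0_le_integral => //.
  - by move=> u _; rewrite lee_fin.
  - by apply/measurable_EFinP; apply: measurable_funS hb.1 => //; exact: subDsetl.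
  - by move=> u _; rewrite lee_fin.
rewrite integral_cst // [X in (_ * X)%E](_ : _ = (pi - 2 * U)%:E).
  by rewrite -EFinM lee_fin.
rewrite measureD //; last by rewrite [ltLHS]mu_halfcircle ltry.
rewrite [X in (X - _)%E]mu_halfcircle (setIidr UD).
rewrite [X in (_ - X)%E]lebesgue_measure_itv /= lte_fin (_ : - U < U); last by lra.
by rewrite -!EFinB; congr _%:E; lra.
Qed.
End TanSubst.

(** * Integrals over rectangles *)

Lemma ge0_integral_setU_le d (T : measurableType d) (R : realType)
    (mu : {measure set T -> \bar R}) (A B : set T) (f : T -> \bar R) :
  measurable A -> measurable B -> measurable_fun (A `|` B) f ->
  (forall x, (A `|` B) x -> (0 <= f x)%E) ->
  (\int[mu]_(x in A `|` B) f x <= \int[mu]_(x in A) f x + \int[mu]_(x in B) f x)%E.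
Proof.
move=> mA mB mf f0.
have mD : measurable (B `\` A) by exact: measurableD.
have AB : A `|` B = A `|` (B `\` A) by rewrite setDE setUIr setUv setIT.
rewrite AB ge0_integral_setU //; first last.
- by rewrite disj_set2E setDIK.
- by rewrite -AB.
- by rewrite -AB.
apply: leeD => //; apply: ge0_subset_integral => //.
- by apply: measurable_funS mf; [exact: measurableU|exact: subsetUr].
- by move=> x Bx; apply: f0; right.
Qed.

Section rectangles.
Variable R : realType.
Local Notation mu := (@lebesgue_measure R).
Implicit Types I J : set (measurableTypeR R).

Section tonelli.
Variables (I J : set (measurableTypeR R)) (f : R * R -> R).
Hypotheses (mI : measurable I) (mJ : measurable J).
Hypotheses (mf : measurable_fun (I `*` J) f) (f0 : forall p, (I `*` J) p -> 0 <= f p).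

Let F := (EFin \o f) \_ (I `*` J).

Let mF : measurable_fun setT F.
Proof.
apply/(measurable_restrict _ _ measurableT) => //; first exact: measurableX.
by rewrite setTI; apply/measurable_EFinP.
Qed.

Let F0 p : (0 <= F p)%E.
Proof. by rewrite /F patchE; case: ifPn => // /[!inE] /f0; rewrite lee_fin. Qed.

Let innerE : fubini_F mu F = (fun x => \int[mu]_(y in J) (f (x, y))%:E)%E \_ I.
Proof.
apply/funext => x; rewrite /fubini_F patchE.
case: ifPn => [|/negP] /[!inE] Ix.
  rewrite [RHS]integral_mkcond; apply: eq_integral => y _.
  rewrite /F !patchE /=; congr (if _ then _ else _).
  by apply/idP/idP; rewrite !inE /= => // -[].
apply: integral0_eq => y _; rewrite /F patchE; case: ifPn => // /[!inE] -[] //.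
Qed.

Lemma integral_rect :
  (\int[@area R]_(p in I `*` J) (f p)%:E =
   \int[mu]_(x in I) \int[mu]_(y in J) (f (x, y))%:E)%E.
Proof.
rewrite /area integral_mkcond (@fubini_tonelli1 _ _ _ _ _ mu mu F mF F0) innerE.
by rewrite -integral_mkcond.
Qed.

Lemma measurable_inner : measurable_fun I (fun x => \int[mu]_(y in J) (f (x, y))%:E)%E.
Proof.
have := @measurable_fun_fubini_tonelli_F _ _ _ _ _ mu F mF F0.
by rewrite innerE => /(measurable_restrict _ mI measurableT); rewrite setTI.
Qed.
End tonelli.

Lemma measurable_cabs2_dpartial (a : nat -> R[i]) M :
  measurable_fun setT (fun p : R * R => cabs2 (dpartial a (p.1 +i* p.2) M)).
Proof.
have m1 : measurable_fun setT (fun p : R * R => p.1) by exact: measurable_fst.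
have m2 : measurable_fun setT (fun p : R * R => p.2) by exact: measurable_snd.
have mpow n : measurable_fun setT (fun p : R * R => (n%:R : R) `^ (- p.1)).
  apply: (measurableT_comp (measurable_powRr n%:R)).
  exact: measurable_funN.
have mth n : measurable_fun setT (fun p : R * R => p.2 * ln (n%:R : R)).
  by apply: measurable_funM.
have mcos n : measurable_fun setT (fun p : R * R => cos (p.2 * ln (n%:R : R))).
  by apply: (measurableT_comp _ (mth n)); apply: continuous_measurable_fun; exact: continuous_cos.
have msin n : measurable_fun setT (fun p : R * R => sin (p.2 * ln (n%:R : R))).
  by apply: (measurableT_comp _ (mth n)); apply: continuous_measurable_fun; exact: continuous_sin.
have mt n : measurable_fun setT (fun p : R * R => ReC (a n * npow n (p.1 +i* p.2))) /\
   measurable_fun setT (fun p : R * R => ImC (a n * npow n (p.1 +i* p.2))).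
  case: (a n) => x y; split.
    rewrite (_ : (fun p => _) = (fun p : R * R => x * ((n%:R : R) `^ (- p.1) * cos (p.2 * ln (n%:R : R)))
      + y * ((n%:R : R) `^ (- p.1) * sin (p.2 * ln (n%:R : R))))).
      by apply: measurable_funD; apply: measurable_funM => //; apply: measurable_funM.
    by apply/funext => p /=; ring.
  rewrite (_ : (fun p => _) = (fun p : R * R => (- x) * ((n%:R : R) `^ (- p.1) * sin (p.2 * ln (n%:R : R)))
    + y * ((n%:R : R) `^ (- p.1) * cos (p.2 * ln (n%:R : R))))).
    by apply: measurable_funD; apply: measurable_funM => //; apply: measurable_funM.
  by apply/funext => p /=; ring.
have ms (f : nat -> R * R -> R) : (forall n, measurable_fun setT (f n)) ->
    measurable_fun setT (fun p => \sum_(1 <= n < M.+1) f n p).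
  move=> mf; elim: M => [|N IH].
    rewrite (_ : (fun p => _) = cst 0) //.
    by apply/funext => p; rewrite big_geq.
  rewrite (_ : (fun p => _) = (fun p => \sum_(1 <= n < N.+1) f n p + f N.+1 p)).
    exact: measurable_funD.
  by apply/funext => p; rewrite big_nat_recr.
rewrite /cabs2; apply: measurable_funD; apply: measurable_funX.
  rewrite (_ : (fun p => _) = (fun p : R * R => \sum_(1 <= n < M.+1) ReC (a n * npow n (p.1 +i* p.2)))).
    by apply: ms => n; exact: (mt n).1.
  by apply/funext => p; rewrite ReC_sum.
rewrite (_ : (fun p => _) = (fun p : R * R => \sum_(1 <= n < M.+1) ImC (a n * npow n (p.1 +i* p.2)))).
  by apply: ms => n; exact: (mt n).2.
by apply/funext => p; rewrite ImC_sum.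
Qed.

End rectangles.

(** The coefficients of s -> P(s + i g). Their moduli are those of a, so vertical translations
    preserve every norm in use. *)
Definition vtwist {R : realType} (a : nat -> R[i]) (g : R) (n : nat) : R[i] :=
  a n * npow n (0 +i* g).

Definition wsum {R : realType} (alpha : R) (a : nat -> R[i]) (M : nat) : R :=
  \sum_(1 <= n < M.+1) cabs2 (a n) / ndiv R n `^ alpha.

(** * Vertical translations, truncated norms and continuity of Dirichlet polynomials *)

Section twists.
Variable R : realType.
Local Notation mu := (@lebesgue_measure R).
Implicit Types (a : nat -> R[i]) (alpha beta : R).

Lemma cabs2_vtwist a g n : (0 < n)%N -> cabs2 (vtwist a g n) = cabs2 (a n).
Proof.
move=> n0; rewrite /vtwist cabs2M -[cabs2 (npow _ _)]sqr_modc modc_npow //=.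
by rewrite oppr0 powRr0 expr1n mulr1.
Qed.

Lemma dpartial_vtwist a g x t M :
  dpartial (vtwist a g) (x +i* t) M = dpartial a (x +i* (g + t)) M.
Proof.
apply: eq_big_nat => n /andP[n0 _]; rewrite /vtwist -mulrA -npowD //.
by congr (_ * npow _ _); apply/eqP; rewrite eq_complex /= add0r !eqxx.
Qed.

Lemma wsum_vtwist alpha a g M : wsum alpha (vtwist a g) M = wsum alpha a M.
Proof. by apply: eq_big_nat => n /andP[n0 _]; rewrite cabs2_vtwist. Qed.

Lemma wsum_term_ge0 alpha a n : 0 <= cabs2 (a n) / ndiv R n `^ alpha.
Proof. by rewrite divr_ge0 ?cabs2_ge0 ?powR_ge0. Qed.

Lemma wsum_ge0 alpha a M : 0 <= wsum alpha a M.
Proof. by apply: sumr_ge0 => n _; exact: wsum_term_ge0. Qed.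

Lemma wsum_le_Dnorm2 alpha a M : ((wsum alpha a M)%:E <= Dnorm2 alpha a)%E.
Proof.
rewrite /wsum -sumEFin; apply: nneseries_lim_ge => n _ _.
by rewrite lee_fin wsum_term_ge0.
Qed.

Lemma Dnorm2_le alpha a (X : \bar R) :
  (forall M, ((wsum alpha a M)%:E <= X)%E) -> (Dnorm2 alpha a <= X)%E.
Proof.
move=> h; rewrite /Dnorm2; apply: lime_le.
  by apply: is_cvg_nneseries => n _ _; rewrite lee_fin wsum_term_ge0.
have e M : (0 < M)%N -> (\sum_(1 <= n < M) (cabs2 (a n) / ndiv R n `^ alpha)%:E <= X)%E.
  by case: M => // M _; rewrite sumEFin; exact: h.
by exists 1%N => // M /= /e.
Qed.

Lemma wsum_trunc alpha a M N : wsum alpha (trunc M a) N <= wsum alpha a M.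
Proof.
have e : wsum alpha (trunc M a) (maxn M N) = wsum alpha a M.
  rewrite /wsum (@big_cat_nat _ _ _ M.+1) //=; last by rewrite ltnS leq_maxl.
  rewrite [X in _ + X]big1_seq ?addr0.
    by apply: eq_big_nat => n /andP[_ nM]; rewrite /trunc -ltnS nM.
  move=> n /andP[_]; rewrite mem_index_iota => /andP[Mn _].
  by rewrite /trunc leqNgt Mn /cabs2 /= expr0n /= addr0 mul0r.
rewrite -e [leRHS]/wsum (@big_cat_nat _ _ _ N.+1) //=; last by rewrite ltnS leq_maxr.
by rewrite lerDl sumr_ge0 // => n _; exact: wsum_term_ge0.
Qed.

Lemma Dnorm2_trunc alpha a M : Dnorm2 alpha (trunc M a) = (wsum alpha a M)%:E.
Proof.
apply/eqP; rewrite eq_le; apply/andP; split.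
  by apply: Dnorm2_le => N; rewrite lee_fin wsum_trunc.
apply: le_trans (wsum_le_Dnorm2 _ _ M); rewrite lee_fin le_eqVlt; apply/orP; left.
by apply/eqP/eq_big_nat => n /andP[_ nM]; rewrite /trunc -ltnS nM.
Qed.

Lemma continuous_cabs2_dpartial_path a M (f g : R -> R) t0 :
  {for t0, continuous f} -> {for t0, continuous g} ->
  {for t0, continuous (fun t : R => cabs2 (dpartial a (f t +i* g t) M))}.
Proof.
move=> cf cg.
have c n : (0 < n)%N -> {for t0, continuous (fun t : R => ReC (a n * npow n (f t +i* g t)))} /\
           {for t0, continuous (fun t : R => ImC (a n * npow n (f t +i* g t)))}.
  move=> n0; have cl : {for t0, continuous (fun t => g t * ln (n%:R : R))}.
    by apply: cvgM; [exact: cg|exact: cvg_cst].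
  have pw : {for t0, continuous (fun t => (n%:R : R) `^ (- f t))}.
    rewrite (_ : (fun t => _) = (fun t => expR (- f t * ln (n%:R : R)))); last first.
      by apply/funext => t; rewrite /powR pnatr_eq0 -[_ == 0%N]negbK -lt0n n0.
    apply: (@continuous_comp _ _ _ (fun t => - f t * ln (n%:R : R)) expR); last exact: continuous_expR.
    by apply: cvgM; [apply: cvgN; exact: cf|exact: cvg_cst].
  have cs : {for t0, continuous (fun t : R => (n%:R : R) `^ (- f t) * cos (g t * ln (n%:R : R)))}.
    apply: cvgM; first exact: pw.
    by apply: (@continuous_comp _ _ _ (fun t => g t * ln (n%:R : R)) cos); [exact: cl|exact: continuous_cos].
  have sn : {for t0, continuous (fun t : R => - ((n%:R : R) `^ (- f t) * sin (g t * ln (n%:R : R))))}.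
    apply: cvgN; apply: cvgM; first exact: pw.
    by apply: (@continuous_comp _ _ _ (fun t => g t * ln (n%:R : R)) sin); [exact: cl|exact: continuous_sin].
  case: (a n) => u v; split.
    by apply: cvgB; apply: cvgM; (try exact: cvg_cst); [exact: cs|exact: sn].
  by apply: cvgD; apply: cvgM; (try exact: cvg_cst); [exact: sn|exact: cs].
have s (h : nat -> R -> R) K : (forall n, (0 < n)%N -> {for t0, continuous (h n)}) ->
    {for t0, continuous (fun t => \sum_(1 <= n < K.+1) h n t)}.
  move=> ch; elim: K => [|N IH].
    rewrite (_ : (fun t => _) = cst 0); first exact: cvg_cst.
    by apply/funext => p; rewrite big_geq.
  rewrite (_ : (fun t => _) = (fun p => \sum_(1 <= n < N.+1) h n p + h N.+1 p)).
    by apply: cvgD; [exact: IH|exact: ch].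
  by apply/funext => p; rewrite big_nat_recr.
have e : (fun t : R => cabs2 (dpartial a (f t +i* g t) M)) =
  (fun t => (\sum_(1 <= n < M.+1) ReC (a n * npow n (f t +i* g t))) ^+ 2 +
            (\sum_(1 <= n < M.+1) ImC (a n * npow n (f t +i* g t))) ^+ 2).
  by apply/funext => t; rewrite /cabs2 /dpartial ReC_sum ImC_sum.
have sqr (h : R -> R) : {for t0, continuous h} -> {for t0, continuous (fun t => h t ^+ 2)}.
  by move=> ch; rewrite /GRing.exp /=; apply: cvgM; exact: ch.
rewrite e; apply: cvgD; apply: sqr; apply: s => n n0; first exact: (c n n0).1.
exact: (c n n0).2.
Qed.

Lemma continuous_cabs2_dpartial a M x :
  continuous (fun t : R => cabs2 (dpartial a (x +i* t) M)).
Proof. by move=> t; apply: continuous_cabs2_dpartial_path; [exact: cvg_cst|exact: cvg_id]. Qed.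

(** The interval [-J, J] is covered by the unit intervals [j, j + 1] and [-j - 1, -j]; the second is
    written with tau = -j - 1 to match the side [tau, tau + 1] of a Carleson square. *)
Lemma integral_slabs_le (f : R -> R) (J : nat) : measurable_fun setT f -> (forall t, 0 <= f t) ->
  (\int[mu]_(t in `[(- J%:R)%R, (J%:R)%R]) (f t)%:E <=
   \sum_(j < J) (\int[mu]_(t in `[(j%:R)%R, (j%:R + 1)%R]) (f t)%:E +
                 \int[mu]_(t in `[(- j%:R - 1)%R, (- j%:R - 1 + 1)%R]) (f t)%:E))%E.
Proof.
move=> mf f0; elim: J => [|J IH].
  rewrite big_ord0 oppr0 (@integral_Sset1 _ _ _ 0) // => t /=.
  by rewrite in_itv /= -eq_le => /eqP.
rewrite big_ord_recr /=.
have mE (A : set (measurableTypeR R)) : measurable_fun A (fun t => (f t)%:E).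
  by apply/measurable_EFinP; apply: measurable_funTS.
have f0' t : (0 <= (f t)%:E)%E by rewrite lee_fin.
have J0 : 0 <= (J%:R : R) by [].
apply: (@le_trans _ _ (\int[mu]_(t in `[(- J%:R)%R, (J%:R)%R] `|`
    (`[(J%:R)%R, (J%:R + 1)%R] `|` `[(- J%:R - 1)%R, (- J%:R - 1 + 1)%R])) (f t)%:E)%E).
  apply: ge0_subset_integral => //; try exact: measurable_itv.
    by apply: measurableU; [exact: measurable_itv|apply: measurableU; exact: measurable_itv].
  move=> t; move: (t : R) => {}t /=; rewrite !in_itv /= -natr1 => /andP[t1 t2].
  clear IH f0' f0 mE mf; have [h1|h1] := leP t J%:R; last by right; left; apply/andP; split; lra.
  have [h2|h2] := leP (- J%:R) t; first by left; apply/andP; split; lra.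
  by right; right; apply/andP; split; lra.
have U (A B : set (measurableTypeR R)) (mA : measurable A) (mB : measurable B) :=
  @ge0_integral_setU_le _ _ _ mu A B _ mA mB (mE _) (fun t _ => f0' t).
apply: (le_trans (U _ _ (measurable_itv _) (measurableU _ _ (measurable_itv _) (measurable_itv _)))).
by apply: leeD => //; exact: (U _ _ (measurable_itv _) (measurable_itv _)).
Qed.

End twists.

(** * Bounding the Poisson form by integrals over unit segments *)

Section poisson_slabs.
Variable R : realType.
Local Notation mu := (@lebesgue_measure R).

Definition slab (a : nat -> R[i]) M (x v tau : R) : \bar R :=
  (\int[mu]_(t in `[tau, (tau + 1)%R]) (cabs2 (dpartial a (x +i* t) M) * v)%R%:E)%E.

Lemma slab_ge0 a M x v tau : 0 <= v -> (0 <= slab a M x v tau)%E.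
Proof. by move=> v0; apply: integral_ge0 => t _; rewrite lee_fin mulr_ge0 ?cabs2_ge0. Qed.

Lemma poisson_kernel_le (k0 k k1 c t : R) : 0 < k0 -> k0 <= k <= k1 -> 0 <= c -> c <= `|t| ->
  0 <= k / (k ^+ 2 + t ^+ 2) <= k1 / (k0 ^+ 2 + c ^+ 2).
Proof.
move=> h0 /andP[kk kk1] c0 ct; have kp : 0 < k by exact: lt_le_trans kk.
have t2 : c ^+ 2 <= t ^+ 2 by rewrite -[t ^+ 2]real_normK ?num_real // ler_sqr ?nnegrE.
have k2 : k0 ^+ 2 <= k ^+ 2 by rewrite ler_sqr ?nnegrE ?(ltW h0) ?(ltW kp).
have p0 : 0 < k0 ^+ 2 + c ^+ 2 by rewrite ltr_pwDl ?exprn_gt0 // sqr_ge0.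
have p : 0 < k ^+ 2 + t ^+ 2 by apply: (lt_le_trans p0); exact: lerD.
rewrite divr_ge0 ?(ltW kp) ?(ltW p) //=.
apply: ler_pM; rewrite ?(ltW kp) ?invr_ge0 ?(ltW p) //.
by rewrite lef_pV2 ?posrE // lerD.
Qed.

(** On the segments numbered j the Poisson kernel is at most k1 / (k0^2 + j^2), a bound that is the
    same for all w with k0 <= Re w <= k1. The twist by Im w centres the kernel at height 0, and B
    bounds |P|^2 on the arcs cut off by U. *)
Lemma poisson_form_slabs (a : nat -> R[i]) (w : R[i]) M (y v k0 k1 U B : R) J :
  0 < k0 -> k0 <= ReC w <= k1 -> 0 <= v -> 0 <= y -> 0 < U -> U < pi / 2 ->
  k1 * tan U <= J%:R -> (\sum_(1 <= n < M.+1) modc (a n)) ^+ 2 <= B ->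
  ((v * poisson_form (alpha_coef a y) w 1 M)%:E <=
   \sum_(j < J) (k1 / (k0 ^+ 2 + j%:R ^+ 2))%:E *
      (slab (vtwist a (ImC w)) M (2^-1 + y) v j%:R +
       slab (vtwist a (ImC w)) M (2^-1 + y) v (- j%:R - 1)) + (v * B * (pi - 2 * U))%:E)%E.
Proof.
move=> h0 kk v0 y0 U0 Upi kJ hB; set k := ReC w; set g := ImC w; set x := 2^-1 + y.
have kp : 0 < k by apply: lt_le_trans h0 _; case/andP: kk.
have [k0k kk1] := andP kk.
pose H t := cabs2 (dpartial (vtwist a g) (x +i* t) M) * v.
have H0 t : 0 <= H t by rewrite mulr_ge0 ?cabs2_ge0.
have HB t : 0 <= H t <= v * B.
  rewrite H0 /= /H mulrC ler_wpM2l //; apply: le_trans hB; rewrite dpartial_vtwist.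
  rewrite -sqr_modc ler_sqr ?nnegrE ?modc_ge0 ?sumr_ge0 // => [|n _]; last exact: modc_ge0.
  by apply: modc_dpartial_le; rewrite /= /x; lra.
have cH : continuous H.
  by move=> t; apply: cvgM; [exact: continuous_cabs2_dpartial|exact: cvg_cst].
have [b1 b2] := @poisson_avg R (alpha_coef a y) w 1 M isT (ltW kp).
have e u : v * cabs2 (expsum (alpha_coef a y) (tline w u) 1 M) = H (k * tan u).
  rewrite /H mulrC; congr (cabs2 _ * _); rewrite dpartial_vtwist.
  rewrite [RHS](@dpartial_expsum R a y); congr expsum.
  by apply/eqP; rewrite eq_complex /= /x /g /k subrr oppr0 addr0 !eqxx.
have bH : bmf (fun u => H (k * tan u)).
  by apply: bmf_ext (bmfZ v b1) => u _; exact: e.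
have := avg_tan_le kp U0 Upi cH HB bH.
rewrite (_ : avg _ = v * poisson_form (alpha_coef a y) w 1 M); last first.
  by rewrite -b2 -avgZ //; apply: avg_ext => u _; rewrite e.
move=> h; apply: (le_trans h); apply: leeD => //.
pose f t := H t * (k / (k ^+ 2 + t ^+ 2)).
have f0 t : 0 <= f t.
  by rewrite mulr_ge0 // divr_ge0 ?(ltW kp) // addr_ge0 ?sqr_ge0.
have mH : measurable_fun setT H by exact: continuous_measurable_fun.
have mf : measurable_fun setT f.
  apply: continuous_measurable_fun => t; apply: cvgM; first exact: cH.
  apply: cvgM; first exact: cvg_cst.
  apply: cvgV; first by rewrite gt_eqF // ltr_pwDl ?sqr_ge0 ?exprn_gt0.
  by apply: cvgD; [exact: cvg_cst|rewrite expr2; apply: cvgM; exact: cvg_id].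
have mE (h' : R -> R) (A : set (measurableTypeR R)) : measurable_fun setT h' ->
    measurable_fun A (fun t => (h' t)%:E).
  by move=> mh; apply/measurable_EFinP; apply: measurable_funTS.
apply: (@le_trans _ _ (\int[mu]_(t in `[(- J%:R)%R, (J%:R)%R]) (f t)%:E)%E).
  have kT : k * tan U <= J%:R.
    apply: le_trans kJ; rewrite ler_wpM2r //.
    by rewrite -tan0 ltW // ltr_tan ?in_itv /=; have := pi_gt0 R; lra.
  apply: ge0_subset_integral => //; try exact: measurable_itv.
  - by apply: mE; exact: mf.
  - by move=> t _; rewrite lee_fin; exact: f0.
  - move=> t; move: (t : R) => {}t /=; rewrite !in_itv /= => /andP[t1 t2].
    by apply/andP; split; [apply: le_trans t1; rewrite lerN2|apply: le_trans kT].
apply: (le_trans (integral_slabs_le J mf f0)); apply: lee_sum => j _.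
rewrite muleDr; first last.
- by rewrite ge0_adde_def // inE; apply: slab_ge0.
- by [].
have C0 : 0 <= k1 / (k0 ^+ 2 + j%:R ^+ 2).
  by have /andP[p1 p2] := poisson_kernel_le h0 kk (ler0n R j) (ler_norm j%:R); exact: le_trans p2.
have S (tau : R) : (forall t, tau <= t <= tau + 1 -> j%:R <= `|t|) ->
    (\int[mu]_(t in `[tau, (tau + 1)%R]) (f t)%:E <=
     (k1 / (k0 ^+ 2 + j%:R ^+ 2))%:E * slab (vtwist a g) M x v tau)%E.
  move=> hj; rewrite /slab -ge0_integralZl_EFin //; first last.
  - by apply: mE; exact: mH.
  - by move=> t _; rewrite lee_fin; exact: H0.
  apply: ge0_le_integral => //; try exact: measurable_itv.
  - by move=> t _; rewrite lee_fin.
  - exact: mE.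
  - by apply: (mE (fun t => _ * H t)); apply: measurable_funM.
  - move=> t; move: (t : R) => {}t /=; rewrite in_itv /= => /hj tj.
    rewrite -EFinM lee_fin /f mulrC ler_wpM2r //.
    by have /andP[] := poisson_kernel_le h0 kk (ler0n R j) tj.
apply: leeD; apply: S => t /andP[t1 t2].
  by rewrite ger0_norm //; apply: le_trans t1.
by rewrite ler0_norm; have := ler0n R j; lra.
Qed.

End poisson_slabs.

(** * Carleson integrals as weighted integrals over segments *)

Section carleson_slabs.
Variable R : realType.
Local Notation mu := (@lebesgue_measure R).
Implicit Types (a : nat -> R[i]) (alpha beta : R).

(** Estimating x^beta and 1 / x separately avoids a case distinction on the sign of beta - 1. *)
Lemma powR_pred (x beta : R) : 0 < x -> x `^ (beta - 1) = x `^ beta / x.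
Proof.
move=> x0; rewrite powRD; last by apply/implyP => _; rewrite gt_eqF.
by rewrite powR_inv1 // ltW.
Qed.

Lemma SrectE (tau : R) : Srect tau = `[2^-1, 1] `*` `[tau, (tau + 1)%R].
Proof.
apply/seteqP; split => -[x t] /=; rewrite /Srect /= !in_itv /=.
  by move=> [-> ->].
by move=> [-> ->].
Qed.

Lemma measurable_weighted a M beta : measurable_fun setT
  (fun p : R * R => cabs2 (dpartial a (p.1 +i* p.2) M) * (p.1 - 2^-1) `^ (beta - 1)).
Proof.
apply: measurable_funM; first exact: measurable_cabs2_dpartial.
apply: (measurableT_comp (measurable_powR _)).
by apply: measurable_funB => //; exact: measurable_fst.
Qed.

Lemma weighted_ge0 a M beta (p : R * R) :
  0 <= cabs2 (dpartial a (p.1 +i* p.2) M) * (p.1 - 2^-1) `^ (beta - 1).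
Proof. by rewrite mulr_ge0 ?cabs2_ge0 ?powR_ge0. Qed.

Lemma carleson_slab a M beta tau : carleson_int beta M a tau =
  (\int[mu]_(x in `[2^-1%R, 1%R]) slab a M x ((x - 2^-1) `^ (beta - 1))%R tau)%E.
Proof.
rewrite /carleson_int SrectE integral_rect //; try exact: measurable_itv.
- by apply: measurable_funTS; exact: measurable_weighted.
- by move=> p _; exact: weighted_ge0.
Qed.

Lemma measurable_slab a M beta tau (I : set (measurableTypeR R)) : measurable I ->
  measurable_fun I (fun x => slab a M x ((x - 2^-1) `^ (beta - 1)) tau).
Proof.
move=> mI; apply: (@measurable_inner R I `[tau, (tau + 1)%R]
  (fun p => cabs2 (dpartial a (p.1 +i* p.2) M) * (p.1 - 2^-1) `^ (beta - 1))) => //.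
- by apply: measurable_funTS; exact: measurable_weighted.
- by move=> p _; exact: weighted_ge0.
Qed.

Lemma sum_poisson_kernel_bounded (k0 k1 : R) : 0 < k0 -> 0 <= k1 ->
  exists2 Z : R, 0 < Z & forall J, \sum_(j < J) k1 / (k0 ^+ 2 + j%:R ^+ 2) <= Z.
Proof.
move=> h0 h1; have [Z Z0 hZ] := @zeta_bounded R 2 (ltr_nat R 1 2).
have k2 : 0 < k0 ^+ 2 by rewrite exprn_gt0.
exists (k1 / k0 ^+ 2 + k1 * Z + 1).
  by rewrite ltr_wpDl // addr_ge0 ?mulr_ge0 ?invr_ge0 ?(ltW k2) ?(ltW Z0).
have t j : 0 <= k1 / (k0 ^+ 2 + j%:R ^+ 2).
  by rewrite divr_ge0 // addr_ge0 ?sqr_ge0.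
move=> [|J]; first by rewrite big_ord0 addr_ge0 // addr_ge0 ?mulr_ge0 ?invr_ge0 ?(ltW k2) ?(ltW Z0).
rewrite big_ord_recl /= -addrA; apply: lerD; first by rewrite expr0n addr0.
rewrite ler_wpDr //; apply: (@le_trans _ _ (k1 * \sum_(1 <= n < J.+1) (n%:R : R) `^ (- 2))).
  rewrite big_add1 /= big_mkord mulr_sumr; apply: ler_sum => j _.
  rewrite ler_wpM2l // powRN powR_mulrn // lef_pV2 ?posrE ?exprn_gt0 //.
    by rewrite /bump /= add1n lerDr ltW.
  by rewrite ltr_pwDl // sqr_ge0.
by rewrite ler_wpM2l ?hZ.
Qed.

End carleson_slabs.

Lemma size_divisors_le n : (0 < n)%N -> (size (divisors n) <= n)%N.
Proof.
move=> n0; rewrite -[leqRHS](size_iota 1 n).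
apply: uniq_leq_size (divisors_uniq _) _ => d; rewrite -dvdn_divisors // mem_iota => dn.
by rewrite add1n ltnS (dvdn_leq _ dn) // (dvdn_gt0 n0 dn).
Qed.

Lemma bernoulli_ge (R : realType) (x : R) n : 0 <= x <= 1 -> 1 - n%:R * x <= (1 - x) ^+ n.
Proof.
move=> /andP[x0 x1]; elim: n => [|n IH]; first by rewrite mul0r subr0 expr0.
rewrite exprS; apply: (@le_trans _ _ ((1 - x) * (1 - n%:R * x))).
  have := ler0n R n; rewrite -natr1; nra.
by rewrite ler_wpM2l // subr_ge0.
Qed.

Lemma powR_pred_le (R : realType) (eta x beta : R) : 0 < beta -> 0 < eta -> eta <= x <= 1 ->
  x `^ (beta - 1) <= eta^-1.
Proof.
move=> b0 e0 /andP[ex x1]; have x0 : 0 < x by exact: lt_le_trans ex.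
rewrite powR_pred // -[leRHS]mul1r; apply: ler_pM; rewrite ?powR_ge0 ?invr_ge0 ?(ltW x0) //.
  have -> : (1 : R) = 1 `^ beta by rewrite powR1.
  apply: ge0_ler_powR; rewrite ?nnegrE ?(ltW b0) ?(ltW x0) //.
by rewrite lef_pV2.
Qed.

Lemma powR_pred_ge (R : realType) (h x beta : R) : 0 < beta -> 0 < h -> h <= x <= 2 * h ->
  h `^ beta / (2 * h) <= x `^ (beta - 1).
Proof.
move=> b0 h0 /andP[hx xh]; have x0 : 0 < x by exact: lt_le_trans hx.
rewrite powR_pred //; apply: ler_pM; rewrite ?powR_ge0 ?invr_ge0 ?mulr_ge0 ?(ltW h0) //.
  by apply: ge0_ler_powR; rewrite ?nnegrE ?(ltW b0) ?(ltW x0) ?(ltW h0).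
by rewrite lef_pV2 ?posrE // mulr_gt0.
Qed.

(** Since (kappa - y) / (kappa + y) >= 1 - 2 y / kappa, Bernoulli's inequality with exponent 2 m
    loses at most 4 m y / kappa, which is at most 1/2. *)
Lemma harnack_factor_ge (R : realType) (kappa y D : R) m :
  0 < y -> y < kappa -> m%:R <= D -> 16 * (D * y) <= 2 * kappa ->
  2^-1 <= (((kappa - y) / (kappa + y)) ^+ m) ^+ 2.
Proof.
move=> y0 yk mD Dy; have k0 : 0 < kappa by exact: lt_trans yk.
set r := _ / _; have r2 : 1 - 2 * y / kappa <= r.
  rewrite /r ler_pdivlMr ?addr_gt0 //.
  have -> : (1 - 2 * y / kappa) * (kappa + y) = kappa - y - 2 * y ^+ 2 / kappa.
    by field; rewrite gt_eqF.
  by rewrite gerBl divr_ge0 ?(ltW k0) // mulr_ge0 // exprn_ge0 // ltW.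
have yk2 : 2 * y / kappa <= 1 \/ 1 < 2 * y / kappa by case: (leP (2 * y / kappa) 1); [left|right].
have u0 : 0 <= 2 * y / kappa by rewrite divr_ge0 ?(ltW k0) // mulr_ge0 ?(ltW y0).
have u : m%:R * (2 * y / kappa) <= 4^-1.
  rewrite mulrA ler_pdivrMr //.
  have : m%:R * y <= D * y by rewrite ler_wpM2r // ltW.
  lra.
rewrite -exprM; case: m mD u => [|m] mD u; first by rewrite mul0n expr0; lra.
case: yk2 => [u1|u1]; last first.
  by move: u; rewrite -natr1; have := ler0n R m; nra.
apply: (@le_trans _ _ ((1 - 2 * y / kappa) ^+ (m.+1 * 2))); last first.
  by apply: lerXn2r => //; rewrite nnegrE; [lra|apply: le_trans r2; lra].
apply: le_trans (bernoulli_ge _ _); last by rewrite u0 u1.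
by move: u; rewrite natrM; lra.
Qed.

Lemma carleson_slab_le (R : realType) (a : nat -> R[i]) M (beta tau X : R)
    (I : set (measurableTypeR R)) : measurable I -> I `<=` `[2^-1, 1] ->
  (carleson_int beta M a tau <= X%:E)%E ->
  (\int[@lebesgue_measure R]_(x in I) slab a M x ((x - 2^-1) `^ (beta - 1))%R tau <= X%:E)%E.
Proof.
move=> mI sI; rewrite carleson_slab; apply: le_trans.
apply: ge0_subset_integral => //; try exact: measurable_itv.
  by apply: measurable_slab; exact: measurable_itv.
by move=> x _; apply: slab_ge0; exact: powR_ge0.
Qed.

Lemma tan_ge0 (R : realType) (U : R) : 0 < U -> U < pi / 2 -> 0 <= tan U.
Proof.
by move=> U0 Upi; rewrite -tan0 ltW // ltr_tan ?in_itv /=; have := pi_gt0 R; lra.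
Qed.

(** * Integrating the coefficient estimate over the distance to the critical line *)

Section integrated.
Variable R : realType.
Local Notation mu := (@lebesgue_measure R).
Variables (beta kappa : R) (a b : nat -> R[i]) (c1 : R[i]) (M : nat) (X Z : R).
Hypotheses (b0 : 0 < beta) (kE : kappa = ReC c1 - 2^-1) (k0 : 0 < kappa).
Hypothesis form_le : forall (y : R) N, 0 < y < kappa ->
  \sum_(1 <= n < N.+1) (((kappa - y) / (kappa + y)) ^+ bigOmega n) ^+ 2 * cabs2 (b n) <=
  poisson_form (alpha_coef a y) (c1 - (2^-1 + y)%:C) 1 M.
Hypothesis carlesonX : forall tau,
  (carleson_int beta M (vtwist a (ImC c1)) tau <= X%:E)%E.
Hypothesis ZE : forall J, \sum_(j < J) kappa / ((kappa / 2) ^+ 2 + j%:R ^+ 2) <= Z.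

(** The bound kappa / 16 gives y <= 2 delta <= kappa / 8, so that Re w = kappa - y stays in
    [kappa / 2, kappa] and the Harnack factor is at least 1/2 on the windows below; the bound 1/4
    keeps 1/2 + 2 delta <= 1. *)
Let delta := Num.min (kappa / 16) 4^-1.

Let delta0 : 0 < delta.
Proof. by rewrite /delta lt_min divr_gt0 //= invr_gt0. Qed.

Let deltak : 16 * delta <= kappa.
Proof. by rewrite mulrC -ler_pdivlMr // /delta ge_min lexx. Qed.

Let delta4 : 4 * delta <= 1.
Proof. by rewrite mulrC -ler_pdivlMr // div1r /delta ge_min lexx orbT. Qed.

(** For the n-th coefficient only the window y in [h n, 2 h n] is kept. There r^(2 Omega(n)) >= 1/2
    because Omega(n) < d(n), and the weight y^(beta - 1) integrates to at least a constant times
    h(n)^beta, that is d(n)^-beta; no exact integral of the Harnack factor is needed. *)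
Let h n := delta / ndiv R n.
Let In n : set (measurableTypeR R) := `[2^-1 + h n, 2^-1 + 2 * h n].
Let co n := cabs2 (b n) * (2^-1 * (h n `^ beta / (2 * h n))).

(** Each window has length h(n) and height [co n], whose product is delta^beta / 4 times the n-th
    term of the norm. On the other side the kernel bounds sum to at most [Z], and each segment
    integrates to at most X, once for positive and once for negative heights. *)
Lemma wsum_integrated N : delta `^ beta / 4 * wsum beta b N <= 2 * Z * X.
Proof.
have [d0 dk d4] := And3 delta0 deltak delta4.
have nd n : (0 < n)%N -> 1 <= ndiv R n by exact: ndiv_ge1.
have h0 n : (0 < n)%N -> 0 < h n.
  by move=> n0; rewrite divr_gt0 // (lt_le_trans ltr01) // nd.
have hd n : (0 < n)%N -> h n <= delta.
  move=> n0; rewrite ler_pdivrMr ?(lt_le_trans ltr01) ?nd //.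
  by rewrite ler_peMr ?nd // ltW.
pose D : R := N.+1%:R.
have D0 : 0 < D by [].
have hD n : (0 < n <= N)%N -> delta / D <= h n.
  move=> /andP[n0 nN]; rewrite ler_wpM2l ?(ltW delta0) // lef_pV2 ?posrE //; last first.
    by rewrite (lt_le_trans ltr01) // nd.
  by rewrite /D /ndiv ler_nat (leq_trans (size_divisors_le n0)) // ltnW.
(* Every window with n <= N lies above [eta], because d(n) <= n. On [I] the weight is then at most 1
   / eta, which makes the error of cutting at U uniform in y. *)
set eta := delta / D in hD; have e0 : 0 < eta by rewrite divr_gt0.
pose I : set (measurableTypeR R) := `[2^-1 + eta, 2^-1 + 2 * delta].
have mI : measurable I by exact: measurable_itv.
have mIn n : measurable (In n) by exact: measurable_itv.
have I1 : I `<=` `[2^-1, 1].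
  move=> x; move: (x : R) => {}x; rewrite /I /= !in_itv /= => /andP[x1 x2].
  by apply/andP; split; lra.
have hge n : 0 <= h n by rewrite divr_ge0 ?(ltW delta0) // /ndiv ler0n.
have co0 n : 0 <= co n.
  rewrite /co mulr_ge0 ?cabs2_ge0 // mulr_ge0 ?invr_ge0 // divr_ge0 ?powR_ge0 //.
  by rewrite mulr_ge0 ?hge.
pose B := (\sum_(1 <= n < M.+1) modc (a n)) ^+ 2.
have B0 : 0 <= B by exact: sqr_ge0.
(* A step function below the weighted twisted norm: 1/2 comes from the Harnack factor and h^beta /
   (2 h) from the weight. *)
pose m (x : R) := (\sum_(1 <= n < N.+1) (co n)%:E * (\1_(In n) x)%:E)%E.
have m_le U (J : nat) (x : R) : 0 < U -> U < pi / 2 -> kappa * tan U <= J%:R -> I x ->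
    (m x <= \sum_(j < J) (kappa / ((kappa / 2) ^+ 2 + j%:R ^+ 2))%:E *
      (slab (vtwist a (ImC c1)) M x ((x - 2^-1) `^ (beta - 1)) j%:R +
       slab (vtwist a (ImC c1)) M x ((x - 2^-1) `^ (beta - 1)) (- j%:R - 1)) +
       (eta^-1 * B * (pi - 2 * U))%:E)%E.
  move=> U0 Upi kJ; rewrite /I /= in_itv /= => /andP[x1 x2].
  pose y := x - 2^-1; have xE : x = 2^-1 + y by rewrite /y addrC subrK.
  have y0 : 0 < y by rewrite /y; lra.
  have yk : y < kappa by rewrite /y; lra.
  set v := (x - 2^-1) `^ (beta - 1); have v0 : 0 <= v by exact: powR_ge0.
  have vE : v <= eta^-1.
    by apply: powR_pred_le => //; apply/andP; split; [rewrite lerBrDl|rewrite lerBlDl; lra].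
  apply: (@le_trans _ _ (v * poisson_form (alpha_coef a y) (c1 - (2^-1 + y)%:C) 1 M)%:E).
    have : v * (\sum_(1 <= n < N.+1) (((kappa - y) / (kappa + y)) ^+ bigOmega n) ^+ 2 * cabs2 (b n))
        <= v * poisson_form (alpha_coef a y) (c1 - (2^-1 + y)%:C) 1 M.
      by rewrite ler_wpM2l // form_le // y0 yk.
    rewrite -lee_fin; apply: le_trans; rewrite /m mulr_sumr -sumEFin !big_nat.
    apply: lee_sum => n /andP[n0 nN]; rewrite -EFinM lee_fin indicE.
    have rhs0 : 0 <= v * ((((kappa - y) / (kappa + y)) ^+ bigOmega n) ^+ 2 * cabs2 (b n)).
      by rewrite mulr_ge0 // mulr_ge0 ?sqr_ge0 ?cabs2_ge0.
    case: (boolP (x \in In n)) => [|_]; last by rewrite mulr0.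
    rewrite inE /In /= in_itv /= mulr1 => /andP[z1 z2].
    have hy : h n <= y <= 2 * h n by apply/andP; split; rewrite /y; lra.
    set F := _ ^+ 2; have -> : v * (F * cabs2 (b n)) = cabs2 (b n) * (F * v) by ring.
    rewrite /co ler_wpM2l ?cabs2_ge0 //; apply: ler_pM.
    - by rewrite invr_ge0.
    - by rewrite divr_ge0 ?powR_ge0 // mulr_ge0 ?hge.
    - apply: (@harnack_factor_ge R kappa y (ndiv R n)) => //.
        by rewrite /ndiv ler_nat ltnW // bigOmega_lt_divisors.
      have nd0 : 0 < ndiv R n by rewrite (lt_le_trans ltr01) // nd.
      have : ndiv R n * y <= 2 * delta.
        have /andP[_ /(ler_wpM2l (ltW nd0))] := hy.
        by rewrite /h mulrCA (mulrCA (ndiv R n)) mulfV ?gt_eqF // mulr1.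
      lra.
    - by apply: powR_pred_ge => //; exact: h0.
  have wE : ReC (c1 - (2^-1 + y)%:C) = kappa - y /\ ImC (c1 - (2^-1 + y)%:C) = ImC c1.
    by rewrite kE; case: (c1) => u1 u2 /=; split; lra.
  have P := @poisson_form_slabs R a (c1 - (2^-1 + y)%:C) M y v (kappa / 2) kappa U B J.
  rewrite !wE.1 !wE.2 -xE in P; rewrite -xE; apply: (le_trans (P _ _ _ _ _ _ _ _)) => //.
  - by rewrite divr_gt0.
  - by apply/andP; split; rewrite /y; lra.
  - exact: ltW.
  - apply: leeD => //; rewrite lee_fin ler_wpM2r //; first by lra.
    by rewrite ler_wpM2r.
have cX := carleson_slab_le mI I1 (carlesonX _).
have X0 : 0 <= X.
  rewrite -lee_fin; apply: le_trans (carlesonX 0); apply: integral_ge0 => p _.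
  by rewrite lee_fin mulr_ge0 ?cabs2_ge0 ?powR_ge0.
have arith1 (U : R) : U < pi / 2 -> 0 <= pi - 2 * U by move=> ?; lra.
have arith2 : 2^-1 + 2 * delta - (2^-1 + eta) <= 1 by lra.
have C0 j : 0 <= kappa / ((kappa / 2) ^+ 2 + j%:R ^+ 2).
  by rewrite divr_ge0 ?(ltW k0) // addr_ge0 ?sqr_ge0.
have ind0 n x : (0 <= (\1_(In n) x)%:E :> \bar R)%E by rewrite lee_fin indicE.
have mind n : measurable_fun I (fun x : R => (\1_(In n) x)%:E : \bar R).
  by apply/measurable_EFinP; exact: measurable_indic.
have int_m : (\int[mu]_(x in I) m x = (delta `^ beta / 4 * wsum beta b N)%:E)%E.
  rewrite /m ge0_integral_sum //; first last.
  - by move=> n x _; rewrite mule_ge0 ?lee_fin.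
  - by move=> n; apply: measurable_funeM; exact: mind.
  rewrite /wsum mulr_sumr -sumEFin; apply: eq_big_nat => n /andP[n0 nN].
  rewrite ge0_integralZl_EFin // integral_indic // setIidl; last first.
    move=> x; move: (x : R) => {}x; rewrite /I /In /= !in_itv /= => /andP[x1 x2].
    have := hD n; rewrite n0 /= -ltnS nN => /(_ isT); have := hd n n0.
    by move=> *; apply/andP; split; lra.
  rewrite [X in (_ * X)%E](lebesgue_measure_itv `[2^-1 + h n, 2^-1 + 2 * h n]%R) /=.
  have hn0 := h0 n n0; rewrite lte_fin ltrD2l ltr_pMl // ltr1n /= -EFinD -EFinM; congr _%:E.
  rewrite /co (_ : h n `^ beta = delta `^ beta / ndiv R n `^ beta).
    have hd0 : h n != 0 by rewrite gt_eqF.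
    have nd0 : ndiv R n `^ beta != 0.
      by rewrite gt_eqF // powR_gt0 // (lt_le_trans ltr01) // nd.
    by field; rewrite hd0 nd0.
  rewrite /h powRM ?invr_ge0 ?(ltW d0) ?(le_trans ler01 (nd n n0)) //.
  by rewrite -[(ndiv R n)^-1]powR_inv1 ?(le_trans ler01 (nd n n0)) // -powRrM mulN1r powRN.
(* The number J of segments grows with U, but [Z] bounds the kernel sums for every J, so U may tend
   to pi / 2 afterwards. *)
have key U : 0 < U -> U < pi / 2 ->
    delta `^ beta / 4 * wsum beta b N <= 2 * Z * X + eta^-1 * B * (pi - 2 * U).
  move=> U0 Upi; pose J := Num.bound (kappa * tan U).
  have tU : 0 <= tan U by exact: tan_ge0.
  have kJ : kappa * tan U <= J%:R by rewrite ltW // archi_boundP // mulr_ge0 // ltW.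
  have Q0 : 0 <= eta^-1 * B * (pi - 2 * U).
    have hU := arith1 U Upi.
    by rewrite mulr_ge0 // mulr_ge0 // invr_ge0 ltW.
  pose v (x : R) := (x - 2^-1) `^ (beta - 1).
  pose T (x : R) (j : nat) := (slab (vtwist a (ImC c1)) M x (v x) j%:R +
    slab (vtwist a (ImC c1)) M x (v x) (- j%:R - 1))%E.
  have T0 x j : (0 <= T x j)%E by rewrite adde_ge0 // slab_ge0 // powR_ge0.
  have mT j : measurable_fun I (fun x : R => T x j).
    by apply: emeasurable_funD; exact: measurable_slab.
  have CT0 x (j : nat) : (0 <= (kappa / ((kappa / 2) ^+ 2 + j%:R ^+ 2))%:E * T x j)%E.
    by rewrite mule_ge0 // lee_fin.
  have mCT (j : nat) :
      measurable_fun I (fun x : R => (kappa / ((kappa / 2) ^+ 2 + j%:R ^+ 2))%:E * T x j)%E.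
    exact: measurable_funeM.
  rewrite -lee_fin -int_m.
  apply: (@le_trans _ _ (\int[mu]_(x in I) (\sum_(j < J)
    (kappa / ((kappa / 2) ^+ 2 + j%:R ^+ 2))%:E * T x j + (eta^-1 * B * (pi - 2 * U))%:E)))%E.
    apply: ge0_le_integral => //.
    - by move=> x _; apply: sume_ge0 => n _; rewrite mule_ge0 ?lee_fin.
    - by apply: emeasurable_sum => n; apply: measurable_funeM; exact: mind.
    - apply: emeasurable_funD; last exact: measurable_cst.
      by apply: emeasurable_sum => j.
    - by move=> x Ix; exact: m_le.
  rewrite ge0_integralD //; first last.
  - by apply: emeasurable_sum => j.
  - by move=> x _; apply: sume_ge0 => j _.
  rewrite EFinD; apply: leeD; last first.
    rewrite [leLHS](_ : _ = (eta^-1 * B * (pi - 2 * U))%:E * mu I)%E; last first.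
      exact: integral_cst.
    rewrite /I [X in (_ * X)%E](lebesgue_measure_itv `[2^-1 + eta, 2^-1 + 2 * delta]%R) /=.
    case: ifP => _; last by rewrite mule0 lee_fin.
    by rewrite -EFinD -EFinM lee_fin ler_piMr.
  rewrite (@ge0_integral_sum _ _ _ mu I mI 'I_J (fun j x =>
    (kappa / ((kappa / 2) ^+ 2 + j%:R ^+ 2))%:E * T x j)%E (fun j => mCT j) (fun j x _ => CT0 x j)).
  apply: (@le_trans _ _ (\sum_(j < J) (kappa / ((kappa / 2) ^+ 2 + j%:R ^+ 2) * (2 * X))%:E)%E).
    apply: lee_sum => j _; rewrite ge0_integralZl_EFin // [leRHS]EFinM lee_wpmul2l ?lee_fin //.
    rewrite /T ge0_integralD //; first last.
    - exact: measurable_slab.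
    - by move=> x _; rewrite slab_ge0 // powR_ge0.
    - exact: measurable_slab.
    - by move=> x _; rewrite slab_ge0 // powR_ge0.
    by rewrite mulr_natl mulr2n EFinD; apply: leeD; exact: cX.
  rewrite sumEFin lee_fin -mulr_suml (_ : 2 * Z * X = Z * (2 * X)); last by ring.
  by rewrite ler_wpM2r ?mulr_ge0.
clear int_m; apply/ler_addgt0Pr => e egt0.
have Q0 : 0 <= eta^-1 * B by rewrite mulr_ge0 // invr_ge0 ltW.
move: key; move: (eta^-1 * B) Q0 => Q Q0 key.
pose t := Num.min (pi / 4) (e / (2 * Q + 1)).
have P0 := pi_gt0 R.
have Q1 : 0 < 2 * Q + 1 by lra.
have t0 : 0 < t by rewrite /t lt_min !divr_gt0.
have t1 : t <= pi / 4 by rewrite /t ge_min lexx.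
have t2 : t * (2 * Q + 1) <= e by rewrite -ler_pdivlMr // /t ge_min lexx orbT.
have U1 : 0 < pi / 2 - t by lra.
have U2 : pi / 2 - t < pi / 2 by lra.
apply: (le_trans (key _ U1 U2)); rewrite lerD2l; apply: le_trans t2.
rewrite (_ : pi - 2 * (pi / 2 - t) = 2 * t); last by field.
by rewrite (_ : t * (2 * Q + 1) = Q * (2 * t) + t); [rewrite lerDl ltW|ring].
Qed.
End integrated.

(** * Boundedness from the Carleson condition *)

Lemma ccvgP (R : realType) (u : nat -> R[i]) z :
  ccvg u z <-> (forall e, 0 < e -> exists J0, forall J, (J0 <= J)%N -> modc (u J - z) <= e).
Proof.
split => [[/cvgrPdist_le h1 /cvgrPdist_le h2] e e0|h].
  have e2 : 0 < e / 2 by rewrite divr_gt0.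
  have [J1 _ H1] := h1 _ e2; have [J2 _ H2] := h2 _ e2.
  exists (maxn J1 J2) => J; rewrite geq_max => /andP[l1 l2].
  apply: (le_trans (modc_le_ReIm _)); rewrite (splitr e); apply: lerD.
    by have := H1 J l1; rewrite distrC; case: (u J) z {h1 h2 H1 H2} => ? ? [].
  by have := H2 J l2; rewrite distrC; case: (u J) z {h1 h2 H1 H2} => ? ? [].
split; apply/cvgrPdist_le => e /h[J0 H]; exists J0 => // J /= /H; apply: le_trans.
  by rewrite distrC; apply: le_trans (le_ReC_modc _); case: (u J) z {h H} => ? ? [].
by rewrite distrC; apply: le_trans (le_ImC_modc _); case: (u J) z {h H} => ? ? [].
Qed.

(** Cauchy-Schwarz with the sum of d(n)^alpha n^(-2 x), which converges for x > 1/2: evaluation at w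
    is bounded on the space, uniformly for Re w >= x. *)
Lemma dpartial_cs (R : realType) (alpha x : R) : 0 <= alpha -> 2^-1 < x ->
  exists2 Z : R, 0 < Z & forall (a : nat -> R[i]) w M, x <= ReC w ->
    cabs2 (dpartial a w M) <= Z * wsum alpha a M.
Proof.
move=> a0 x1; have x2 : 1 < 2 * x by lra.
have [Z Z0 hZ] := sum_ndiv_powR_bounded a0 x2; exists Z => // a w M xw.
have d0 n : (0 < n)%N -> 0 < ndiv R n `^ alpha.
  by move=> n0; rewrite powR_gt0 // (lt_le_trans ltr01) // ndiv_ge1.
apply/ler_addgt0Pr => e e0.
have eZ : 0 < e / Z by rewrite divr_gt0.
have W0 := wsum_ge0 alpha a M.
rewrite -sqr_modc; pose X := Num.sqrt (wsum alpha a M + e / Z).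
have W1 : 0 < wsum alpha a M + e / Z by rewrite ltr_wpDl.
have XE : X ^+ 2 = wsum alpha a M + e / Z by rewrite sqr_sqrtr // ltW.
have ZE : Num.sqrt Z ^+ 2 = Z by rewrite sqr_sqrtr // ltW.
have le : modc (dpartial a w M) <= X * Num.sqrt Z.
  apply: (@le_trans _ _ (\sum_(n <- index_iota 1 M.+1)
    (modc (a n) / Num.sqrt (ndiv R n `^ alpha)) *
    (Num.sqrt (ndiv R n `^ alpha) * (n%:R : R) `^ (- ReC w)))).
    apply: (le_trans (modc_sum _ _ _)); apply: ler_sum_nat => n /andP[n0 _].
    rewrite modcM modc_npow // mulrA divfK // gt_eqF // sqrtr_gt0; exact: d0.
  apply: sum_cauchy_schwarz; rewrite ?sqrtr_gt0 //.
    rewrite XE ler_wpDr ?(ltW eZ) //; apply: ler_sum_nat => n /andP[n0 _].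
    by rewrite exprMn exprVn sqr_modc sqr_sqrtr ?(ltW (d0 n n0)).
  rewrite ZE; apply: le_trans (hZ M); apply: ler_sum_nat => n /andP[n0 _].
  rewrite exprMn sqr_sqrtr ?(ltW (d0 n n0)) // ler_wpM2l ?(ltW (d0 n n0)) //.
  rewrite powR_natN_sqr; apply: ler_powR; first by rewrite ler1n.
  by rewrite lerN2; lra.
have : modc (dpartial a w M) ^+ 2 <= (X * Num.sqrt Z) ^+ 2.
  by rewrite ler_sqr ?nnegrE ?modc_ge0 // mulr_ge0 ?sqrtr_ge0.
move=> h; apply: (le_trans h); rewrite exprMn XE ZE mulrDl divfK ?gt_eqF //.
by rewrite mulrC.
Qed.

(** * Tails and convergence in the weighted spaces *)

Section completion.
Variable R : realType.
Implicit Types (a b : nat -> R[i]) (alpha beta : R).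

Definition tail_from a M : nat -> R[i] := fun n => a n - trunc M a n.

Lemma dpartial_trunc a s M N : (M <= N)%N -> dpartial (trunc M a) s N = dpartial a s M.
Proof.
move=> MN; rewrite (@dpartial_extend _ _ s M N MN) => [|n Mn]; last first.
  by rewrite /trunc leqNgt Mn.
by apply: eq_big_nat => n /andP[_ nM]; rewrite /trunc -ltnS nM.
Qed.

Lemma dpartial_tail a s M N : (M <= N)%N ->
  dpartial (tail_from a M) s N = dpartial a s N - dpartial a s M.
Proof. by move=> MN; rewrite dpartialB dpartial_trunc. Qed.

Lemma wsum_tail alpha a M N : (M <= N)%N ->
  wsum alpha (tail_from a M) N = wsum alpha a N - wsum alpha a M.
Proof.
move=> MN; rewrite /wsum (@big_cat_nat _ _ _ M.+1) //= [in RHS](@big_cat_nat _ _ _ M.+1) //=.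
rewrite [X in X + _ = _]big1_seq ?add0r.
  rewrite addrAC subrr add0r; apply: eq_big_nat => n /andP[Mn _].
  by rewrite /tail_from /trunc leqNgt Mn subr0.
move=> n /andP[_]; rewrite mem_index_iota => /andP[_ nM].
by rewrite /tail_from /trunc -ltnS nM subrr /cabs2 /= expr0n /= addr0 mul0r.
Qed.

Lemma wsum_mono alpha a M N : (M <= N)%N -> wsum alpha a M <= wsum alpha a N.
Proof. by move=> MN; rewrite -subr_ge0 -wsum_tail // wsum_ge0. Qed.

Lemma wsum_ext alpha a b M : (forall n, (0 < n)%N -> a n = b n) -> wsum alpha a M = wsum alpha b M.
Proof. by move=> ab; apply: eq_big_nat => n /andP[n0 _]; rewrite ab. Qed.

Lemma wsum_lim_le alpha (u : nat -> nat -> R[i]) b X N :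
  (forall n, (0 < n)%N -> forall e, 0 < e -> exists J0, forall J, (J0 <= J)%N ->
      modc (u J n - b n) <= e) ->
  (exists J0, forall J, (J0 <= J)%N -> wsum alpha (u J) N <= X) ->
  wsum alpha b N <= X.
Proof.
move=> ub [J0 h]; have e c : wsum alpha c N = \sum_(1 <= n < N.+1) (ndiv R n `^ alpha)^-1 * cabs2 (c n).
  by apply: eq_bigr => n _; rewrite mulrC.
rewrite e; apply: wsum_cabs2_le ub _ => e' e0; exists J0 => J /h.
by rewrite e => h'; rewrite ler_wpDr // ltW.
Qed.

Lemma inD_tail alpha a : inD alpha a -> exists2 X : R, Dnorm2 alpha a = X%:E &
  (forall M, wsum alpha a M <= X) /\
  (forall e, 0 < e -> exists M0, forall M, (M0 <= M)%N -> X - wsum alpha a M <= e).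
Proof.
move=> h; have D0 : (0 <= Dnorm2 alpha a)%E.
  by apply: le_trans (wsum_le_Dnorm2 _ _ 0%N); rewrite lee_fin wsum_ge0.
have fD : Dnorm2 alpha a \is a fin_num by rewrite ge0_fin_numE.
exists (fine (Dnorm2 alpha a)); first by rewrite fineK.
have hX M : wsum alpha a M <= fine (Dnorm2 alpha a).
  by rewrite -lee_fin fineK // wsum_le_Dnorm2.
split => // e e0; have [[M0 hM]|hn] := pselect (exists M, fine (Dnorm2 alpha a) - wsum alpha a M <= e).
  by exists M0 => M /(wsum_mono alpha a) hM'; apply: le_trans hM; rewrite lerB.
have : (Dnorm2 alpha a <= (fine (Dnorm2 alpha a) - e)%:E)%E.
  apply: Dnorm2_le => M; rewrite lee_fin lerBrDl -lerBrDr leNgt; apply/negP => h'.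
  by apply: hn; exists M; rewrite ltW.
by rewrite -{1}(fineK fD) lee_fin lerBrDr gerDl leNgt e0.
Qed.

Lemma dpartial_cauchy alpha a w : 0 <= alpha -> 2^-1 < ReC w -> inD alpha a ->
  exists z, dser_to a w z.
Proof.
move=> a0 hw /inD_tail[X _ [hX tX]].
have [Z Z0 hZ] := dpartial_cs a0 hw.
suff H e : 0 < e -> exists J0, forall J K, (J0 <= J)%N -> (J <= K)%N ->
    modc (dpartial a w J - dpartial a w K) <= e.
  have [z hz] : exists z, forall e, 0 < e -> exists J0, forall J, (J0 <= J)%N ->
      modc (dpartial a w J - z) <= e.
    apply: complex_complete => e /H[J0 hJ]; exists J0 => J K J0J J0K.
    have [JK|KJ] := leqP J K; first exact: hJ.
    by rewrite -modcN opprB hJ // ltnW.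
  by exists z; apply/ccvgP.
move=> e0; have eZ : 0 < e ^+ 2 / Z by rewrite divr_gt0 ?exprn_gt0.
have [M0 hM] := tX _ eZ; exists M0 => J K MJ JK.
rewrite -modcN opprB -dpartial_tail // -ler_sqr ?nnegrE ?modc_ge0 ?(ltW e0) // sqr_modc.
apply: (le_trans (hZ _ _ _ (lexx _))); rewrite wsum_tail // -ler_pdivlMl // mulrC.
by apply: le_trans (hM J MJ); rewrite lerB.
Qed.

End completion.

(** * From Dirichlet polynomials to the whole space *)

Section boundedness.
Variable R : realType.
Implicit Types (a b : nat -> R[i]) (alpha beta : R).

(** A density argument carried out on coefficients. The images of the partial sums of a form a
    Cauchy sequence in the weighted norm, so each coefficient converges; the limit inherits the
    bound, and its series is compared with f(phi(s)) through point evaluations. *)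
Lemma comp_bounded_of_partial alpha beta K (phi : R[i] -> R[i]) :
  0 <= alpha -> 0 <= beta -> 0 <= K ->
  (forall s, 2^-1 < ReC s -> 2^-1 < ReC (phi s)) ->
  (forall a M, exists2 b, unif_apx predT (fun s => dpartial a (phi s) M) b &
     forall N, wsum beta b N <= K * wsum alpha a M) ->
  comp_bounded alpha beta phi.
Proof.
move=> al0 be0 K0 hphi H; exists K => a aD.
have [X XE [hX tX]] := inD_tail aD.
have [bM hb] : exists bM : nat -> nat -> R[i], forall M,
    unif_apx predT (fun s => dpartial a (phi s) M) (bM M) /\
    forall N, wsum beta (bM M) N <= K * wsum alpha a M.
  have H2 M : exists b, unif_apx predT (fun s => dpartial a (phi s) M) b /\
      forall N, wsum beta b N <= K * wsum alpha a M.
    by have [b h1 h2] := H a M; exists b.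
  by have [bM h] := choice H2; exists bM.
(* The hypothesis is applied to the segment of a between M and N; uniqueness identifies its image
   with the difference of the two images. *)
have hdiff M N L : (M <= N)%N ->
    wsum beta (fun n => bM N n - bM M n) L <= K * (X - wsum alpha a M).
  move=> MN; have [b h1 h2] := H (tail_from a M) N.
  apply: (@le_trans _ _ (K * wsum alpha (tail_from a M) N)); last first.
    by rewrite ler_wpM2l // wsum_tail // lerB.
  rewrite (wsum_ext _ _ (b := b)) // => n n0.
  have u1 := apx_sub ((hb N).1 _ ltr01) ((hb M).1 _ ltr01).
  have u2 : apx 1 predT (fun s => dpartial a (phi s) N - dpartial a (phi s) M) b.
    by apply: apx_ext (h1 _ ltr01) _ _ => // s _; rewrite dpartial_tail.
  exact: (apx_unique ler01 u1 u2 n0).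
have w0 n : (0 < n)%N -> 0 < ndiv R n `^ beta.
  by move=> n0; rewrite powR_gt0 // (lt_le_trans ltr01) // ndiv_ge1.
have hcoef n : (0 < n)%N -> exists l, forall e, 0 < e -> exists J0, forall J, (J0 <= J)%N ->
    modc (bM J n - l) <= e.
  move=> n0; apply: complex_complete => e e0.
  have c0 : 0 < ndiv R n `^ beta * (K + 1) by rewrite mulr_gt0 ?w0 // ltr_wpDl.
  have e1 : 0 < e ^+ 2 / (ndiv R n `^ beta * (K + 1)) by rewrite divr_gt0 ?exprn_gt0.
  have [M0 hM] := tX _ e1; exists M0.
  have le J L : (M0 <= J)%N -> (J <= L)%N -> modc (bM L n - bM J n) <= e.
    move=> MJ JL; rewrite -ler_sqr ?nnegrE ?modc_ge0 ?(ltW e0) // sqr_modc.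
    have : cabs2 (bM L n - bM J n) / ndiv R n `^ beta <= (K + 1) * (X - wsum alpha a J).
      apply: (@le_trans _ _ (K * (X - wsum alpha a J))); last first.
        by rewrite ler_wpM2r ?subr_ge0 // lerDl.
      apply: le_trans (hdiff J L n JL); case: (n) n0 => // m _.
      by rewrite /wsum big_nat_recr //= lerDr wsum_ge0.
    rewrite ler_pdivrMr ?w0 // => h; apply: (le_trans h).
    have := hM J MJ; rewrite ler_pdivlMr // => h'; apply: le_trans h'.
    by rewrite le_eqVlt; apply/orP; left; apply/eqP; ring.
  move=> J L MJ ML; have [JL|LJ] := leqP J L.
    by rewrite -modcN opprB; exact: le.
  exact/le/ltnW.
have [b hbl] : exists b, forall n, (0 < n)%N -> forall e, 0 < e -> exists J0, forall J, (J0 <= J)%N ->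
    modc (bM J n - b n) <= e.
  have H1 n : exists l, (0 < n)%N -> forall e, 0 < e -> exists J0, forall J, (J0 <= J)%N ->
      modc (bM J n - l) <= e.
    by case: n => [|n]; [exists 0|have [l hl] := hcoef n.+1 isT; exists l].
  by have [b h] := choice H1; exists b.
have wb N : wsum beta b N <= K * X.
  apply: wsum_lim_le hbl _; exists 0%N => J _.
  by apply: (le_trans ((hb J).2 N)); rewrite ler_wpM2l.
have wd M N : wsum beta (fun n => b n - bM M n) N <= K * (X - wsum alpha a M).
  apply: (@wsum_lim_le _ _ (fun J n => bM J n - bM M n)); last by exists M => J; exact: hdiff.
  move=> n n0 e /(hbl n n0)[J0 h]; exists J0 => J /h.
  by rewrite (_ : bM J n - bM M n - (b n - bM M n) = bM J n - b n) //; ring.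
have bb : (Dnorm2 beta b <= K%:E * Dnorm2 alpha a)%E.
  by rewrite XE; apply: Dnorm2_le => M; rewrite lee_fin.
exists b; split; first by apply: le_lt_trans bb _; rewrite XE ltry.
split => // s s2; have [z hz] := dpartial_cauchy al0 (hphi s s2) aD.
exists z; split => //; apply/ccvgP => e e0.
have e3 : 0 < e / 3 by rewrite divr_gt0.
have [Z Z0 hZ] := dpartial_cs be0 s2.
have c0 : 0 < Z * (K + 1) by rewrite mulr_gt0 // ltr_wpDl.
have e1 : 0 < (e / 3) ^+ 2 / (Z * (K + 1)) by rewrite divr_gt0 ?exprn_gt0.
have [M1 hM1] := tX _ e1; have [M2 hM2] := (ccvgP _ _).1 hz _ e3.
pose M := maxn M1 M2.
have ee : 0 < (ReC s - 2^-1) / 2 by rewrite divr_gt0 // subr_gt0.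
have eps : (ReC s - 2^-1) / 2 + 2^-1 < ReC s by lra.
have [N0 hN] := apx_series (ltW ee) ((hb M).1 _ ee) eps e3.
(* Three errors of e / 3: the limit b against the M-th image, the M-th image against its sum, and
   the M-th partial sum at phi(s) against z. *)
exists N0 => N /hN h2.
have h3 : modc (dpartial (fun n => b n - bM M n) s N) <= e / 3.
  rewrite -ler_sqr ?nnegrE ?modc_ge0 ?(ltW e3) // sqr_modc.
  apply: (le_trans (hZ _ _ _ (lexx _))).
  apply: (@le_trans _ _ (Z * (K * (X - wsum alpha a M)))); first by rewrite ler_wpM2l // ltW.
  have := hM1 M (leq_maxl _ _); rewrite ler_pdivlMr // => h'; apply: le_trans h'.
  have : 0 <= Z * (X - wsum alpha a M) by rewrite mulr_ge0 ?subr_ge0 // ltW.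
  by lra.
rewrite (_ : dpartial b s N - z = dpartial (fun n => b n - bM M n) s N +
  ((dpartial (bM M) s N - dpartial a (phi s) M) + (dpartial a (phi s) M - z))); last first.
  by rewrite dpartialB; ring.
apply: (le_trans (modcD _ _)); rewrite (_ : e = e / 3 + (e / 3 + e / 3)); last by field.
apply: lerD => //; apply: (le_trans (modcD _ _)); apply: lerD => //.
exact: hM2 (leq_maxr _ _).
Qed.

Lemma symbol_wsum_le alpha beta K (c : nat -> R[i]) (phi : R[i] -> R[i]) : 0 < beta ->
  (forall N a tau, (carleson_int beta N a tau <= K%:E * Dnorm2 alpha (trunc N a))%E) ->
  GH_char0 c phi ->
  exists2 K', 0 <= K' & forall a M, exists2 b,
    unif_apx predT (fun s => dpartial a (phi s) M) b &
    forall N, wsum beta b N <= K' * wsum alpha a M.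
Proof.
move=> b0 hK GH; have k0 := symbol_kappa_gt0 GH.
set kappa := ReC (c 1%N) - 2^-1 in k0.
have k2 : 0 < kappa / 2 by rewrite divr_gt0.
have [Z Z0 hZ] := sum_poisson_kernel_bounded k2 (ltW k0).
pose q := Num.min (kappa / 16) 4^-1 `^ beta / 4.
have q0 : 0 < q by rewrite divr_gt0 // powR_gt0 // lt_min invr_gt0 divr_gt0 //=.
exists (2 * Z * `|K| / q); first by rewrite divr_ge0 ?(ltW q0) // !mulr_ge0 // ltW.
move=> a M; have [b h1 h2] := symbol_comp a M GH; exists b => // N.
have hX tau : (carleson_int beta M (vtwist a (ImC (c 1%N))) tau <= (`|K| * wsum alpha a M)%:E)%E.
  apply: (le_trans (hK _ _ _)); rewrite Dnorm2_trunc wsum_vtwist -EFinM lee_fin.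
  by rewrite ler_wpM2r ?wsum_ge0 // ler_norm.
have := wsum_integrated b0 (erefl kappa) k0 (fun y N h => h2 y N h) hX hZ N.
rewrite -/q mulrC -ler_pdivlMr // => h; apply: (le_trans h).
by rewrite le_eqVlt; apply/orP; left; apply/eqP; rewrite -/kappa -/q; ring.
Qed.

Lemma comp_bounded_of_carleson alpha beta : 0 < alpha -> 0 < beta ->
  (exists K : R, forall (N : nat) a (tau : R),
     (carleson_int beta N a tau <= K%:E * Dnorm2 alpha (trunc N a))%E) ->
  forall c phi, GH_char0 c phi -> comp_bounded alpha beta phi.
Proof.
move=> a0 b0 [K hK] c phi GH; have [K' K0 H] := symbol_wsum_le b0 hK GH.
apply: (comp_bounded_of_partial (ltW a0) (ltW b0) K0 _ H) => s hs.
by apply: GH.2; apply: lt_trans hs; rewrite invr_gt0.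
Qed.

End boundedness.

(** * Sampling on circles *)

Lemma cisN_2pi (R : realType) k : cisN (k%:R * (2 * pi) : R) = 1.
Proof.
elim: k => [|k IH]; first by rewrite mul0r cisN0.
rewrite -natr1 mulrDl mul1r cisND IH mul1r (_ : 2 * pi = pi + pi); last by ring.
by rewrite cisND cisNpi mulrNN mulr1.
Qed.

Lemma cisN_natmul (R : realType) (x : R) j : cisN (j%:R * x) = cisN x ^+ j.
Proof.
elim: j => [|j IH]; first by rewrite mul0r cisN0 expr0.
by rewrite -natr1 mulrDl mul1r cisND IH exprSr.
Qed.

Lemma cisN_neq1 (R : realType) (x : R) : 0 < `|x| -> `|x| < 2 * pi -> cisN x != 1.
Proof.
move=> x0 x2; apply/eqP => /(congr1 (@complex.Re R)) /= c1.
have : cos `|x| = 1 by case: (ger0P x) => _ //; rewrite cosN.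
rewrite {1}(_ : `|x| = `|x| / 2 + `|x| / 2); last by field.
rewrite cosD => c2; have s2 : sin (`|x| / 2) ^+ 2 = 0.
  by have := cos2Dsin2 (`|x| / 2); move: c2; rewrite !expr2; lra.
have : 0 < sin (`|x| / 2).
  apply: sin_gt0_pi; apply/andP; split; first by rewrite divr_gt0.
  by rewrite ltr_pdivrMr // mulrC.
by move/eqP: s2; rewrite sqrf_eq0 => /eqP ->; rewrite ltxx.
Qed.

Lemma sum_roots_of_unity (R : realType) (J k l : nat) : (k < J)%N -> (l < J)%N ->
  \sum_(j < J) cisN (j%:R * ((k%:R - l%:R) * (2 * pi / J%:R))) =
  (if k == l then J%:R else 0) :> R[i].
Proof.
move=> kJ lJ; case: eqP => [->|/eqP kl].
  rewrite (eq_bigr (fun=> 1)); first by rewrite sumr_const card_ord.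
  by move=> j _; rewrite subrr mul0r mulr0 cisN0.
have J0 : (0 : R) < J%:R by rewrite ltr0n (leq_trans _ kJ).
set x := (k%:R - l%:R) * _.
have xE : J%:R * x = k%:R * (2 * pi) - l%:R * (2 * pi).
  by rewrite /x; field; rewrite gt_eqF.
have klr : `|k%:R - l%:R| < J%:R :> R.
  have : (k%:R : R) < J%:R by rewrite ltr_nat.
  have : (l%:R : R) < J%:R by rewrite ltr_nat.
  have := ler0n R k; have := ler0n R l => *.
  by rewrite ltr_norml; apply/andP; split; lra.
have P := pi_gt0 R.
have nx : `|x| = `|k%:R - l%:R| * (2 * pi / J%:R).
  by rewrite /x normrM (ger0_norm (divr_ge0 _ _)) // ?(ltW J0) // mulr_ge0 // ltW.
have c0 : 0 < 2 * pi / J%:R :> R by rewrite divr_gt0 // mulr_gt0.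
have x1 : cisN x != 1.
  apply: cisN_neq1; rewrite nx.
    by rewrite mulr_gt0 // normr_gt0 subr_eq0 eqr_nat.
  apply: (@lt_le_trans _ _ (J%:R * (2 * pi / J%:R))); first by rewrite ltr_pM2r.
  by rewrite mulrC divfK // gt_eqF.
have e : (cisN x - 1) * \sum_(j < J) cisN x ^+ j = 0.
  by rewrite -subrX1 -cisN_natmul xE cisND -cisN_conj !cisN_2pi conjc_real ?rmorph1 ?mulr1 ?subrr.
rewrite (eq_bigr (fun j : 'I_J => cisN x ^+ j)); last by move=> j _; rewrite cisN_natmul.
by move/eqP: e; rewrite mulf_eq0 subr_eq0 (negbTE x1) => /eqP.
Qed.

(** With at least as many sample points as coefficients, orthogonality of roots of unity makes
    Parseval's identity exact, so the angular integral can be replaced by a finite sum. *)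
Lemma parseval_roots (R : realType) (c : nat -> R[i]) (J K : nat) : (K <= J)%N ->
  \sum_(j < J) cabs2 (\sum_(k < K) c k * cisN (k%:R * (j%:R * (2 * pi / J%:R)))) =
  J%:R * \sum_(k < K) cabs2 (c k).
Proof.
move=> KJ.
have e (j : 'I_J) : cabs2 (\sum_(k < K) c k * cisN (k%:R * (j%:R * (2 * pi / J%:R)))) =
    \sum_(k < K) \sum_(l < K)
      ReC (c k * conjc (c l) * cisN (j%:R * ((k%:R - l%:R) * (2 * pi / J%:R)))).
  transitivity (ReC ((\sum_(k < K) c k * cisN (k%:R * (j%:R * (2 * pi / J%:R)))) *
    conjc (\sum_(k < K) c k * cisN (k%:R * (j%:R * (2 * pi / J%:R)))))).
    by rewrite mulC_conj.
  rewrite conjc_sum mulr_suml ReC_sum; apply: eq_bigr => k _.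
  rewrite mulr_sumr ReC_sum; apply: eq_bigr => l _.
  rewrite conjcM cisN_conj mulrACA -cisND; congr (ReC (_ * cisN _)); ring.
rewrite (eq_bigr _ (fun j _ => e j)) exchange_big mulr_sumr; apply: eq_bigr => k _ /=.
rewrite exchange_big /= (bigD1 k) //= [X in _ + X]big1 ?addr0.
  rewrite -ReC_sum -mulr_sumr sum_roots_of_unity ?eqxx ?(leq_trans (ltn_ord k)) //.
  by rewrite mulC_conj ReC_realM -(rmorph_nat (real_complex R)) mulrC.
move=> l lk; rewrite -ReC_sum -mulr_sumr sum_roots_of_unity; last first.
- exact: leq_trans (ltn_ord l) KJ.
- exact: leq_trans (ltn_ord k) KJ.
by rewrite eq_sym (inj_eq val_inj) (negbTE lk) mulr0.
Qed.

(** * Expansions of P o psi and their sampling on circles *)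

Section symbol_psi.
Variable R : realType.
Implicit Types (a b q : nat -> R[i]) (alpha beta : R).

(** The exponential step with t = ln n applied to the constant 1; here only the existence of the
    expansion matters. *)
Lemma npow_psi_apx n : (0 < n)%N -> exists g, unif_apx pow2 (fun s => npow n (@psi R s)) g.
Proof.
move=> n0; have t0 : 0 <= ln (n%:R : R) by rewrite ln_ge0 // ler1n.
have V1 : unif_apx pow2 (fun=> 1) (fun m => if m == 1%N then (1 : R[i]) else 0).
  by move=> eps e0; apply: apx_const.
have [g [hg _ _]] := exp_step (fun i j => @pow2M i j) (@psi_apx R) V1 t0.
exists g => eps e0; apply: apx_ext (hg eps e0) _ _ => // s _.
by rewrite mulr1 npow_cexp.
Qed.

Lemma dpartial_psi_apx a N : exists g, unif_apx pow2 (fun s => dpartial a (psi s) N) g.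
Proof.
elim: N => [|N [g hg]].
  exists (fun m => if m == 1%N then 0 else 0) => eps e0.
  by apply: apx_ext (apx_const eps (S := pow2) 0 isT) _ _ => // s _; rewrite /dpartial big_geq.
have [p hp] := @npow_psi_apx N.+1 isT; exists (fun n => g n + a N.+1 * p n) => eps e0.
apply: apx_ext (apx_add (hg eps e0) (apx_scale (a N.+1) (hp eps e0))) _ _ => // s _.
by rewrite /dpartial [RHS]big_nat_recr.
Qed.

Lemma dpartial_psi_degree a N eps e : 0 < eps -> 0 < e -> exists D, forall a',
  (forall n, (0 < n)%N -> modc (a' n) <= modc (a n)) ->
  exists q, [/\ forall n, ~~ pow2 n -> q n = 0, forall n, (D < n)%N -> q n = 0 &
    forall s, eps < ReC s -> modc (dpartial a' (psi s) N - dpartial q s D) <= e].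
Proof.
move=> eps0; elim: N e => [|N IH] e e0.
  exists 0%N => a' _; exists (fun=> 0); split => // s _.
  by rewrite /dpartial !big_geq // subr0 modc0 ltW.
have e2 : 0 < e / 2 by rewrite divr_gt0.
have [D1 h1] := IH _ e2; have c0 : 0 < modc (a N.+1) + 1 by rewrite ltr_wpDl ?modc_ge0.
have [p hp] := @npow_psi_apx N.+1 isT.
have [D2 [r [r1 r2 r3 _]]] := hp eps eps0 _ (divr_gt0 e2 c0) 0%N.
exists (maxn D1 D2) => a' ha; have [q [q1 q2 q3]] := h1 a' ha.
exists (fun n => q n + a' N.+1 * r n); split.
- by move=> n np; rewrite q1 // r1 // mulr0 addr0.
- by move=> n; rewrite gtn_max => /andP[n1 n2]; rewrite q2 // r2 // mulr0 addr0.
move=> s es; rewrite dpartialD dpartialZ (dpartial_extend _ (leq_maxl _ _) q2).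
rewrite (dpartial_extend _ (leq_maxr _ _) r2) {1}/dpartial big_nat_recr //= -/(dpartial a' (psi s) N).
rewrite opprD addrACA -mulrBr (splitr e); apply: (le_trans (modcD _ _)); apply: lerD; first exact: q3.
rewrite modcM; apply: (@le_trans _ _ (modc (a N.+1) * (e / 2 / (modc (a N.+1) + 1)))).
  by apply: ler_pM; rewrite ?modc_ge0 ?ha ?r3.
by rewrite mulrCA ler_piMr ?(ltW e2) // ler_pdivrMr // mul1r lerDl.
Qed.

(** Partial sums of a series of the space converge uniformly on Re s > 1. This makes coefficients
    delivered by boundedness comparable, through uniqueness, with the expansion in powers of 2. *)
Lemma inD_apx beta b (F : R[i] -> R[i]) : 0 <= beta -> inD beta b ->
  (forall s, 2^-1 < ReC s -> dser_to b s (F s)) -> apx 1 predT F b.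
Proof.
move=> be0 /inD_tail[X _ [hX tX]] hF e e0 M.
have h1 : 2^-1 < 1 :> R by lra.
have [Z Z0 hZ] := dpartial_cs be0 h1.
have e1 : 0 < e ^+ 2 / Z by rewrite divr_gt0 ?exprn_gt0.
have [M0 hM] := tX _ e1; pose N := maxn M0 M.
exists N, (trunc N b); split => //.
- by move=> n Nn; rewrite /trunc leqNgt Nn.
- move=> s s1; rewrite dpartial_trunc //; apply/ler_addgt0Pr => d d0.
  have /ccvgP /(_ d d0) [J0 hJ] := hF s (lt_trans h1 s1).
  pose J := maxn J0 N; have := hJ J (leq_maxl _ _).
  rewrite -modcN opprB => hJ'.
  rewrite (_ : F s - dpartial b s N = (dpartial b s J - dpartial b s N) + (F s - dpartial b s J));
    last by ring.
  apply: (le_trans (modcD _ _)); apply: lerD => //.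
  rewrite -dpartial_tail ?leq_maxr // -ler_sqr ?nnegrE ?modc_ge0 ?(ltW e0) // sqr_modc.
  apply: (le_trans (hZ _ _ _ (ltW s1))); rewrite wsum_tail ?leq_maxr // -ler_pdivlMl // mulrC.
  by apply: le_trans (hM N (leq_maxl _ _)); rewrite lerB.
- move=> n /andP[n0 nM]; rewrite /trunc (leq_trans nM) ?leq_maxr // subrr modc0.
  exact: ltW.
Qed.

Lemma size_divisors_pow2 k : size (divisors (2 ^ k)) = k.+1.
Proof.
rewrite -[RHS](size_iota 0) -[RHS](size_map (expn 2)); apply/perm_size/uniq_perm.
- exact: divisors_uniq.
- by rewrite map_inj_uniq ?iota_uniq // => i j /eqP; rewrite eqn_exp2l // => /eqP.
- move=> d; rewrite -dvdn_divisors ?expn_gt0 //.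
  apply/(dvdn_pfactor d k (isT : prime 2))/mapP => [[m mk ->]|[m]].
    by exists m; rewrite // mem_iota.
  by rewrite mem_iota => /= mk ->; exists m.
Qed.

Lemma sum_pow2_le (F : nat -> R) K : (forall n, 0 <= F n) ->
  \sum_(k < K.+1) F (2 ^ k)%N <= \sum_(1 <= n < (2 ^ K).+1) F n.
Proof.
move=> F0; have := @sum_pow2 R (fun n => if pow2 n then F n else 0) (2 ^ K).
rewrite expn_gt0 trunc_expnK // => /(_ isT) e.
rewrite (eq_bigr (fun k : 'I_K.+1 => if pow2 (2 ^ k) then F (2 ^ k)%N else 0)); last first.
  by move=> k _; rewrite pow2_exp.
rewrite -e => [|n /negbTE -> //]; apply: ler_sum => n _.
by case: ifP.
Qed.

Lemma wsum_pow2_le beta b K :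
  \sum_(k < K.+1) cabs2 (b (2 ^ k)%N) / (k.+1%:R : R) `^ beta <= wsum beta b (2 ^ K).
Proof.
apply: le_trans (sum_pow2_le K (fun n => wsum_term_ge0 beta b n)).
by apply: ler_sum => k _; rewrite /ndiv size_divisors_pow2.
Qed.

(** The point s with 2^-s = r e^(-i th); dividing th by 2 compensates the half-angle convention of
    [vline]. *)
Definition circ (r th : R) : R[i] := vline (- (ln r / ln 2)) (th / 2).

Lemma ReC_circ r th : ReC (circ r th) = - (ln r / ln 2).
Proof. by []. Qed.

Lemma pow2_circ r : 0 < r -> (2 : R) `^ (- (- (ln r / ln 2))) = r.
Proof.
move=> r0; rewrite opprK /powR pnatr_eq0 /= divfK ?lnK //.
by rewrite gt_eqF // ln_gt0 // ltr1n.
Qed.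

Lemma npow_circ r th k : 0 < r -> npow (2 ^ k) (circ r th) = (r ^+ k)%:C * cisN (k%:R * th).
Proof.
move=> r0; rewrite npow2_vline pow2_circ //; congr (_ * cisN (_ * _)).
by rewrite mulrC divfK.
Qed.

Lemma parseval_circ q (r : R) D J : 0 < r -> (forall n, ~~ pow2 n -> q n = 0) ->
  (0 < D)%N -> ((trunc_log 2 D).+1 <= J)%N ->
  \sum_(j < J) cabs2 (dpartial q (circ r (j%:R * (2 * pi / J%:R))) D) =
  J%:R * \sum_(k < (trunc_log 2 D).+1) cabs2 (q (2 ^ k)%N) * (r ^+ k) ^+ 2.
Proof.
move=> r0 hq D0 DJ; under [in RHS]eq_bigr => k _.
  rewrite mulrC -cabs2_realM mulrC; over.
rewrite -(parseval_roots (fun k => q (2 ^ k)%N * (r ^+ k)%:C) DJ).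
apply: eq_bigr => j _; congr cabs2; rewrite /dpartial sum_pow2 //; last by move=> n /hq ->; rewrite mul0r.
by apply: eq_bigr => k _; rewrite npow_circ // mulrA.
Qed.

(** The polynomial q stands between F and its expansion g. The inequality |x + y|^2 <= 2 |x|^2 + 2
    |y|^2 is used twice, for the values and for the coefficients, whence 4 = 2 * 2 and 6 = 2 * 2 +
    2. *)
Lemma sampling_le (F : R[i] -> R[i]) g q (r e eps : R) D J : 0 < r -> 0 <= e ->
  unif_apx pow2 F g -> 0 < eps -> eps < - (ln r / ln 2) ->
  (forall n, ~~ pow2 n -> q n = 0) -> (forall n, (D < n)%N -> q n = 0) ->
  (0 < D)%N -> ((trunc_log 2 D).+1 <= J)%N ->
  (forall s, eps < ReC s -> modc (F s - dpartial q s D) <= e) ->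
  \sum_(j < J) cabs2 (F (circ r (j%:R * (2 * pi / J%:R)))) <=
  J%:R * (4 * (\sum_(k < (trunc_log 2 D).+1) cabs2 (g (2 ^ k)%N) * (r ^+ k) ^+ 2) + 6 * e ^+ 2).
Proof.
move=> r0 e0 Fg eps0 epsr hq qD D0 DJ hFq.
have h1 s : eps < ReC s -> cabs2 (F s) <= 2 * cabs2 (dpartial q s D) + 2 * e ^+ 2.
  move=> es; have := cabs2_addle (dpartial q s D) (F s - dpartial q s D).
  rewrite addrC subrK; move/le_trans; apply; rewrite lerD2l ler_pM2l //.
  exact/cabs2_le/hFq.
apply: (@le_trans _ _ (\sum_(j < J) (2 * cabs2 (dpartial q (circ r (j%:R * (2 * pi / J%:R))) D) + 2 * e ^+ 2))).
  by apply: ler_sum => j _; apply: h1; rewrite ReC_circ.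
rewrite big_split /= -mulr_sumr parseval_circ // sumr_const card_ord -(mulr_natl (2 * e ^+ 2) J).
set L := (trunc_log 2 D).+1.
rewrite (mulrCA 2) -mulrDr ler_wpM2l //.
have l2 := apx_l2 (ltW eps0) epsr e0 (@apx_dpartial R eps pow2 D q hq qD) (Fg eps eps0).
have l3 : \sum_(k < L) cabs2 (q (2 ^ k)%N - g (2 ^ k)%N) * (r ^+ k) ^+ 2 <= e ^+ 2.
  apply: le_trans (l2 _ (2 ^ trunc_log 2 D)%N); last first.
    by move=> s es; rewrite -modcN opprB; exact: hFq.
  apply: le_trans (sum_pow2_le (F := fun n => cabs2 (q n - g n) *
     (n%:R `^ (- (- (ln r / ln 2)))) ^+ 2) (trunc_log 2 D) _); last first.
    by move=> n; rewrite mulr_ge0 ?cabs2_ge0 ?sqr_ge0.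
  apply: ler_sum => k _; rewrite natrX -(powR_mulrn _ (ler0n R 2)) -powRrM.
  by rewrite (mulrC k%:R) powRrM pow2_circ // powR_mulrn // ltW.
have : \sum_(k < L) cabs2 (q (2 ^ k)%N) * (r ^+ k) ^+ 2 <=
    2 * (\sum_(k < L) cabs2 (g (2 ^ k)%N) * (r ^+ k) ^+ 2) + 2 * e ^+ 2.
  apply: (@le_trans _ _ (2 * (\sum_(k < L) cabs2 (g (2 ^ k)%N) * (r ^+ k) ^+ 2) +
     2 * \sum_(k < L) cabs2 (q (2 ^ k)%N - g (2 ^ k)%N) * (r ^+ k) ^+ 2)).
    rewrite !mulr_sumr -big_split /=; apply: ler_sum => k _.
    rewrite !(mulrA 2 (cabs2 _)) -mulrDl ler_wpM2r ?sqr_ge0 //.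
    by have := cabs2_addle (g (2 ^ k)%N) (q (2 ^ k)%N - g (2 ^ k)%N); rewrite addrCA subrr addr0.
  by rewrite lerD2l ler_pM2l.
lra.
Qed.

End symbol_psi.

(** * The symbol psi on circles *)

Section psi_circle.
Variable R : realType.
Implicit Types (q c s th : R).

(* |1 + z|^2 = 2 psi_den c q / (1 + q)^2 for z = (1 - q) / (1 + q) e^(-i th), c = cos th. *)
Definition psi_den c q : R := (1 + c) + (1 - c) * q ^+ 2.

Definition psi_re c q : R := 2 * q / psi_den c q.
Definition psi_im c s q : R := (1 - q ^+ 2) * s / psi_den c q.

(** The radius is parametrised by q = (1 - r) / (1 + r), the value of Re psi - 1/2 at angle 0, so q
    itself plays the role of the distance to the critical line. *)
Lemma psi_circ q th : 0 < q < 1 -> 0 <= cos th ->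
  psi (circ ((1 - q) / (1 + q)) th) =
  (2^-1 + psi_re (cos th) q) +i* psi_im (cos th) (sin th) q.
Proof.
move=> /andP[q0 q1] c0; set r := (1 - q) / (1 + q); set c := cos th; set s := sin th.
have qp : 0 < 1 + q by lra.
have r0 : 0 < r by rewrite divr_gt0 // subr_gt0.
have s2 : s ^+ 2 = 1 - c ^+ 2 by have := cos2Dsin2 th; rewrite -/c -/s; lra.
have c1 : c <= 1 by exact: cos_le1.
have d0 : psi_den c q != 0.
  by rewrite gt_eqF // /psi_den; have := sqr_ge0 q; move: c0; rewrite -/c; nra.
have z1 : npow 2 (circ r th) = (r * c) -i* (r * s).
  have := npow_circ th 1 r0; rewrite expn1 expr1 mul1r => ->.
  by rewrite /cisN; apply/eqP; rewrite eq_complex /= !mul0r subr0 addr0 mulrN !eqxx.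
have nz : 1 + ((r * c) -i* (r * s)) != 0 :> R[i].
  apply/eqP => /(congr1 (@complex.Re R)) /= /eqP; apply/negP; rewrite gt_eqF //.
  by rewrite ltr_wpDr // mulr_ge0 // ltW.
rewrite /psi /Tmap z1.
suff -> : (1 - ((r * c) -i* (r * s))) / (1 + ((r * c) -i* (r * s))) = psi_re c q +i* psi_im c s q.
  rewrite (_ : 2^-1 = (2^-1 : R)%:C); last by rewrite rmorphV ?unitfE ?pnatr_eq0 // rmorph_nat.
  by apply/eqP; rewrite eq_complex /= add0r !eqxx.
apply: (mulIf nz); rewrite divfK //; apply/eqP; rewrite eq_complex /= ?add0r ?opprK ?sub0r.
rewrite /psi_re /psi_im /r; apply/andP; split; apply/eqP.
  apply: (@mulIf _ (psi_den c q * (1 + q))); first by rewrite mulf_neq0 // gt_eqF.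
  transitivity (((1 + q) - (1 - q) * c) * psi_den c q); first by field; rewrite gt_eqF.
  transitivity (2 * q * (1 + q + (1 - q) * c) + (1 - q ^+ 2) * (1 - q) * s ^+ 2).
    by rewrite s2 /psi_den; ring.
  by field; rewrite d0 gt_eqF.
apply: (@mulIf _ (psi_den c q * (1 + q))); first by rewrite mulf_neq0 // gt_eqF.
transitivity ((1 - q) * s * psi_den c q); first by field; rewrite gt_eqF.
transitivity (- (2 * q * (1 - q) * s) + (1 - q ^+ 2) * (1 + q + (1 - q) * c) * s).
  by rewrite /psi_den; ring.
by field; rewrite d0 gt_eqF.
Qed.

(** * Estimates for psi at angles whose cosine is at least 1/2 *)

Section real_part.
Variable c : R.
Hypothesis c12 : 2^-1 <= c <= 1.

Lemma psi_den_ge q : 3 / 2 <= psi_den c q.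
Proof. by rewrite /psi_den; have := sqr_ge0 q; case/andP: c12; nra. Qed.

Lemma psi_den_gt0 q : 0 < psi_den c q.
Proof. by apply: lt_le_trans (psi_den_ge q); rewrite divr_gt0. Qed.

Lemma psi_den_le q : 0 <= q <= 1 -> psi_den c q <= 2.
Proof.
move=> /andP[q0 q1]; rewrite /psi_den; have : q ^+ 2 <= 1 by rewrite expr_le1.
by case/andP: c12; nra.
Qed.

Lemma psi_re_ge q : 0 <= q <= 1 -> q <= psi_re c q.
Proof.
move=> h; have [q0 q1] := andP h; rewrite /psi_re ler_pdivlMr ?psi_den_gt0 //.
by rewrite mulrC ler_wpM2r // psi_den_le.
Qed.

Lemma psi_re_le q : 0 <= q -> psi_re c q <= 4 / 3 * q.
Proof.
move=> q0; rewrite /psi_re ler_pdivrMr ?psi_den_gt0 //.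
by have := psi_den_ge q; nra.
Qed.

Definition dpsi_re q : R := 2 * ((1 + c) - (1 - c) * q ^+ 2) / psi_den c q ^+ 2.

Lemma is_derive_psi_re q : is_derive q (1 : R) (psi_re c) (dpsi_re q).
Proof.
have d0 : psi_den c q != 0 by rewrite gt_eqF // psi_den_gt0.
have hd : is_derive q (1 : R) (psi_den c) ((1 - c) * (2 * q)).
  rewrite /psi_den; apply: is_derive_eq.
  by rewrite /GRing.scale /=; ring.
have hi := is_deriveV d0 hd.
have hq : is_derive q (1 : R) (fun y : R => 2 * y) 2.
  by apply: is_derive_eq; rewrite /GRing.scale /=; ring.
have := is_deriveM hq hi; rewrite /psi_re => h; apply: is_derive_eq.
by rewrite /GRing.scale /= /dpsi_re; move: d0; rewrite /psi_den => d0; field.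
Qed.

Lemma dpsi_re_bounds q : 0 <= q <= 1 -> 0 <= dpsi_re q <= 4 / 3.
Proof.
move=> h; have [q0 q1] := andP h; have [c1 c2] := andP c12.
have d0 := psi_den_gt0 q; have d1 := psi_den_ge q.
have q2 : q ^+ 2 <= 1 by rewrite expr_le1.
have d2 : 0 < psi_den c q ^+ 2 by rewrite exprn_gt0.
have q20 := sqr_ge0 q.
rewrite /dpsi_re; apply/andP; split.
  by rewrite divr_ge0 ?(ltW d2) //; nra.
rewrite ler_pdivrMr //.
apply: (@le_trans _ _ (2 * psi_den c q)); first by rewrite /psi_den; nra.
by rewrite expr2; nra.
Qed.

Lemma psi_re_homo : {in `[0, 1]%R &, {homo psi_re c : x y / x < y}}.
Proof.
move=> x y; rewrite !in_itv /= => /andP[x0 x1] /andP[y0 y1] xy; have [c1 c2] := andP c12.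
rewrite /psi_re ltr_pdivrMr ?psi_den_gt0 // mulrAC ltr_pdivlMr ?psi_den_gt0 //.
rewrite -subr_gt0 (_ : _ - _ = 2 * (y - x) * ((1 + c) - (1 - c) * (x * y))); last first.
  by rewrite /psi_den; ring.
rewrite !mulr_gt0 ?subr_gt0 //.
have : x * y <= 1 by rewrite mulr_ile1.
have : 0 <= x * y by exact: mulr_ge0.
nra.
Qed.

(** Moving by the imaginary part of psi therefore keeps [tau, tau + 1] inside [tau - 1, tau + 2]. *)
Lemma psi_im_le1 s q : `|s| <= 1 -> 0 <= q <= 1 -> `|psi_im c s q| <= 1.
Proof.
move=> s1 h; have [q0 q1] := andP h; rewrite /psi_im normrM normfV (gtr0_norm (psi_den_gt0 q)).
have q2 : q ^+ 2 <= 1 by rewrite expr_le1.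
rewrite ler_pdivrMr ?psi_den_gt0 // mul1r normrM; apply: (@le_trans _ _ 1).
  by rewrite mulr_ile1 // ger0_norm ?subr_ge0 // gerBl sqr_ge0.
by apply: le_trans (psi_den_ge q); lra.
Qed.

Lemma continuous_psi_den : continuous (psi_den c).
Proof.
move=> q; apply: cvgD; first exact: cvg_cst.
apply: cvgM; first exact: cvg_cst.
by rewrite expr2; apply: cvgM; exact: cvg_id.
Qed.

Lemma continuous_psi_re : continuous (psi_re c).
Proof.
move=> q; apply: cvgM; first by apply: cvgM; [exact: cvg_cst|exact: cvg_id].
by apply: cvgV; [rewrite gt_eqF // psi_den_gt0|exact: continuous_psi_den].
Qed.

Lemma continuous_psi_im s : continuous (psi_im c s).
Proof.
move=> q; apply: cvgM; last first.
  by apply: cvgV; [rewrite gt_eqF // psi_den_gt0|exact: continuous_psi_den].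
apply: cvgM; last exact: cvg_cst.
by apply: cvgB; [exact: cvg_cst|rewrite expr2; apply: cvgM; exact: cvg_id].
Qed.

Lemma continuous_dpsi_re : continuous dpsi_re.
Proof.
move=> q; apply: cvgM; last first.
  apply: cvgV; first by rewrite gt_eqF // exprn_gt0 // psi_den_gt0.
  by rewrite expr2; apply: cvgM; exact: continuous_psi_den.
apply: cvgM; first exact: cvg_cst.
apply: cvgB; first exact: cvg_cst.
apply: cvgM; first exact: cvg_cst.
by rewrite expr2; apply: cvgM; exact: cvg_id.
Qed.

End real_part.
End psi_circle.

(** * Substitution inequalities and decay of the circular weights *)

Section substitution.
Variable R : realType.
Local Notation mu := (@lebesgue_measure R).

Lemma integral_subst_le (F dF G : R -> R) (a b C : R) : a < b ->
  {in `[a, b]%R &, {homo F : x y / x < y}} ->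
  (forall x, is_derive x (1 : R) F (dF x)) -> continuous dF ->
  (forall x, a <= x <= b -> 0 <= dF x <= C) -> (forall y, 0 <= G y) ->
  {within `[F a, F b], continuous G} -> measurable_fun setT (fun x => G (F x)) ->
  (\int[mu]_(y in `[(F a)%R, (F b)%R]) (G y)%:E <=
   C%:E * \int[mu]_(x in `[a, b]) (G (F x))%:E)%E.
Proof.
move=> ab hF dFE cdF bF G0 cG mGF.
have dE : F^`() = dF.
  by apply/funext => x; rewrite derive1E; have := dFE x => h; apply: derive_val.
have cF : continuous F.
  by move=> x; apply/differentiable_continuous/derivable1_diffP; have := dFE x => h; apply: ex_derive.
have C0 : 0 <= C.
  have aa : a <= a <= b by rewrite lexx ltW.
  by have /andP[p1 p2] := bF a aa; exact: le_trans p2.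
have S := @integration_by_substitution_increasing R F G a b (ltW ab) hF.
rewrite {}S ?dE //; first last.
- split.
  + by move=> x _; have := dFE x => h; apply: ex_derive.
  + by apply: cvg_at_right_filter; exact: cF.
  + by apply: cvg_at_left_filter; exact: cF.
- by apply/cvg_ex; exists (dF b); apply: cvg_at_left_filter; exact: cdF.
- by apply/cvg_ex; exists (dF a); apply: cvg_at_right_filter; exact: cdF.
have mG (A : set (measurableTypeR R)) : measurable_fun A (fun x : R => (G (F x))%:E).
  by apply/measurable_EFinP; apply: measurable_funTS.
have G0' (x : measurableTypeR R) : `[a, b]%classic x -> (0 <= (G (F x))%:E)%E.
  by move=> _; rewrite lee_fin.
rewrite -(@ge0_integralZl_EFin _ _ _ mu _ (measurable_itv `[a, b]%R) _ G0' (mG _) C C0).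
have hb (x : R) : x \in `[a, b]%R -> 0 <= dF x <= C by rewrite in_itv /= => /bF.
apply: ge0_le_integral.
- exact: measurable_itv.
- by move=> x /= /hb /andP[d0 _]; rewrite lee_fin; apply: mulr_ge0 => //; exact: G0.
- apply/measurable_EFinP; apply: measurable_funTS; apply: measurable_funM => //.
  exact: continuous_measurable_fun.
- exact: measurable_funeM.
- by move=> x /= /hb /andP[_ dC]; rewrite -EFinM lee_fin (_ : _ x = dF x * G (F x)) ?ler_wpM2r // mulrC.
Qed.

Lemma integral_shift_le (G : R -> R) (a b t : R) : a < b -> continuous G ->
  (forall y, 0 <= G y) ->
  (\int[mu]_(y in `[a, b]) (G y)%:E <= \int[mu]_(x in `[(a - t)%R, (b - t)%R]) (G (x + t))%:E)%E.
Proof.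
move=> ab cG G0; have h : a - t < b - t by rewrite ltrD2r.
have sub := @integral_subst_le (fun x => x + t) (fun=> 1) G (a - t) (b - t) 1 h.
rewrite /= !subrK mul1e in sub; apply: sub => //.
- by move=> x y _ _; rewrite ltrD2r.
- by move=> x; apply: is_derive_eq; rewrite addr0.
- by move=> x; exact: cvg_cst.
- by rewrite ler01 lexx.
- exact: continuous_subspaceT.
- apply: continuous_measurable_fun => x; apply: continuous_comp; last exact: cG.
  by apply: cvgD; [exact: cvg_id|exact: cvg_cst].
Qed.

(** From (1 - q) / (1 + q) <= 1 - q <= e^-q the left side is at most e^(-2 k q), and e^y >= 1 + y
    with y = 2 k q / (beta + 1) converts this into a power. The exponent beta + 1 is chosen so that
    the product with q^(beta - 1) has an explicit primitive. *)
Lemma harnack_weight_le (beta : R) : 0 < beta -> exists2 C : R, 0 < C &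
  forall (q : R) k, 0 < q <= 2^-1 ->
  (((1 - q) / (1 + q)) ^+ k) ^+ 2 <= C * (1 + k.+1%:R * q) `^ (- (beta + 1)).
Proof.
move=> b0; have b1 : 0 < beta + 1 by rewrite ltr_wpDl ?(ltW b0).
(* For q <= 1/2 one has 1 + (k + 1) q <= 3/2 + k q, and k q = y (beta + 1) / 2. *)
pose C0 := 3 / 2 + (beta + 1) / 2; have C00 : 0 < C0 by rewrite /C0; lra.
exists (C0 `^ (beta + 1)); first exact: powR_gt0.
move=> q k /andP[q0 q1]; set x := 1 + k.+1%:R * q.
have x0 : 0 < x by rewrite ltr_pwDl // mulr_ge0 // ltW.
set y := 2 * k%:R * q / (beta + 1).
have y0 : 0 <= y by rewrite divr_ge0 ?(ltW b1) // !mulr_ge0 // ltW.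
have xy : x <= C0 * (1 + y).
  have yb : y * (beta + 1) = 2 * k%:R * q by rewrite divfK // gt_eqF.
  rewrite /x -natr1 /C0; nra.
have r1 : ((1 - q) / (1 + q)) ^+ k ^+ 2 <= expR (- (y * (beta + 1))).
  rewrite -exprM /y divfK ?gt_eqF // (_ : - (2 * k%:R * q) = (k * 2)%:R * (- q)); last first.
    by rewrite natrM; ring.
  rewrite expRM_natl; apply: lerXn2r; rewrite ?nnegrE ?expR_ge0 //.
    by rewrite divr_ge0 //; lra.
  apply: (@le_trans _ _ (1 - q)); last by have := expR_ge1Dx (- q).
  by rewrite ler_pdivrMr; nra.
apply: (le_trans r1); rewrite powRN ler_pdivlMr ?powR_gt0 // expRN.
rewrite mulrC ler_pdivrMr ?expR_gt0 //.
have -> : expR (y * (beta + 1)) = expR y `^ (beta + 1).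
  by rewrite /powR gt_eqF ?expR_gt0 // expRK mulrC.
rewrite -powRM ?expR_ge0 ?(ltW C00) //.
apply: ge0_ler_powR; rewrite ?nnegrE ?(ltW b1) ?(ltW x0) ?mulr_ge0 ?expR_ge0 ?(ltW C00) //.
by apply: (le_trans xy); rewrite ler_wpM2l ?(ltW C00) // expR_ge1Dx.
Qed.

End substitution.

(** * Integrals of the circular weights *)

Section weights.
Variable R : realType.
Local Notation mu := (@lebesgue_measure R).

Lemma continuous_powRl (p x : R) : 0 < x -> {for x, continuous (fun y : R => y `^ p)}.
Proof.
move=> x0; apply/differentiable_continuous/derivable1_diffP.
by have h := is_derive1_powR p x0; apply: ex_derive.
Qed.

Lemma continuous_mobius (m x : R) : 0 <= m -> 0 < x ->
  {for x, continuous (fun y : R => 1 + m * y)}.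
Proof.
move=> m0 x0; apply: cvgD; first exact: cvg_cst.
by apply: cvgM; [exact: cvg_cst|exact: cvg_id].
Qed.

(** The integrand is the derivative of (q / (1 + m q))^beta / beta, and q / (1 + m q) <= 1 / m. *)
Lemma integral_powR_mobius (beta m q1 : R) : 0 < beta -> 0 < m -> 0 < q1 < 2^-1 ->
  (\int[mu]_(q in `[q1, 2^-1%R]) (q `^ (beta - 1) * (1 + m * q) `^ (- (beta + 1)))%:E
   <= (m `^ (- beta) / beta)%:E)%E.
Proof.
move=> b0 m0 /andP[q0 q2].
have den (q : R) : 0 < q -> 0 < 1 + m * q by move=> h; rewrite ltr_pwDl // mulr_ge0 // ltW.
pose f (q : R) := q `^ (beta - 1) * (1 + m * q) `^ (- (beta + 1)).
pose phi (q : R) := q * (1 + m * q)^-1.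
pose F (q : R) := beta^-1 * phi q `^ beta.
have phi0 q : 0 < q -> 0 < phi q by move=> h; rewrite divr_gt0 // den.
have dphi (q : R) : 0 < q -> is_derive q (1 : R) phi ((1 + m * q) ^- 2).
  move=> h; have hd : is_derive q (1 : R) (fun y : R => 1 + m * y) m.
    by apply: is_derive_eq; rewrite /GRing.scale /=; ring.
  have dn : 1 + m * q != 0 by rewrite gt_eqF // den.
  have := is_deriveM (is_derive_id q 1) (@is_deriveV R (fun y : R => 1 + m * y) q m 1 dn hd) => h'; apply: is_derive_eq.
  by rewrite /GRing.scale /=; field.
have dF (q : R) : 0 < q -> is_derive q (1 : R) F (f q).
  move=> h; have h1 := is_derive1_powR beta (phi0 q h).
  have h2 := is_derive1_comp h1 (dphi q h).
  have := is_deriveZ beta^-1 h2 => h3; apply: is_derive_eq.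
  rewrite /GRing.scale /= /f /phi powRM ?invr_ge0 ?(ltW h) ?(ltW (den q h)) //.
  rewrite -[(1 + m * q)^-1]powR_inv1 ?(ltW (den q h)) // -powRrM.
  have -> : (1 + m * q) ^- 2 = (1 + m * q) `^ (- 2).
    by rewrite powRN powR_mulrn // ltW // den.
  have -> : (1 + m * q) `^ (- (beta + 1)) = (1 + m * q) `^ (-1 * (beta - 1)) * (1 + m * q) `^ (- 2).
    rewrite -powRD; last by apply/implyP => _; rewrite gt_eqF // den.
    by congr powR; ring.
  by field; rewrite gt_eqF.
have pos (q : R) : q \in `[q1, 2^-1]%R -> 0 < q.
  by rewrite in_itv /= => /andP[h _]; exact: lt_le_trans h.
have cF (q : R) : 0 < q -> {for q, continuous F}.
  by move=> /dF h; apply/differentiable_continuous/derivable1_diffP; apply: ex_derive.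
have cf (q : R) : 0 < q -> {for q, continuous f}.
  move=> h; apply: cvgM; first exact: continuous_powRl.
  apply: (@continuous_comp _ _ _ (fun y : R => 1 + m * y) (fun y : R => y `^ (- (beta + 1)))).
    exact: continuous_mobius (ltW m0) h.
  exact/continuous_powRl/den.
rewrite (@continuous_FTC2 _ f F) //.
- rewrite -EFinB lee_fin; apply: (@le_trans _ _ (F 2^-1)).
    by rewrite gerBl /F mulr_ge0 ?powR_ge0 // invr_ge0 ltW.
  rewrite /F mulrC ler_wpM2r ?invr_ge0 ?(ltW b0) //.
  have -> : m `^ (- beta) = m^-1 `^ beta.
    by rewrite -[m^-1]powR_inv1 ?(ltW m0) // -powRrM mulN1r.
  apply: ge0_ler_powR; rewrite ?nnegrE ?(ltW b0) ?invr_ge0 ?(ltW m0) //.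
    by rewrite ltW // phi0 // invr_gt0.
  have d2 : 0 < 1 + m * 2^-1 by rewrite den // invr_gt0.
  by rewrite /phi ler_pdivrMr // ler_pdivlMl // mulrC ler_wpDl.
- apply: continuous_in_subspaceT => x /[!inE] /= hx; apply: cf; exact: pos.
- split.
  + move=> x; rewrite in_itv /= => /andP[h _]; have x0 : 0 < x by exact: lt_trans h.
    by have := dF x x0 => h'; apply: ex_derive.
  + by apply: cvg_at_right_filter; exact: cF.
  + by apply: cvg_at_left_filter; apply: cF; rewrite invr_gt0.
- move=> x; rewrite in_itv /= => /andP[h _]; have x0 : 0 < x by exact: lt_trans h.
  by rewrite derive1E; have := dF x x0 => h'; apply: derive_val.
Qed.

Lemma measurable_circ_radius (q1 : R) k : 0 < q1 ->
  measurable_fun (`[q1, 2^-1] : set (measurableTypeR R))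
    (fun q : R => (((1 - q) / (1 + q)) ^+ k) ^+ 2).
Proof.
move=> q0; apply: (@eq_measurable_fun _ _ _ _ _
    (fun q : R => (((1 - q) * (1 + q) `^ (-1)) ^+ k) ^+ 2)).
  move=> q; rewrite inE /= in_itv /= => /andP[h _].
  by rewrite powR_inv1 // addr_ge0 // (le_trans _ h) // ltW.
apply: measurable_funTS; do 2!apply: measurable_funX; apply: measurable_funM.
  exact: measurable_funB.
by apply: (measurableT_comp (measurable_powR _)); exact: measurable_funD.
Qed.

(** The k-th power of 2^-s thus receives the weight (k + 1)^-beta, which is that of n = 2^k in the
    target space. *)
Lemma integral_circ_weight (beta : R) : 0 < beta -> exists2 C : R, 0 < C &
  forall (q1 : R) k, 0 < q1 < 2^-1 ->
  (\int[mu]_(q in `[q1, 2^-1%R]) ((((1 - q) / (1 + q)) ^+ k) ^+ 2 * q `^ (beta - 1))%:E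
   <= (C * k.+1%:R `^ (- beta))%:E)%E.
Proof.
move=> b0; have [C C0 hC] := harnack_weight_le b0.
exists (C / beta); first by rewrite divr_gt0.
move=> q1 k hq; have [q0 q2] := andP hq; have m0 : 0 < k.+1%:R :> R by [].
rewrite mulrAC -mulrA EFinM.
apply: le_trans (lee_wpmul2l _ (integral_powR_mobius b0 m0 hq)); last by rewrite lee_fin ltW.
have mp (p : R) : measurable_fun setT (fun q : R => q `^ p) by exact: measurable_powR.
have mI (h : R -> R) (A : set (measurableTypeR R)) : measurable_fun setT h ->
    measurable_fun A (fun q => (h q)%:E).
  by move=> mh; apply/measurable_EFinP; apply: measurable_funTS.
have mm : measurable_fun setT (fun q : R => q `^ (beta - 1) * (1 + k.+1%:R * q) `^ (- (beta + 1))).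
  apply: measurable_funM => //; apply: (measurableT_comp (measurable_powR _)).
  by apply: measurable_funD => //; apply: measurable_funM.
rewrite -ge0_integralZl_EFin //; first last.
- exact: ltW.
- exact: (mI _ _ mm).
- by move=> q _; rewrite lee_fin mulr_ge0 ?powR_ge0.
apply: ge0_le_integral => //.
- by move=> q _; rewrite lee_fin mulr_ge0 ?powR_ge0 ?sqr_ge0.
- apply/measurable_EFinP; apply: measurable_funM; first exact: measurable_circ_radius.
  exact: measurable_funTS.
- by apply: measurable_funeM; exact: (mI _ _ mm).
move=> q /=; rewrite in_itv /= => /andP[h1 h2]; rewrite -EFinM lee_fin mulrCA mulrC.
rewrite ler_wpM2l ?powR_ge0 //; apply: hC; rewrite h2 andbT; exact: lt_le_trans h1.
Qed.

End weights.

(** * The Carleson condition from boundedness of one operator *)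

Section energy.
Variable R : realType.
Local Notation mu := (@lebesgue_measure R).
Implicit Types (a g : nat -> R[i]) (alpha beta : R).

Lemma dser_to_trunc a N w z : dser_to (trunc N a) w z -> z = dpartial a w N.
Proof.
move/ccvgP => h; apply/eqP; rewrite eq_sym -subr_eq0; apply/eqP/modc_eq0.
apply/ler_addgt0Pr => e /h[J0 hJ]; rewrite add0r.
by have := hJ (maxn J0 N) (leq_maxl _ _); rewrite dpartial_trunc ?leq_maxr.
Qed.

Definition psi_bound alpha beta (K : R) : Prop := forall a N,
  exists2 g, unif_apx pow2 (fun s => dpartial a (psi s) N) g &
    forall L, \sum_(k < L.+1) cabs2 (g (2 ^ k)%N) / (k.+1%:R : R) `^ beta <= K * wsum alpha a N.

(** The image of P under the operator and the expansion of P o psi in powers of 2 represent the same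
    function on Re s > 1, so their coefficients agree and the norm bound transfers. *)
Lemma psi_bound_of_comp_bounded alpha beta : 0 <= beta -> comp_bounded alpha beta (@psi R) ->
  exists2 K, 0 <= K & psi_bound alpha beta K.
Proof.
move=> be0 [K hK]; exists `|K|; first exact: normr_ge0.
move=> a N; have aD : inD alpha (trunc N a) by rewrite /inD Dnorm2_trunc ltry.
have [b [bD [bK hb]]] := hK _ aD; rewrite Dnorm2_trunc -EFinM in bK.
have hF s : 2^-1 < ReC s -> dser_to b s (dpartial a (psi s) N).
  by move=> /hb[z [/dser_to_trunc ->]].
have ub := inD_apx be0 bD hF; have [g hg] := dpartial_psi_apx a N; exists g => // L.
have ug : apx 1 predT (fun s => dpartial a (psi s) N) g.
  move=> e e0 M; have [D [q [_ q2 q3 q4]]] := hg 1 ltr01 e e0 M.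
  by exists D, q; split.
rewrite (eq_bigr (fun k : 'I_L.+1 => cabs2 (b (2 ^ k)%N) / (k.+1%:R : R) `^ beta)); last first.
  by move=> k _; rewrite (apx_unique ler01 ug ub) // expn_gt0.
apply: (le_trans (wsum_pow2_le _ _ _)); rewrite -lee_fin.
apply: (le_trans (wsum_le_Dnorm2 _ _ _)); apply: (le_trans bK).
by rewrite lee_fin ler_wpM2r ?wsum_ge0 // ler_norm.
Qed.

(** The value cos(pi / 3) = 1/2 comes from the triple angle formula: cos pi = -1 becomes (c + 1) (2
    c - 1)^2 = 0 with c > 0. *)
Lemma cos_ge_half (x : R) : 0 <= x <= pi / 3 -> 2^-1 <= cos x.
Proof.
have P := pi_gt0 R; pose c : R := cos (pi / 3).
have c0 : 0 < c by apply: cos_gt0_pihalf; apply/andP; split; lra.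
have c3 : cos (pi / 3 + (pi / 3 + pi / 3)) = -1 :> R.
  by rewrite (_ : pi / 3 + (pi / 3 + pi / 3) = pi) ?cospi //; field.
have cE : c = 2^-1.
  have s2 : sin (pi / 3) * sin (pi / 3) = 1 - c * c.
    by have := cos2Dsin2 (pi / 3 : R); rewrite !expr2 -/c; lra.
  move: c3; rewrite cosD cosD sinD -/c => c3.
  have e : (c + 1) * (2 * c - 1) ^+ 2 = 0.
    transitivity (4 * c ^+ 3 - 3 * c + 1); first by ring.
    transitivity (c * (c * c - sin (pi / 3) * sin (pi / 3)) -
      sin (pi / 3) * (sin (pi / 3) * c + c * sin (pi / 3)) + 1); last by rewrite c3; ring.
    transitivity (c * (c * c - sin (pi / 3) * sin (pi / 3)) -
      2 * c * (sin (pi / 3) * sin (pi / 3)) + 1); last by ring.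
    by rewrite s2; ring.
  move/eqP: e; rewrite mulf_eq0 gt_eqF ?addr_gt0 //= sqrf_eq0 subr_eq0 => /eqP e.
  by lra.
move=> /andP[x0 x3]; by rewrite -cE /c leNgt ltr_cos ?in_itv /= -?leNgt //; apply/andP; split; lra.
Qed.

(** Among 6 L equally spaced angles the first L lie in [0, pi / 3]; this is the origin of the factor
    6. *)
Lemma cos_sample L (j : 'I_L) : 2^-1 <= cos (j%:R * (2 * pi / (6 * L)%:R) : R) <= 1.
Proof.
have P := pi_gt0 R; rewrite cos_le1 andbT; apply: cos_ge_half; rewrite mulrA natrM.
have L0 : (0 : R) < L%:R by rewrite ltr0n (leq_trans _ (ltn_ord j)).
have jL : (j%:R : R) <= L%:R by rewrite ler_nat ltnW.
have L6 : 0 < 6 * L%:R :> R by rewrite mulr_gt0.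
apply/andP; split; first by rewrite divr_ge0 ?(ltW L6) // mulr_ge0 // mulr_ge0 // ltW.
by rewrite ler_pdivrMr //; nra.
Qed.

Definition circ_energy a N beta c s (q : R) : R :=
  cabs2 (dpartial a ((2^-1 + psi_re c q) +i* psi_im c s q) N) * q `^ (beta - 1).

Lemma circ_energy_ge0 a N beta c s q : 0 <= circ_energy a N beta c s q.
Proof. by rewrite mulr_ge0 ?cabs2_ge0 ?powR_ge0. Qed.

Lemma measurable_circ_energy a N beta c s : 2^-1 <= c <= 1 ->
  measurable_fun setT (circ_energy a N beta c s).
Proof.
move=> c12; apply: measurable_funM; last exact: measurable_powR.
apply: (measurableT_comp (measurable_cabs2_dpartial a N)
  (g := fun q : R => (2^-1 + psi_re c q, psi_im c s q))).
apply: measurable_fun_pair.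
  by apply: measurable_funD => //; apply: continuous_measurable_fun; exact: continuous_psi_re.
by apply: continuous_measurable_fun; exact: continuous_psi_im.
Qed.

Lemma ln_circ_radius_le (q1 q : R) : 0 < q1 -> q1 <= q -> q < 1 ->
  - (ln ((1 - q1) / (1 + q1)) / ln 2) <= - (ln ((1 - q) / (1 + q)) / ln 2).
Proof.
move=> q0 qq q1'; have l2 : 0 < ln (2 : R) by rewrite ln_gt0 // ltr1n.
rewrite lerN2 ler_pM2r ?invr_gt0 // ler_ln ?posrE ?divr_gt0 //; try lra.
by rewrite ler_pdivrMr; [rewrite mulrAC ler_pdivlMr; nra|lra].
Qed.

(** All 6 L samples on a circle are controlled by discrete Parseval; only the L samples with angle
    at most pi / 3 are kept, the others being nonnegative. Integrating in q replaces r^(2 k) by (k +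
    1)^-beta. The approximation error e is multiplied by q^(beta - 1) <= 1 / q1, harmless since e is
    chosen after q1. *)
Lemma sum_circ_energy_le beta : 0 < beta -> exists2 C : R, 0 < C & forall a g N q1 e eps D q Y,
  0 < q1 < 2^-1 -> 0 <= e -> 0 < eps -> eps < - (ln ((1 - q1) / (1 + q1)) / ln 2) ->
  unif_apx pow2 (fun s => dpartial a (psi s) N) g ->
  (forall L, \sum_(k < L.+1) cabs2 (g (2 ^ k)%N) / (k.+1%:R : R) `^ beta <= Y) ->
  (forall n, ~~ pow2 n -> q n = 0) -> (forall n, (D < n)%N -> q n = 0) -> (0 < D)%N ->
  (forall s, eps < ReC s -> modc (dpartial a (psi s) N - dpartial q s D) <= e) ->
  let L := (trunc_log 2 D).+1 in let J := (6 * L)%N in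
  let th (j : nat) : R := j%:R * (2 * pi / J%:R) in
  is_true (\sum_(j < L) \int[mu]_(x in `[q1, 2^-1%R])
     (circ_energy a N beta (cos (th j)) (sin (th j)) x)%:E <=
   (J%:R * (4 * C * Y + 6 * e ^+ 2 / q1))%:E)%E.
Proof.
move=> b0; have [C C0 hC] := integral_circ_weight b0; exists C => //.
move=> a g N q1 e eps D q Y q12 e0 eps0 epsr hg hY hq hqD D0 hFq L J th.
have [q0 q2] := andP q12.
have J0 : (0 : R) < J%:R by rewrite ltr0n muln_gt0.
have c12 (j : 'I_L) : 2^-1 <= cos (th j) <= 1 by exact: cos_sample.
have mI (h : R -> R) (A : set (measurableTypeR R)) : measurable_fun setT h ->
    measurable_fun A (fun q => (h q)%:E).
  by move=> mh; apply/measurable_EFinP; apply: measurable_funTS.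
have mE (j : 'I_L) (A : set (measurableTypeR R)) :
    measurable_fun A (fun x : R => (circ_energy a N beta (cos (th j)) (sin (th j)) x)%:E).
  by apply: mI; exact: measurable_circ_energy.
have E0 (j : 'I_L) (x : R) : (0 <= (circ_energy a N beta (cos (th j)) (sin (th j)) x)%:E)%E.
  by rewrite lee_fin circ_energy_ge0.
pose I : set (measurableTypeR R) := `[q1, 2^-1].
have mI' : measurable I by exact: measurable_itv.
rewrite -(@ge0_integral_sum _ _ _ mu I mI' 'I_L
  (fun j x => (circ_energy a N beta (cos (th j)) (sin (th j)) x)%:E) (fun j => mE j I)
  (fun j x _ => E0 j x)).
pose w k (x : R) := (((1 - x) / (1 + x)) ^+ k) ^+ 2 * x `^ (beta - 1).
have w0 k x : 0 <= w k x by rewrite mulr_ge0 ?sqr_ge0 ?powR_ge0.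
have mw k : measurable_fun I (fun x => (w k x)%:E).
  apply/measurable_EFinP; apply: measurable_funM; first exact: measurable_circ_radius.
  exact: measurable_funTS.
pose co k := 4 * J%:R * cabs2 (g (2 ^ k)%N).
have co0 k : 0 <= co k by rewrite mulr_ge0 ?cabs2_ge0 // mulr_ge0 // ltW.
pose c1 := 6 * J%:R * e ^+ 2 / q1.
have c10 : 0 <= c1 by rewrite divr_ge0 ?(ltW q0) // mulr_ge0 ?sqr_ge0 // mulr_ge0 // ltW.
have pw x : I x -> (\sum_(j < L) (circ_energy a N beta (cos (th j)) (sin (th j)) x)%:E <=
    \sum_(k < L) (co k)%:E * (w k x)%:E + c1%:E)%E.
  rewrite /I /= in_itv /= => /andP[x1 x2].
  have x0 : 0 < x by exact: lt_le_trans x1.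
  have x01 : 0 < x < 1 by rewrite x0 /=; lra.
  have r0 : 0 < (1 - x) / (1 + x) by rewrite divr_gt0; lra.
  have epsx : eps < - (ln ((1 - x) / (1 + x)) / ln 2).
    by apply: (lt_le_trans epsr); apply: ln_circ_radius_le; lra.
  have LJ : (L <= J)%N by rewrite leq_pmull.
  have S := sampling_le r0 e0 hg eps0 epsx hq hqD D0 LJ hFq.
  rewrite -/L -/J in S.
  rewrite sumEFin; under [X in (_ <= X + _)%E]eq_bigr do rewrite -EFinM.
  rewrite sumEFin -EFinD lee_fin.
  apply: (@le_trans _ _ ((\sum_(j < J) cabs2 (dpartial a (psi (circ ((1 - x) / (1 + x)) (th j))) N))
      * x `^ (beta - 1))).
    rewrite mulr_suml (big_ord_widen J (fun j => circ_energy a N beta (cos (th j)) (sin (th j)) x) LJ).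
    rewrite big_mkcond; apply: ler_sum => j _; case: ifP => [jL|_].
      by have /andP[c0 _] := c12 (Ordinal jL); rewrite psi_circ //; apply: le_trans c0; rewrite invr_ge0.
    by rewrite mulr_ge0 ?cabs2_ge0 ?powR_ge0.
  apply: (le_trans (ler_wpM2r (powR_ge0 _ _) S)).
  rewrite mulrDr mulrDl; apply: lerD.
    rewrite mulrA !mulr_sumr mulr_suml le_eqVlt; apply/orP; left; apply/eqP.
    by apply: eq_bigr => k _; rewrite /co /w; ring.
  have xw : x `^ (beta - 1) <= q1^-1.
    by apply: powR_pred_le => //; apply/andP; split=> //; lra.
  rewrite /c1 (_ : 6 * J%:R * e ^+ 2 / q1 = J%:R * (6 * e ^+ 2) / q1); last by ring.
  by rewrite ler_wpM2l // !mulr_ge0 ?sqr_ge0 // ltW.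
apply: (@le_trans _ _ (\int[mu]_(x in I) (\sum_(k < L) (co k)%:E * (w k x)%:E + c1%:E))%E).
  apply: ge0_le_integral => //.
  - by move=> x _; apply: sume_ge0 => j _; exact: E0.
  - by apply: emeasurable_sum => j; exact: mE.
  - apply: emeasurable_funD; last exact: measurable_cst.
    by apply: emeasurable_sum => k; apply: measurable_funeM; exact: mw.
have cw0 k (x : R) : (0 <= (co k)%:E * (w k x)%:E)%E by rewrite mule_ge0 ?lee_fin.
have mcw k : measurable_fun I (fun x => (co k)%:E * (w k x)%:E)%E.
  by apply: measurable_funeM; exact: mw.
rewrite ge0_integralD //; first last.
- by apply: emeasurable_sum => k; exact: mcw.
- by move=> x _; apply: sume_ge0 => k _; exact: cw0.
rewrite (_ : J%:R * (4 * C * Y + 6 * e ^+ 2 / q1) = 4 * J%:R * C * Y + c1); last first.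
  by rewrite /c1; ring.
rewrite EFinD; apply: leeD; last first.
  rewrite [leLHS](_ : _ = c1%:E * mu I)%E; last by exact: integral_cst.
  rewrite /I [X in (_ * X)%E](lebesgue_measure_itv `[q1, 2^-1]%R) /=.
  rewrite lte_fin q2 -EFinD -EFinM lee_fin ler_piMr //; lra.
rewrite (@ge0_integral_sum _ _ _ mu I mI' 'I_L (fun k x => (co k)%:E * (w k x)%:E)%E
  (fun k => mcw k) (fun k x _ => cw0 k x)).
apply: (@le_trans _ _ (\sum_(k < L) (co k * (C * k.+1%:R `^ (- beta)))%:E)%E).
  apply: lee_sum => k _; rewrite ge0_integralZl_EFin //; last by move=> x _; rewrite lee_fin.
  by rewrite [leRHS]EFinM lee_wpmul2l ?lee_fin //; exact: hC.
rewrite sumEFin lee_fin.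
apply: (@le_trans _ _ (4 * J%:R * C * \sum_(k < L) cabs2 (g (2 ^ k)%N) / (k.+1%:R : R) `^ beta)).
  rewrite mulr_sumr le_eqVlt; apply/orP; left; apply/eqP; apply: eq_bigr => k _.
  by rewrite /co powRN; ring.
by rewrite ler_wpM2l ?hY // mulr_ge0 ?(ltW C0) // mulr_ge0 // ltW.
Qed.

End energy.

(** * Change of variables from circles to Carleson squares *)

Section exchange.
Variable R : realType.
Local Notation mu := (@lebesgue_measure R).
Implicit Types (I J : set (measurableTypeR R)) (a : nat -> R[i]).

Lemma integral_rect_mkcond I J (h : R -> R -> R) :
  (\int[mu]_(x in I) \int[mu]_(y in J) (h x y)%:E =
   \int[mu]_x \int[mu]_y (if (x \in I) && (y \in J) then h x y else 0)%:E)%E.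
Proof.
rewrite integral_mkcond; apply: eq_integral => x _; rewrite patchE.
case: ifPn => Ix /=.
  rewrite integral_mkcond; apply: eq_integral => y _; rewrite patchE.
  by case: ifP.
by rewrite integral0.
Qed.

Lemma integral_rect_exchange I J (f : R * R -> R) : measurable I -> measurable J ->
  measurable_fun setT f -> (forall p, 0 <= f p) ->
  (\int[mu]_(x in I) \int[mu]_(y in J) (f (x, y))%:E =
   \int[mu]_(y in J) \int[mu]_(x in I) (f (x, y))%:E)%E.
Proof.
move=> mI mJ mf f0; rewrite (integral_rect_mkcond I J (fun x y => f (x, y))).
rewrite (integral_rect_mkcond J I (fun y x => f (x, y))).
pose F (p : R * R) : \bar R := ((EFin \o f) \_ (I `*` J)) p.
have FE x y : F (x, y) = (if (x \in I) && (y \in J) then f (x, y) else 0)%:E.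
  rewrite /F patchE (_ : ((x, y) \in I `*` J) = (x \in I) && (y \in J)).
    by case: ifP.
  by apply/idP/andP; rewrite !inE.
have mF : measurable_fun setT F.
  apply/(measurable_restrict _ _ measurableT) => //; first exact: measurableX.
  by rewrite setTI; apply/measurable_EFinP; apply: measurable_funTS.
have F0 p : (0 <= F p)%E by rewrite /F patchE; case: ifP => // _; rewrite lee_fin.
have := @fubini_tonelli _ _ _ _ _ mu mu F mF F0.
under eq_integral => x _ do under eq_integral => y _ do rewrite FE.
under [in RHS]eq_integral => y _ do under eq_integral => x _ do rewrite FE.
move=> ->; apply: eq_integral => y _; apply: eq_integral => x _.
by rewrite andbC.
Qed.

Lemma continuous_weighted a N beta t (x : R) : 2^-1 < x -> {for x, continuous (fun x : R =>
  cabs2 (dpartial a (x +i* t) N) * (x - 2^-1) `^ (beta - 1))}.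
Proof.
move=> x2; apply: cvgM.
  by apply: continuous_cabs2_dpartial_path; [exact: cvg_id|exact: cvg_cst].
apply: (@continuous_comp _ _ _ (fun x : R => x - 2^-1) (fun y : R => y `^ (beta - 1))).
  by apply: cvgB; [exact: cvg_id|exact: cvg_cst].
by apply: continuous_powRl; rewrite subr_gt0.
Qed.

Lemma circ_energy_vtwist a N beta c s g q : circ_energy (vtwist a g) N beta c s q =
  cabs2 (dpartial a ((2^-1 + psi_re c q) +i* (g + psi_im c s q)) N) * q `^ (beta - 1).
Proof. by rewrite /circ_energy dpartial_vtwist. Qed.

Lemma measurable_circ_energy_pair a N beta c s : 2^-1 <= c <= 1 ->
  measurable_fun setT (fun p : R * R => circ_energy (vtwist a p.1) N beta c s p.2).
Proof.
move=> c12; under eq_fun do rewrite circ_energy_vtwist.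
have m1 : measurable_fun setT (fun p : R * R => p.1) by exact: measurable_fst.
have m2 : measurable_fun setT (fun p : R * R => p.2) by exact: measurable_snd.
apply: measurable_funM; last exact: (measurableT_comp (measurable_powR _)).
apply: (measurableT_comp (measurable_cabs2_dpartial a N)
  (g := fun p : R * R => (2^-1 + psi_re c p.2, p.1 + psi_im c s p.2))).
apply: measurable_fun_pair; apply: measurable_funD => //.
  by apply: (measurableT_comp _ m2); apply: continuous_measurable_fun; exact: continuous_psi_re.
by apply: (measurableT_comp _ m2); apply: continuous_measurable_fun; exact: continuous_psi_im.
Qed.

Lemma powR_pred_comparable (beta q x : R) : 0 < beta -> 0 < q -> q <= x <= 2 * q ->
  x `^ (beta - 1) <= 2 `^ beta * q `^ (beta - 1).
Proof.
move=> b0 q0 /andP[qx xq]; have x0 : 0 < x by exact: lt_le_trans qx.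
rewrite !powR_pred // mulrA -powRM ?(ltW q0) //.
apply: ler_pM; rewrite ?powR_ge0 ?invr_ge0 ?(ltW x0) //.
  by apply: ge0_ler_powR; rewrite ?nnegrE ?(ltW b0) ?(ltW x0) ?mulr_ge0 ?(ltW q0).
by rewrite lef_pV2.
Qed.

(** At a fixed angle the variables (q, g) map to x = 1/2 + [psi_re] and t = g + [psi_im]. For fixed
    q this is a translation in g, of length at most 1; for fixed t it is a substitution in q with
    derivative at most 4/3. Since q <= [psi_re] <= 4 q / 3, the image of [q1, 1/2] covers
    [1/2 + 4 q1 / 3, 1], and the two weights are comparable up to 2^beta. *)
Lemma circ_energy_lower a N beta c s q1 tau : 0 < beta -> 2^-1 <= c <= 1 -> `|s| <= 1 ->
  0 < q1 < 4^-1 ->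
  (\int[mu]_(t in `[tau, (tau + 1)%R]) \int[mu]_(x in `[(2^-1 + 4 / 3 * q1)%R, 1%R])
      (cabs2 (dpartial a (x +i* t) N) * (x - 2^-1) `^ (beta - 1))%:E <=
   (4 / 3 * 2 `^ beta)%:E * \int[mu]_(g in `[(tau - 1)%R, (tau + 2)%R])
      \int[mu]_(q in `[q1, 2^-1%R]) (circ_energy (vtwist a g) N beta c s q)%:E)%E.
Proof.
move=> b0 c12 s1 /andP[q0 q4].
pose I : set (measurableTypeR R) := `[q1, 2^-1].
pose T1 : set (measurableTypeR R) := `[tau, tau + 1].
pose T3 : set (measurableTypeR R) := `[tau - 1, tau + 2].
have [mI mT1 mT3] : [/\ measurable I, measurable T1 & measurable T3] by split; exact: measurable_itv.
have mE := measurable_circ_energy_pair a N beta s c12.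
rewrite (@integral_rect_exchange T3 I (fun p => circ_energy (vtwist a p.1) N beta c s p.2)) //=;
  last by move=> p; exact: circ_energy_ge0.
pose E (p : R * R) := cabs2 (dpartial a ((2^-1 + psi_re c p.1) +i* p.2) N) * p.1 `^ (beta - 1).
have E0 p : 0 <= E p by rewrite mulr_ge0 ?cabs2_ge0 ?powR_ge0.
have m1 : measurable_fun setT (fun p : R * R => p.1) by exact: measurable_fst.
have m2 : measurable_fun setT (fun p : R * R => p.2) by exact: measurable_snd.
have mre : measurable_fun setT (psi_re c : R -> R).
  by apply: continuous_measurable_fun; exact: continuous_psi_re.
have mEE : measurable_fun setT E.
  apply: measurable_funM; last exact: (measurableT_comp (measurable_powR _)).
  apply: (measurableT_comp (measurable_cabs2_dpartial a N)
    (g := fun p : R * R => (2^-1 + psi_re c p.1, p.2))).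
  by apply: measurable_fun_pair => //; apply: measurable_funD => //; exact: (measurableT_comp mre).
have C0 : 0 <= 4 / 3 * 2 `^ beta :> R by rewrite mulr_ge0 ?powR_ge0.
have step1 : (\int[mu]_(q in I) \int[mu]_(t in T1) (E (q, t))%:E <=
    \int[mu]_(q in I) \int[mu]_(g in T3) (circ_energy (vtwist a g) N beta c s q)%:E)%E.
  apply: ge0_le_integral => //.
  - by move=> q _; apply: integral_ge0 => t _; rewrite lee_fin.
  - apply: (@measurable_inner R I T1 E) => //; exact: measurable_funTS.
  - apply: (@measurable_inner R I T3 (fun p => circ_energy (vtwist a p.2) N beta c s p.1)) => //.
    + apply: measurable_funTS; apply: (measurableT_comp mE (g := fun p : R * R => (p.2, p.1))).
      exact: measurable_fun_pair.
    + by move=> p _; exact: circ_energy_ge0.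
  move=> q; rewrite /I /= in_itv /= => /andP[qq1 qq2].
  have qb : 0 <= q <= 1 by apply/andP; split; lra.
  have := psi_im_le1 c12 s1 qb; rewrite ler_norml => /andP[t1 t2].
  pose G (y : R) := cabs2 (dpartial a ((2^-1 + psi_re c q) +i* y) N) * q `^ (beta - 1).
  have cG : continuous G.
    by move=> y; apply: cvgM; [exact: continuous_cabs2_dpartial|exact: cvg_cst].
  have tt : tau < tau + 1 by rewrite ltrDl.
  apply: (le_trans (integral_shift_le (psi_im c s q) tt cG (fun y => E0 (q, y)))).
  have eG (x : R) : G (x + psi_im c s q) = circ_energy (vtwist a x) N beta c s q.
    by rewrite circ_energy_vtwist.
  under eq_integral => x _ do rewrite eG.
  apply: ge0_subset_integral => //; try exact: measurable_itv.
  - apply/measurable_EFinP; apply: measurable_funTS.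
    exact: (measurableT_comp mE (measurable_fun_pair (@measurable_id _ _ _) (measurable_cst q))).
  - by move=> x _; rewrite lee_fin circ_energy_ge0.
  - move=> x; move: (x : R) => {}x; rewrite /T3 /= !in_itv /= => /andP[x1 x2].
    by apply/andP; split; lra.
apply: le_trans (lee_wpmul2l _ step1); last by rewrite lee_fin.
rewrite (integral_rect_exchange mI mT1 mEE E0).
have EI t : measurable_fun I (fun q : R => (E (q, t))%:E).
  apply/measurable_EFinP; apply: measurable_funTS.
  exact: (measurableT_comp mEE (measurable_fun_pair (@measurable_id _ _ _) (measurable_cst t))).
have mT : measurable_fun T1 (fun t : R => \int[mu]_(q in I) (E (q, t))%:E)%E.
  apply: (@measurable_inner R T1 I (fun p => E (p.2, p.1))) => //.
  apply: measurable_funTS; apply: (measurableT_comp mEE (g := fun p : R * R => (p.2, p.1))).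
  exact: measurable_fun_pair.
have T0 t : (0 <= \int[mu]_(q in I) (E (q, t))%:E)%E.
  by apply: integral_ge0 => q _; rewrite lee_fin.
rewrite -(ge0_integralZl_EFin mu mT1 (fun t _ => T0 t) mT C0).
have mW := measurable_weighted a N beta.
apply: ge0_le_integral; first exact: mT1.
- by move=> t _; apply: integral_ge0 => x _; rewrite lee_fin mulr_ge0 ?cabs2_ge0 ?powR_ge0.
- apply: (@measurable_inner R T1 `[2^-1 + 4 / 3 * q1, 1]
    (fun p => cabs2 (dpartial a (p.2 +i* p.1) N) * (p.2 - 2^-1) `^ (beta - 1))) => //.
  + apply: measurable_funTS.
    apply: (measurableT_comp mW (g := fun p : R * R => (p.2, p.1))).
    exact: measurable_fun_pair.
  + by move=> p _; rewrite mulr_ge0 ?cabs2_ge0 ?powR_ge0.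
- exact: measurable_funeM.
move=> t _; pose G (x : R) := cabs2 (dpartial a (x +i* t) N) * (x - 2^-1) `^ (beta - 1).
have G0 x : 0 <= G x by rewrite mulr_ge0 ?cabs2_ge0 ?powR_ge0.
have mG : measurable_fun setT G.
  exact: (measurableT_comp mW (measurable_fun_pair (@measurable_id _ _ _) (measurable_cst t))).
have i1 : q1 \in `[0, 1]%R by rewrite in_itv /=; apply/andP; split; lra.
have q2 : q1 < 2^-1 by lra.
have re1 : psi_re c q1 <= 4 / 3 * q1 by apply: psi_re_le => //; exact: ltW.
have re2 : 2^-1 <= psi_re c 2^-1 by apply: psi_re_ge => //; apply/andP; split; lra.
have re0 : q1 <= psi_re c q1 by apply: psi_re_ge => //; apply/andP; split; lra.
apply: (@le_trans _ _ (\int[mu]_(x in `[(2^-1 + psi_re c q1)%R, (2^-1 + psi_re c 2^-1)%R]) (G x)%:E)%E).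
  apply: ge0_subset_integral => //; try exact: measurable_itv.
  - by apply/measurable_EFinP; exact: measurable_funTS.
  - by move=> x _; rewrite lee_fin; exact: G0.
  - move=> x; move: (x : R) => {}x; rewrite /= !in_itv /= => /andP[x1 x2].
    by apply/andP; split; lra.
have sub := @integral_subst_le R (fun q => 2^-1 + psi_re c q) (dpsi_re c) G q1 2^-1 (4 / 3) q2.
have h1 : {in `[q1, 2^-1]%R &, {homo (fun q => 2^-1 + psi_re c q) : x y / x < y}}.
  move=> x y; rewrite !in_itv /= => /andP[x1 x2] /andP[y1 y2] xy; rewrite ltrD2l.
  by apply: psi_re_homo => //; rewrite in_itv /=; apply/andP; split; lra.
have h2 x : is_derive x (1 : R) (fun q => 2^-1 + psi_re c q) (dpsi_re c x).
  have h := is_derive_psi_re c12 x; apply: is_derive_eq.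
  by rewrite scaler0 add0r mul1r.
have h3 x : q1 <= x <= 2^-1 -> 0 <= dpsi_re c x <= 4 / 3.
  by move=> /andP[x1 x2]; apply: dpsi_re_bounds => //; apply/andP; split; lra.
have h4 : {within `[2^-1 + psi_re c q1, 2^-1 + psi_re c 2^-1], continuous G}.
  apply: continuous_in_subspaceT => x /[!inE] /=; rewrite in_itv /= => /andP[x1 x2].
  by apply: continuous_weighted; lra.
have h5 : measurable_fun setT (fun q : R => G (2^-1 + psi_re c q)).
  exact: (measurableT_comp mG (measurable_funD (measurable_cst _) mre)).
apply: (le_trans (sub h1 h2 (continuous_dpsi_re c12) h3 G0 h4 h5)).
clear sub; rewrite (EFinM (4 / 3) (2 `^ beta)) -muleA; apply: lee_wpmul2l; first by rewrite lee_fin.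
have EI0 (q : measurableTypeR R) : I q -> (0 <= (E (q, t))%:E)%E.
  by move=> _; rewrite lee_fin; exact: E0.
rewrite -(ge0_integralZl_EFin mu mI EI0 (EI t) (powR_ge0 2 beta)).
apply: ge0_le_integral; first exact: mI.
- by move=> q _; rewrite lee_fin; exact: G0.
- by apply/measurable_EFinP; exact: measurable_funTS.
- by apply: measurable_funeM; exact: EI.
move=> q; rewrite /I /= in_itv /= => /andP[qq1 qq2]; rewrite -EFinM lee_fin /G /E /=.
rewrite (_ : 2^-1 + psi_re c q - 2^-1 = psi_re c q); last by ring.
rewrite [leRHS]mulrCA ler_wpM2l ?cabs2_ge0 //.
have qp : 0 < q by exact: lt_le_trans qq1.
have qb : 0 <= q <= 1 by apply/andP; split; lra.
apply: powR_pred_comparable => //; rewrite psi_re_ge //=.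
by apply: (le_trans (psi_re_le c12 (ltW qp))); rewrite ler_wpM2r ?(ltW qp) //; lra.
Qed.

End exchange.

(** * Passage to the critical line and the Carleson condition *)

Section conclusion.
Variable R : realType.
Local Notation mu := (@lebesgue_measure R).
Implicit Types (a : nat -> R[i]) (alpha beta : R).

(** The estimates hold only at positive distance from the critical line; monotone convergence
    exhausts ]1/2, 1], and the remaining endpoint is a null set. *)
Lemma integral_limit_le (f : R -> \bar R) (X : R) :
  measurable_fun (`[2^-1, 1] : set (measurableTypeR R)) f -> (forall x, (0 <= f x)%E) ->
  (forall q1, 0 < q1 < 4^-1 -> (\int[mu]_(x in `[(2^-1 + 4 / 3 * q1)%R, 1%R]) f x <= X%:E)%E) ->
  (\int[mu]_(x in `[2^-1%R, 1%R]) f x <= X%:E)%E.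
Proof.
move=> mf f0 hX.
pose I : set (measurableTypeR R) := `]2^-1, 1].
(* Starting at 1/4 makes q1 = 3 / (4 (n + 4)) smaller than 1/4 for every n. *)
pose F (n : nat) : set (measurableTypeR R) := `[2^-1 + n.+4%:R^-1, 1].
have inv0 n : 0 < n.+4%:R^-1 :> R by rewrite invr_gt0.
have mS (A : set (measurableTypeR R)) : measurable A -> A `<=` `[2^-1, 1] -> measurable_fun A f.
  by move=> mA sA; apply: measurable_funS mf => //; exact: measurable_itv.
have FI n : F n `<=` `[2^-1, 1].
  move=> x; move: (x : R) => {}x; rewrite /F /= !in_itv /= => /andP[x1 ->]; rewrite andbT.
  by apply: le_trans x1; rewrite lerDl ltW.
have II : I `<=` `[2^-1, 1].
  by move=> x; rewrite /I /= !in_itv /= => /andP[x1 ->]; rewrite (ltW x1).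
have mI : measurable I by exact: measurable_itv.
have bF : \bigcup_n F n = I.
  apply/seteqP; split => x; move: (x : R) => {}x.
    move=> [n _]; rewrite /F /I /= !in_itv /= => /andP[x1 ->]; rewrite andbT.
    by apply: lt_le_trans x1; rewrite ltrDl.
  rewrite /I /= in_itv /= => /andP[x1 x2].
  have d0 : 0 < x - 2^-1 by rewrite subr_gt0.
  exists (Num.bound (x - 2^-1)^-1) => //; rewrite /F /= in_itv /= x2 andbT -lerBrDl.
  rewrite invf_ple ?posrE // ltW // (lt_le_trans (archi_boundP _)) ?invr_ge0 ?(ltW d0) //.
  by rewrite ler_nat -addn4 leq_addr.
have := @ge0_nondecreasing_set_cvg_integral _ _ R F f mu _ _ _ _.
rewrite bF => lim.
have {lim} hI : (\int[mu]_(x in I) f x <= X%:E)%E.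
  have cv : (fun n => \int[mu]_(x in F n) f x)%E @ \oo --> (\int[mu]_(x in I) f x)%E.
    apply: lim.
    - move=> m n mn; apply/subsetPset => x; move: (x : R) => {}x; rewrite /F /= !in_itv /= => /andP[x1 ->].
      rewrite andbT; apply: le_trans x1; rewrite lerD2l lef_pV2 ?posrE // ler_nat.
      by rewrite !ltnS.
    - by move=> n; exact: measurable_itv.
    - by move=> n; apply: mS => //; exact: measurable_itv.
    - by move=> n x _.
  rewrite -(cvg_lim _ cv) //; apply: lime_le; first by apply/cvg_ex; exists (\int[mu]_(x in I) f x)%E.
  near=> n; rewrite /F.
  have -> : n.+4%:R^-1 = 4 / 3 * (3 / 4 * n.+4%:R^-1) :> R by field.
  have i4 : n.+4%:R^-1 <= 4^-1 :> R by rewrite lef_pV2 ?posrE // ler_nat.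
  move: (n.+4%:R^-1) (inv0 n) i4 => z z0 z4; apply: hX; clear -z0 z4.
  by apply/andP; split; lra.
have sI : `[2^-1, 1] `<=` [set 2^-1] `|` I.
  move=> x; move: (x : R) => {}x; rewrite /I /= !in_itv /= => /andP[x1 ->]; rewrite andbT.
  by move: x1; rewrite le_eqVlt => /orP[/eqP <-|]; [left|right].
have m1 : measurable ([set 2^-1] : set (measurableTypeR R)) by exact: measurable_set1.
have sU : [set 2^-1] `|` I `<=` `[2^-1, 1].
  by move=> x [->|/II //]; rewrite /= in_itv /= lexx /= invf_le1 // ler1n.
have mU := mS _ (measurableU _ _ m1 mI) sU.
have h1 := ge0_subset_integral mu (measurable_itv `[2^-1, 1]%R) (measurableU _ _ m1 mI) mU
  (fun x _ => f0 x) sI.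
have h2 := ge0_integral_setU_le mu m1 mI mU (fun x _ => f0 x).
apply: (le_trans h1); apply: (le_trans h2).
by rewrite integral_set1 add0e.
Unshelve. all: by end_near.
Qed.

Lemma sume_cst (x : \bar R) n : (\sum_(j < n) x = n%:R%:E * x)%E.
Proof.
elim: n => [|n IH]; first by rewrite big_ord0 mul0e.
by rewrite big_ord_recr /= IH -natr1 EFinD ge0_muleDl ?mul1e // lee_fin.
Qed.

Lemma modc_vtwist a g n : (0 < n)%N -> modc (vtwist a g n) = modc (a n).
Proof. by move=> n0; rewrite /modc cabs2_vtwist. Qed.

(** Each of the L kept angles bounds the same integral, so L copies of it are at most a constant
    times the total energy, which is proportional to 6 L. The number of samples cancels, and the
    accuracy e can tend to 0 although L depends on it. *)
Lemma slab_tail_le alpha beta K : 0 < beta -> psi_bound alpha beta K ->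
  exists2 K', 0 < K' & forall a N tau q1, 0 < q1 < 4^-1 ->
  (\int[mu]_(x in `[(2^-1 + 4 / 3 * q1)%R, 1%R]) slab a N x ((x - 2^-1) `^ (beta - 1))%R tau <=
   (K' * (K * wsum alpha a N))%:E)%E.
Proof.
move=> b0 hK; have [C C0 hC] := sum_circ_energy_le b0.
have B0 : 0 < 2 `^ beta :> R by rewrite powR_gt0.
(* Here 24 = (4/3) * 3 * 6: the Jacobian bound, the length of [tau - 1, tau + 2] and the ratio of
   all samples to those kept. *)
exists (24 * 2 `^ beta * (4 * C)); first by rewrite !mulr_gt0.
move=> a N tau q1 q14; have [q0 q4] := andP q14.
have q12 : 0 < q1 < 2^-1 by apply/andP; split; lra.
set Y := K * wsum alpha a N.
pose I : set (measurableTypeR R) := `[q1, 2^-1].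
pose T3 : set (measurableTypeR R) := `[tau - 1, tau + 2].
pose T1 : set (measurableTypeR R) := `[tau, tau + 1].
pose S1 : set (measurableTypeR R) := `[2^-1 + 4 / 3 * q1, 1].
have [mI mT3 mT1 mS1] : [/\ measurable I, measurable T3, measurable T1 & measurable S1].
  by split; exact: measurable_itv.
have r1 : 0 < - (ln ((1 - q1) / (1 + q1)) / ln 2).
  have l2 : 0 < ln (2 : R) by rewrite ln_gt0 // ltr1n.
  have l1 : ln ((1 - q1) / (1 + q1)) < 0.
    apply: ln_lt0; apply/andP; split; first by rewrite divr_gt0; lra.
    by rewrite ltr_pdivrMr; lra.
  by rewrite oppr_gt0 pmulr_llt0 // invr_gt0.
set eps := - (ln ((1 - q1) / (1 + q1)) / ln 2) / 2.
have eps0 : 0 < eps by rewrite divr_gt0.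
have epsr : eps < - (ln ((1 - q1) / (1 + q1)) / ln 2).
  by rewrite /eps ltr_pdivrMr // ltr_pMr // ltr1n.
set A := (\int[mu]_(x in _) _)%E.
have AE : A = (\int[mu]_(t in T1) \int[mu]_(x in S1)
    (cabs2 (dpartial a (x +i* t) N) * (x - 2^-1) `^ (beta - 1))%:E)%E.
  rewrite /A /slab.
  exact: (@integral_rect_exchange R S1 T1 _ mS1 mT1 (measurable_weighted a N beta)
    (weighted_ge0 a N beta)).
clearbody A.
have key e : 0 < e -> (A <= (24 * 2 `^ beta * (4 * C * Y + 6 * e ^+ 2 / q1))%:E)%E.
  move=> e0; have [D0 hD0] := dpartial_psi_degree a N eps0 e0.
  pose D := maxn D0 1; pose L := (trunc_log 2 D).+1; pose J := (6 * L)%N.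
  pose th (j : nat) : R := j%:R * (2 * pi / J%:R).
  pose E (j : nat) (g q : R) := circ_energy (vtwist a g) N beta (cos (th j)) (sin (th j)) q.
  have hg g : (\sum_(j < L) \int[mu]_(x in I) (E j g x)%:E <=
      (J%:R * (4 * C * Y + 6 * e ^+ 2 / q1))%:E)%E.
    have le n : (0 < n)%N -> modc (vtwist a g n) <= modc (a n) by move=> n0; rewrite modc_vtwist.
    have [q [hq1 hq2 hq3]] := hD0 (vtwist a g) le.
    have [h h1 h2] := hK (vtwist a g) N; rewrite wsum_vtwist -/Y in h2.
    apply: (hC (vtwist a g) h N q1 e eps D q Y q12 (ltW e0) eps0 epsr h1 h2 hq1).
    - by move=> n; rewrite gtn_max => /andP[n0 _]; exact: hq2.
    - by rewrite /D leq_maxr.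
    - by move=> s es; rewrite (dpartial_extend _ (leq_maxl D0 1) hq2); exact: hq3.
  have c12 (j : 'I_L) : 2^-1 <= cos (th j) <= 1.
    exact: cos_sample.
  have E0 j g q : (0 <= (E j g q)%:E)%E by rewrite lee_fin circ_energy_ge0.
  have mIE (j : 'I_L) : measurable_fun T3 (fun g : R => \int[mu]_(x in I) (E j g x)%:E)%E.
    apply: (@measurable_inner R T3 I (fun p => E j p.1 p.2)) => //.
      by apply: measurable_funTS; exact: measurable_circ_energy_pair.
    by move=> p _; exact: circ_energy_ge0.
  have IE0 j g : (0 <= \int[mu]_(x in I) (E j g x)%:E)%E.
    by apply: integral_ge0 => x _; exact: E0.
  have hj (j : 'I_L) : (A <= (4 / 3 * 2 `^ beta)%:E *
      \int[mu]_(g in T3) \int[mu]_(q in I) (E j g q)%:E)%E.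
    by rewrite AE; apply: circ_energy_lower => //; exact: sin_max.
  have hS : (\sum_(j < L) \int[mu]_(g in T3) \int[mu]_(q in I) (E j g q)%:E <=
      (3 * (J%:R * (4 * C * Y + 6 * e ^+ 2 / q1)))%:E)%E.
    rewrite -(@ge0_integral_sum _ _ _ mu T3 mT3 'I_L (fun j g => \int[mu]_(q in I) (E j g q)%:E)%E
      (fun j => mIE j) (fun j g _ => IE0 j g)).
    have T3m : mu T3 = 3%:E.
      rewrite [LHS](lebesgue_measure_itv `[tau - 1, tau + 2]%R) /= lte_fin.
      rewrite (_ : tau - 1 < tau + 2) -?EFinD; last by lra.
      by congr _%:E; ring.
    apply: (@le_trans _ _ (\int[mu]_(g in T3) cst (J%:R * (4 * C * Y + 6 * e ^+ 2 / q1))%:E g)%E).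
      apply: ge0_le_integral => //.
      - by move=> g _; apply: sume_ge0 => j _; exact: IE0.
      - by apply: emeasurable_sum => j; exact: mIE.
    by rewrite integral_cst // [X in (_ * X)%E]T3m -EFinM mulrC.
  have : (\sum_(j < L) A <= (4 / 3 * 2 `^ beta)%:E *
      (3 * (J%:R * (4 * C * Y + 6 * e ^+ 2 / q1)))%:E)%E.
    apply: (@le_trans _ _ ((4 / 3 * 2 `^ beta)%:E *
        \sum_(j < L) \int[mu]_(g in T3) \int[mu]_(q in I) (E j g q)%:E)%E).
      rewrite ge0_sume_distrr; last by move=> j _; apply: integral_ge0 => g _; exact: IE0.
      by apply: lee_sum => j _; exact: hj.
    by apply: lee_wpmul2l => //; rewrite lee_fin mulr_ge0 ?(ltW B0).
  have L0 : (0 : R) < L%:R by [].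
  rewrite sume_cst -EFinM -lee_pdivlMl // -EFinM => h; apply: (le_trans h).
  rewrite lee_fin le_eqVlt; apply/orP; left; apply/eqP.
  have JE : (J%:R : R) = 6 * L%:R by rewrite natrM.
  by rewrite JE; field; rewrite !gt_eqF.
apply/lee_addgt0Pr => d d0.
(* With this value of e^2 the error 24 * 2^beta * 6 e^2 / q1 is exactly d. *)
have e0 : 0 < d * q1 / (144 * 2 `^ beta) by rewrite divr_gt0 ?mulr_gt0.
apply: (le_trans (key (Num.sqrt (d * q1 / (144 * 2 `^ beta))) _)); first by rewrite sqrtr_gt0.
rewrite -EFinD lee_fin sqr_sqrtr ?(ltW e0) // le_eqVlt; apply/orP; left; apply/eqP.
by field; rewrite !gt_eqF.
Qed.

Lemma carleson_of_comp_bounded alpha beta : 0 < alpha -> 0 < beta ->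
  comp_bounded alpha beta (@psi R) ->
  exists K : R, forall (N : nat) a (tau : R),
    (carleson_int beta N a tau <= K%:E * Dnorm2 alpha (trunc N a))%E.
Proof.
move=> a0 b0 hpsi; have [K K0 hK] := psi_bound_of_comp_bounded (ltW b0) hpsi.
have [K' K'0 h] := slab_tail_le b0 hK; exists (K' * K) => N a tau.
rewrite Dnorm2_trunc -EFinM -mulrA carleson_slab.
apply: integral_limit_le.
- by apply: measurable_slab; exact: measurable_itv.
- by move=> x; rewrite slab_ge0 ?powR_ge0.
- by move=> q1; exact: h.
Qed.

End conclusion.

Theorem theorem2p2 (R : realType) (alpha beta : R) :
  0 < alpha -> 0 < beta ->
  let A := exists K : R, forall (N : nat) (a : nat -> R[i]) (tau : R),
             (carleson_int beta N a tau <= K%:E * Dnorm2 alpha (trunc N a))%E in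
  let B := forall (c : nat -> R[i]) (phi : R[i] -> R[i]),
             GH_char0 c phi -> comp_bounded alpha beta phi in
  let Cc := comp_bounded alpha beta (@psi R) in
  (A <-> B) /\ (B <-> Cc).
Proof.
move=> a0 b0 A B Cc.
have AB : A -> B by exact: comp_bounded_of_carleson.
have BC : B -> Cc by move=> hB; exact: hB (psi_GH R).
have CA : Cc -> A by exact: carleson_of_comp_bounded.
by split; split=> // h; [exact/CA/BC|exact/AB/CA].
Qed.
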